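(* Let $\Gamma$ be any tree of height $N\le\infty$, let $\{X(\sigma):\sigma\neq\rho\}$ be i.i.d. real random variables, and let $B\subset\mathbf{R}^N$ be any target set. Let $\mathcal{S}(\Gamma)$ be the (virtual) spherically symmetric tree with growth function $f(n)=|\Gamma_n|/|\Gamma_{n-1}|$. Let $\mathcal{S}(B)$ be a Cartesian product target set $\{y\in\mathbf{R}^N: y_i\le b_i\text{ for all finite } i\le N\}$, with $b_i$ chosen so that $$\prod_{i=1}^n\mathbf{P}(X(\sigma)\le b_i)=p(B;n)\quad\text{for all finite } n\le N.$$ Then $$\mathbf{P}(B;\rho\leftrightarrow\partial\Gamma)\ \le\ \mathbf{P}(B;\rho\leftrightarrow\partial\mathcal{S}(\Gamma))\ \le\ \mathbf{P}(\mathcal{S}(B);\rho\leftrightarrow\partial\mathcal{S}(\Gamma))$$ $$\le\ 2\left[p(B;N)^{-1}|\Gamma_N|^{-1}+\sum_{k=0}^{N-1}p(B;k)^{-1}\big(|\Gamma_k|^{-1}-|\Gamma_{k+1}|^{-1}\big)\right]^{-1},$$ where the term $p(B;N)^{-1}|\Gamma_N|^{-1}$ appears only if $N<\infty$ (and for $N=\infty$ the sum is over all $k\ge0$). If $\mathcal{S}(\Gamma)$ exists as a tree, i.e. $f(n)$ is an integer for all $n$, then the last expression is precisely $2\,\mathrm{Cap}_p(\mathcal{S}(\Gamma))$, where $p$ is the gauge $p(n)=p(B;n)$.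
   Context: Trees here are locally finite rooted trees with root $\rho$, of height $N\le\infty$: if $N=\infty$ the tree is infinite without leaves; if $N<\infty$ all maximal paths from the root have length $N$. $|\sigma|$ is the distance from $\rho$ to $\sigma$, $\Gamma_n=\{\sigma:|\sigma|=n\}$, and $|\Gamma_n|$ is its cardinality. Maximal paths from the root are called rays; $\partial\Gamma$ is the set of rays (identified with $\Gamma_N$ if $N<\infty$). Target percolation: given i.i.d. real $\{X(\sigma):\sigma\ne\rho\}$ and a closed set $B\subseteq\mathbf{R}^N$ (the target set), let $W$ be the set of vertices consisting of $\rho$ and all $\sigma\in\Gamma_k$, $1\le k\le N$ finite, such that $(X(\tau_1),\ldots,X(\tau_k))\in\pi_kB$, where $\rho,\tau_1,\ldots,\tau_k=\sigma$ is the path from $\rho$ to $\sigma$ and $\pi_k$ is projection to the first $k$ coordinates. $\{\rho\leftrightarrow\sigma\}$ is the event that $W$ contains the path from $\rho$ to $\sigma$, and $\{\rho\leftrightarrow\partial\Gamma\}$ the event that $W$ contains a ray; $\{\rho\not\leftrightarrow\partial\Gamma\}$ is the complement. $\mathbf{P}(B;\cdot)$ indicates the target set used, and $p(B;n)=\mathbf{P}(B;\rho\leftrightarrow\sigma)$ for $|\sigma|=n$ (so $p(B;0)=1$). Conventions $1/0=\infty$, $1/\infty=0$. Virtual spherically symmetric trees: a spherically symmetric tree with growth function $f$ is one where each vertex in level $n-1$ has $f(n)$ children. For positive real $f$ (not necessarily integer), $\mathbf{P}(B;\rho\leftrightarrow\partial\mathcal{S}(\Gamma))=1-\mathbf{P}(B;\rho\not\leftrightarrow\partial\mathcal{S}(\Gamma))$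 is defined for $N<\infty$ by $\mathbf{P}(B;\rho\not\leftrightarrow\partial\mathcal{S}(\Gamma))=\Psi(B;f(1),\ldots,f(N))$, where, with $X$ distributed as the $X(\sigma)$: $\Psi(B;a)=\mathbf{P}(X\notin B)^a$ for $B\subseteq\mathbf{R}$, $a>0$; and $\Psi(B;a_1,\ldots,a_n)=\big[\mathbf{E}\,\Psi(B/X;a_2,\ldots,a_n)\big]^{a_1}$ for $B\subseteq\mathbf{R}^n$, where $B/x=\{y\in\mathbf{R}^{n-1}:(x,y_1,\ldots,y_{n-1})\in B\}$. For $N=\infty$, $\mathbf{P}(B;\rho\leftrightarrow\partial\mathcal{S}(\Gamma))$ is the limit as $n\to\infty$ of $1-\Psi(\pi_nB;f(1),\ldots,f(n))$. For integer $f$ this agrees with the probability on the actual tree. Capacity: for a gauge $p$, $\mathrm{Cap}_p(\Lambda)^{-1}$ is the infimum over probability measures $\mu$ on $\partial\Lambda$ of $I_p(\mu)=\int\int p(|\xi\wedge\eta|)^{-1}d\mu(\xi)d\mu(\eta)$, where $\xi\wedge\eta$ is the vertex where rays $\xi,\eta$ diverge (with $|\xi\wedge\xi|$ equal to the height of the tree, and $p(\infty)=\lim_n p(n)$).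
   Formalization: The identity with 2 Cap_p(S(Γ)) is stated, when N = ∞, only for |Γ_n| unbounded; it is false as printed for a single infinite ray with B = R^∞, where the last expression is ∞ but Cap_p = 1. The inequalities carry no such restriction. *)

(* Defs.v *)
From HB Require Import structures.
From mathcomp Require Import all_boot all_order all_algebra finmap.
From mathcomp Require Import all_classical all_reals all_analysis.

Set Implicit Arguments.
Unset Strict Implicit.
Unset Printing Implicit Defensive.
Import Order.TTheory GRing.Theory Num.Theory.
Import numFieldNormedType.Exports.

Local Open Scope classical_set_scope.
Local Open Scope ring_scope.
Local Open Scope ereal_scope.

(* A locally finite rooted tree is given by its parent function (whose value
   at the root is irrelevant).  The two axioms on [level] force [level s] to be
   the number of steps from [s] to the root, so every vertex is connected to
   the root and there are no cycles. *)
Record rooted_tree := RootedTree {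
  vertex :> choiceType;
  tree_root : vertex;
  parent : vertex -> vertex;
  level : vertex -> nat;
  level_tree_root : level tree_root = 0%N;
  level_parent : forall s, s <> tree_root -> level s = (level (parent s)).+1;
  locally_finite : forall s, finite_set [set t | t <> tree_root /\ parent t = s]
}.
Arguments tree_root {_}.
Arguments parent {_}.
Arguments level {_}.

(* Heights and levels at infinity live in N \cup {oo}; [None] is oo. *)
Definition leh (k : nat) (N : option nat) : Prop :=
  if N is Some n then (k <= n)%N : Prop else True.
Definition lth (k : nat) (N : option nat) : Prop :=
  if N is Some n then (k < n)%N : Prop else True.

Section Tree.
Variable T : rooted_tree.
Implicit Types s t : T.

Definition children s : set T := [set t | t <> tree_root /\ parent t = s].

Definition leaf s : Prop := children s = set0.

(* N = oo: no leaves; N = n: the leaves are exactly the vertices of level n,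
   so that all maximal paths from the root have length n. *)
Definition has_height (N : option nat) : Prop :=
  forall s, leaf s <-> N = Some (level s).

Definition level_set (n : nat) : set T := [set s | level s = n].

Definition level_size (n : nat) : nat := #|` fset_set (level_set n)|.

(* The ancestor of [s] at level [j <= level s]. *)
Definition ancestor s (j : nat) : T := iter (level s - j) parent s.

(* A maximal path from the root as a sequence of vertices; a path that reaches
   a leaf stays there forever. *)
Definition is_ray (xi : nat -> T) : Prop :=
  xi 0%N = tree_root /\
  forall n, children (xi n) (xi n.+1) \/ (leaf (xi n) /\ xi n.+1 = xi n).

Definition ray : Type := {xi : nat -> T | is_ray xi}.

Lemma ray_exists : {xi : nat -> T | is_ray xi}.
Proof.
exists (fun n => iter n (fun s => xget s (children s)) tree_root); split => // n /=.
case: xgetP => [t _ ?|no]; first by left.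
by right; split=> //; apply/seteqP; split => // t /no.
Qed.

HB.instance Definition _ := gen_eqMixin ray.
HB.instance Definition _ := gen_choiceMixin ray.
HB.instance Definition _ := isPointed.Build ray ray_exists.

Definition cylinders : set (set ray) :=
  [set C | exists (n : nat) (s : T), C = [set xi | sval xi n = s]].

(* The boundary with the sigma-algebra generated by the cylinders, which is
   its Borel sigma-algebra. *)
Definition boundary := g_sigma_algebraType cylinders.

(* |xi /\ eta|: one less than the first index at which the rays differ, and
   the height of the tree if xi = eta. *)
Definition meet_level (N : option nat) (xi eta : ray) : option nat :=
  match pselect (exists n, sval xi n != sval eta n) with
  | left ne => Some (ex_minn ne).-1
  | right _ => N
  end.

End Tree.

Section Capacity.
Variable R : realType.

Definition gauge_at (p : nat -> \bar R) (h : option nat) : \bar R :=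
  if h is Some n then p n else limn p.

Definition energy (T : rooted_tree) (N : option nat) (p : nat -> \bar R)
    (mu : probability (boundary T) R) : \bar R :=
  \int[mu]_xi \int[mu]_eta (gauge_at p (meet_level N xi eta))^-1.

(* In [\bar R], 0^-1 = +oo and +oo^-1 = 0. *)
Definition capacity (T : rooted_tree) (N : option nat) (p : nat -> \bar R) :
    \bar R :=
  (ereal_inf (range (@energy T N p)))^-1.

End Capacity.

Section Growth.
Variables (R : realType) (T : rooted_tree).

Definition growth (n : nat) : R :=
  ((level_size T n)%:R / (level_size T n.-1)%:R)%R.

Definition spherically_symmetric (N : option nat) (f : nat -> R) : Prop :=
  has_height T N /\
  forall s : T, lth (level s) N ->
    (#|` fset_set (children s)|%:R = f (level s).+1 :> R)%R.

End Growth.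

(* Coordinates of R^N are numbered from 0. *)
Definition coordinate (N : option nat) : Type :=
  if N is Some n then 'I_n else nat.
Definition coordinate_index (N : option nat) : coordinate N -> nat :=
  match N return coordinate N -> nat with
  | Some n => fun i => nat_of_ord i
  | None => fun i => i
  end.

Section Target.
Variable R : realType.

(* pi_k B, for k <= N. *)
Definition proj_target (N : option nat) (B : set (coordinate N -> R)) (k : nat) :
    set (k.-tuple R) :=
  [set t | exists2 y, B y &
     forall i : coordinate N, (coordinate_index i < k)%N -> y i = nth 0%R t (coordinate_index i)].

(* The bounds are extended reals because the required bound may be infinite,
   e.g. +oo when p(B; n) = 1 and the law is unbounded. *)
Definition product_target (N : option nat) (b : nat -> \bar R) :
    set (coordinate N -> R) :=
  [set y | forall i : coordinate N, (y i)%:E <= b (coordinate_index i)].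

Definition section_target (n : nat) (B : set (n.+1.-tuple R)) (x : R) :
    set (n.-tuple R) := [set y : n.-tuple R | B [tuple of x :: y]].

End Target.

(* Projections of closed sets need not be Borel, only analytic, hence
   universally measurable.  Probabilities are therefore taken with respect to
   the completion of the measure, whose value is given by the outer measure
   [mu^*]; it agrees with [mu] on measurable sets. *)
Definition Pr d (T : measurableType d) (R : realType) (P : probability T R)
  (A : set T) : \bar R := (P^*)%mu A.

Section Percolation.
Context {R : realType} {d : measure_display} {Omega : measurableType d}.
Variables (P : probability Omega R) (T : rooted_tree).
Variable (X : T -> {RV P >-> R}).

(* The variables X(s), s <> root, are i.i.d. with law mu; X(root) is unused. *)
Definition iid (mu : probability R R) : Prop :=
  (forall s, s <> tree_root -> forall E : set R, measurable E ->
     P (X s @^-1` E) = mu E) /\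
  (forall (J : {fset T}) (E : T -> set R), tree_root \notin J ->
     (forall s, measurable (E s)) ->
     P (\bigcap_(s in [set` J]) (X s @^-1` E s)) =
     \prod_(s <- J) P (X s @^-1` E s)).

Variables (N : option nat) (B : set (coordinate N -> R)).

(* (X(tau_1), ..., X(tau_k)) along the path root, tau_1, ..., tau_k = s. *)
Definition path_labels (s : T) (w : Omega) : (level s).-tuple R :=
  [tuple X (ancestor s i.+1) w | i < level s].

Definition retained (w : Omega) : set T :=
  [set s | s = tree_root \/ proj_target B (path_labels s w)].

Definition connected_to (s : T) : set Omega :=
  [set w | forall j, (j <= level s)%N -> retained w (ancestor s j)].

Definition connected_to_boundary : set Omega :=
  [set w | exists xi : ray T, forall n, retained w (sval xi n)].

(* p(B; n); by the i.i.d. assumption the choice of the vertex of level n does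
   not matter. *)
Definition hit_prob (n : nat) : \bar R :=
  Pr P (connected_to (xget tree_root (@level_set T n))).

End Percolation.

Section Virtual.
Variables (R : realType) (mu : probability R R).

(* [Psi B a] is Psi(B; a_1, ..., a_n).  With n = 0 the tree is just the root,
   which is always retained. The integral of a nonnegative function is a
   supremum over simple functions below it, so it is also the integral with
   respect to the completion of mu. *)
Fixpoint Psi (n : nat) : set (n.-tuple R) -> n.-tuple R -> \bar R :=
  match n with
  | 0 => fun _ _ => 0
  | m.+1 =>
    match m return (set (m.-tuple R) -> m.-tuple R -> \bar R) ->
                   set (m.+1.-tuple R) -> m.+1.-tuple R -> \bar R with
    | 0 => fun _ B a => (Pr mu [set x | ~ B [tuple x]]) `^ (thead a)
    | k.+1 => fun Psi' B a =>
        (\int[mu]_x Psi' (section_target B x) (behead_tuple a)) `^ (thead a)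
    end (@Psi m)
  end.

Definition survival (n : nat) (B : set (n.-tuple R)) (f : nat -> R) : \bar R :=
  1 - Psi B [tuple f i.+1 | i < n].

(* P(B; root <-> boundary of the virtual tree with growth function f). *)
Definition virtual_survival (N : option nat) (B : set (coordinate N -> R))
    (f : nat -> R) : \bar R :=
  match N with
  | Some n => survival (proj_target B (k := n)) f
  | None => limn (fun n => survival (proj_target B (k := n)) f)
  end.

End Virtual.

Definition inverse_sum (R : realType) (N : option nat) (p : nat -> \bar R)
    (g : nat -> nat) : \bar R :=
  let term k := (p k)^-1 * ((g k)%:R^-1 - (g k.+1)%:R^-1)%:E in
  match N with
  | Some n => (p n)^-1 * ((g n)%:R^-1)%:E + \sum_(0 <= k < n) term k
  | None => \sum_(0 <= k <oo) term k
  end.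

(* Main.v *)
(** Given the labels near the root, the subtrees of the children of the root are
    independent, so the non-survival probability of the tree is a product over
    the children.  By Hoelder's inequality the non-survival probability Psi of a
    virtual tree, as a function of its level sizes M, satisfies
    Psi(M + M') <= Psi(M) Psi(M'); induction then shows that the virtual
    spherically symmetric tree has the largest survival probability.

    Along product targets the survival probability of a virtual tree is a
    concave function of p(B; 1), ..., p(B; n).  The bound given by its tangent
    plane has nonnegative coefficients and, by induction on the height, holds
    for every target with the same p(B; k); at the point of tangency it is the
    survival probability for S(B).

    The last inequality is the recursive application of
    (1 - u)^a >= (2 - (a + 1) u) / (2 + (a - 1) u) for 0 <= u <= 1 <= a.

    The energy of mu is
      sum_k p(k)^-1 (M_k - M_(k+1)),   M_k = sum_(|s| = k) mu(s)^2,
    up to a boundary term.  Since p is nonincreasing, summation by parts and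
    the Cauchy-Schwarz bound M_k >= 1/|Gamma_k| show that it is minimized by
    the uniform measure.

    Projections of closed sets are not Borel in general; they contain and are
    contained in measurable cylinders of almost the same outer measure, by
    compactness, and all estimates are carried out on these. *)

(* Hitting probabilities may vanish and the bracket of the last bound may be infinite, so that bound
   is never proved by dividing: for every real [U] below the bracket, the survival probability times
   [U] is shown to be at most 2. Bounds [b] realising p(B; n) need not exist, for instance when the
   law has atoms. The pivot of the argument is therefore [1 - extinction n q], where [q] can be the
   ratios of successive hitting probabilities. It is defined for every target, and it equals the
   level-n survival probability for S(B) when the bounds exist and none of them is -oo. All targets
   are handled as sets of infinite sequences: projections at different levels become nested
   cylinders, and sections stay in the same type. For infinite height, the identity with the
   capacity is stated for unbounded level sizes. With bounded sizes the uniform measure has atoms,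
   and the diagonal adds to the energy a multiple of the reciprocal limiting gauge, a term which the
   series does not contain. *)
From HB Require Import structures.
Require Import Defs.
From mathcomp Require Import all_boot all_order all_algebra finmap.
From mathcomp Require Import all_classical all_reals all_analysis.
From mathcomp Require Import measurable_realfun ring lra zify.
Import Order.TTheory GRing.Theory Num.Theory.
Import numFieldNormedType.Exports.
Set Implicit Arguments.
Unset Strict Implicit.
Unset Printing Implicit Defensive.
Local Open Scope classical_set_scope.
Local Open Scope ring_scope.

(** * Virtual trees under independent percolation *)

Section Numeric.
Context {R : realType}.
Implicit Types (a u w c : R) (q : nat -> R).

(** Both factors are dominated by exponentials with opposite exponents: ln c <= c - 1 and 1 + x <=
    exp x. With exponent a - 1 this gives the sign of a derivative in the next lemma. *)
Lemma powR_mul_affine_le1 (b c : R) : 0 <= b -> 0 < c <= 1 ->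
  c `^ b * (1 + b * (1 - c)) <= 1.
Proof.
move=> b0 /andP[c0 c1].
rewrite [leRHS](_ : 1 = expR (b * (c - 1)) * expR (b * (1 - c))); last first.
  by rewrite -expRD -mulrDr addrC subrKA subrr mulr0 expR0.
apply: ler_pM; rewrite ?powR_ge0 ?addr_ge0 ?mulr_ge0 ?subr_ge0//.
- rewrite /powR gt_eqF// ler_expR ler_wpM2l//.
  by have := @le_ln1Dx R (c - 1); rewrite [1 + _]addrC subrK; apply; lra.
- exact: expR_ge1Dx.
Qed.

(** With w = 1 - u, the right side minus the left side is [G w - G 1] for the function [G] below.
    [G] is nonincreasing on ]0, 1], since its derivative is (a + 1) (L - 1), where L is the left
    side of the previous lemma. *)
Lemma powR_ge_pade (a u : R) : 1 <= a -> 0 <= u <= 1 ->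
  2 - (a + 1) * u <= (1 - u) `^ a * (2 + (a - 1) * u).
Proof.
move=> a1 /andP[u0 u1].
have [->|u1'] := eqVneq u 1.
  by rewrite subrr powR0 ?gt_eqF ?(lt_le_trans ltr01 a1)//; lra.
pose w := 1 - u.
have w0 : 0 < w by rewrite subr_gt0 lt_neqAle u1'.
have w1 : w <= 1 by rewrite /w; lra.
pose G (x : R) : R := x `^ a * (a + 1 - (a - 1) * x) - (a + 1) * x.
pose dG (x : R) : R := a * x `^ (a - 1) * (a + 1 - (a - 1) * x)
   - (a - 1) * x `^ a - (a + 1).
have dGG (x : R) : 0 < x -> is_derive x 1 G (dG x).
  move=> x0; have := is_derive1_powR a x0 => ?.
  apply: is_derive_eq; rewrite /dG /GRing.scale/=; ring.
have [] := @MVT_segment R G dG w 1 w1.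
- by move=> x; rewrite in_itv/= => /andP[wx _]; apply: dGG; lra.
- apply: derivable_within_continuous => x; rewrite in_itv/= => /andP[wx _].
  by have [] := dGG x (lt_le_trans w0 wx).
move=> c; rewrite in_itv/= => /andP[wc c1] E.
have c0 : 0 < c by exact: lt_le_trans wc.
have dGc : dG c <= 0.
  have ca : c `^ a = c * c `^ (a - 1) by rewrite mulr_powRB1 ?ltW//; lra.
  have := @powR_mul_affine_le1 (a - 1) c; rewrite /dG ca c0 c1 => /(_ _ _).
  move=> H; have {}H := H ltac:(lra) isT.
  have -> : a * c `^ (a - 1) * (a + 1 - (a - 1) * c) -
     (a - 1) * (c * c `^ (a - 1)) - (a + 1)
    = (a + 1) * (c `^ (a - 1) * (1 + (a - 1) * (1 - c)) - 1) by ring.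
  by apply: mulr_ge0_le0; lra.
have : G 1 - G w <= 0 by rewrite E mulr_le0_ge0// subr_ge0.
rewrite /G powR1 /w => H.
have E2 : a + 1 - (a - 1) * (1 - u) = 2 + (a - 1) * u by ring.
rewrite E2 in H; lra.
Qed.

(** Young's inequality for the product x 1 with the conjugate exponents a and a / (a - 1); for a = 1
    there is no finite conjugate exponent, but equality holds. *)
Lemma powR_ge_bernoulli (a x : R) : 1 <= a -> 0 <= x -> 1 + a * (x - 1) <= x `^ a.
Proof.
move=> a1 x0; have a0 : 0 < a by exact: lt_le_trans a1.
have [a1'|a1'] := eqVneq a 1; first by rewrite a1' powRr1//; lra.
have a1'' : 0 < a - 1 by rewrite subr_gt0 lt_neqAle eq_sym a1'.
have := @conjugate_powR R x 1 a (a / (a - 1)) x0 ler01 a0.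
rewrite divr_gt0// powR1 mulr1 => /(_ isT) H.
have {}H : x <= x `^ a / a + 1 / (a / (a - 1)) by apply: H; field; rewrite !gt_eqF//.
have -> : x `^ a = a * (x `^ a / a) by rewrite mulrCA divff ?gt_eqF// mulr1.
have -> : 1 + a * (x - 1) = a * (x - 1 / (a / (a - 1))) by field; rewrite !gt_eqF.
by rewrite ler_pM2l// lerBlDr.
Qed.

(** The line is the tangent at [ub] of a concave function. Its intercept is nonnegative because it
    dominates the value 0 of that function at u = 0. The tangent inequality is Bernoulli's at (1 -
    u) / (1 - ub), so [ub = 1] is treated apart: there the constant 1 touches. *)
Lemma powR_compl_tangent (a ub : R) : 1 <= a -> 0 <= ub <= 1 ->
  exists c d : R, [/\ 0 <= c, 0 <= d, c + d * ub = 1 - (1 - ub) `^ a &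
    forall u, 0 <= u <= 1 -> 1 - (1 - u) `^ a <= c + d * u].
Proof.
move=> a1 /andP[u0 u1]; have a0 : 0 < a by exact: lt_le_trans a1.
have [->|ub1] := eqVneq ub 1.
  exists 1, 0; split => //; first by rewrite subrr powR0 ?gt_eqF//; lra.
  by move=> u _; rewrite mul0r addr0 lerBlDr lerDl powR_ge0.
pose v := 1 - ub; have v0 : 0 < v by rewrite subr_gt0 lt_neqAle ub1.
have vE : v `^ a = v * v `^ (a - 1) by rewrite mulr_powRB1 ?ltW//.
exists (1 - v `^ a - a * v `^ (a - 1) * ub), (a * v `^ (a - 1)).
have H u : 0 <= u <= 1 ->
    1 - (1 - u) `^ a <= 1 - v `^ a - a * v `^ (a - 1) * ub + a * v `^ (a - 1) * u.
  move=> /andP[uu0 uu1]; have w0 : 0 <= 1 - u by lra.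
  have B := @powR_ge_bernoulli a ((1 - u) / v) a1 (divr_ge0 w0 (ltW v0)).
  have E : (1 - u) `^ a = v `^ a * ((1 - u) / v) `^ a.
    rewrite -powRM; [|exact: ltW|by rewrite divr_ge0// ltW].
    by rewrite mulrCA divff ?gt_eqF// mulr1.
  have {}B : v `^ a * (1 + a * ((1 - u) / v - 1)) <= (1 - u) `^ a.
    by rewrite E ler_wpM2l// powR_ge0.
  suff : v `^ a * (1 + a * ((1 - u) / v - 1)) = v `^ a + a * v `^ (a - 1) * (ub - u).
    by lra.
  by rewrite mulrDr mulr1; congr (_ + _); rewrite vE /v; field; rewrite gt_eqF.
split => //.
- have := H 0; rewrite lexx ler01 subr0 powR1 subrr mulr0 addr0; exact.
- by rewrite mulr_ge0 ?powR_ge0// ltW.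
- by rewrite /v; ring.
Qed.

(* The probability that the virtual spherically symmetric tree with growth
   a 0, a 1, ... has no retained path of length n in independent percolation
   where the edges of the level i are retained with probability q i. *)
Fixpoint extinction (n : nat) (q a : nat -> R) : R :=
  if n is m.+1 then
    (1 - q 0%N * (1 - extinction m (q \o S) (a \o S))) `^ (a 0%N)
  else 0.

Lemma extinction_itv n q (a : nat -> R) : (forall i, 0 <= q i <= 1) -> (forall i, 0 <= a i) ->
  0 <= extinction n q a <= 1.
Proof.
elim: n q a => [|n IH] q a q01 a0 /=; first by rewrite lexx ler01.
have /andP[e0 e1] := IH (q \o S) (a \o S) (fun i => q01 i.+1) (fun i => a0 i.+1).
rewrite powR_ge0/=; have /andP[q0 q1] := q01 0%N.
have h0 : 0 <= q 0%N * (1 - extinction n (q \o S) (a \o S)).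
  by rewrite mulr_ge0// subr_ge0.
have h1 : q 0%N * (1 - extinction n (q \o S) (a \o S)) <= 1.
  by rewrite mulr_ile1//; lra.
have -> : 1 = 1 `^ (a 0%N) :> R by rewrite powR1.
by rewrite ge0_ler_powR ?nnegrE// ?powR1; lra.
Qed.

Lemma eq_extinction n q q' (a : nat -> R) : (forall i, (i < n)%N -> q i = q' i) ->
  extinction n q a = extinction n q' a.
Proof.
elim: n q q' a => //= n IH q q' a qq'; rewrite qq'// (IH _ (q' \o S))// => i ilt /=.
exact: qq'.
Qed.

Lemma extinction1 n q (a : nat -> R) i : (i < n)%N -> q i = 0 -> extinction n q a = 1.
Proof.
elim: n q a i => // n IH q a [|i] /=; first by move=> _ ->; rewrite mul0r subr0 powR1.
by rewrite ltnS => /(IH (q \o S) (a \o S) i) + qi => /(_ qi) ->; rewrite subrr mulr0 subr0 powR1.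
Qed.

(** The bracket of the upper bound, peeled at the root: [1 - (a 0)^-1] is its term k = 0, and all
    later terms carry the factor [(q 0)^-1 * (a 0)^-1] of the first level. *)
Fixpoint resistance (n : nat) (q a : nat -> R) : R :=
  if n is m.+1 then
    1 - (a 0%N)^-1 + (q 0%N)^-1 * (a 0%N)^-1 * resistance m (q \o S) (a \o S)
  else 1.

Lemma resistanceE n q (a : nat -> R) (p g : nat -> R) :
  (forall k, p k = \prod_(i < k) q i) -> (forall k, g k = \prod_(i < k) a i) ->
  resistance n q a = (p n)^-1 * (g n)^-1 +
    \sum_(k < n) (p k)^-1 * ((g k)^-1 - (g k.+1)^-1).
Proof.
elim: n q a p g => [|n IH] q a p g pE gE /=.
  by rewrite big_ord0 addr0 pE gE !big_ord0 invr1 mulr1.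
rewrite (IH _ _ (fun k => \prod_(i < k) q i.+1) (fun k => \prod_(i < k) a i.+1))//.
have pS k : p k.+1 = q 0%N * \prod_(i < k) q i.+1 by rewrite pE big_ord_recl.
have gS k : g k.+1 = a 0%N * \prod_(i < k) a i.+1 by rewrite gE big_ord_recl.
rewrite big_ord_recl/= pS !gS pE gE !big_ord0 mulr1 invr1 mul1r.
rewrite mulrDr addrCA; congr (_ + (_ + _)).
  by rewrite !invfM; ring.
rewrite big_distrr/=; apply: eq_bigr => i _.
by rewrite pS !gS !invfM; ring.
Qed.

Lemma survival_resistance_le2 n q (a : nat -> R) :
  (forall i, 0 < q i <= 1) -> (forall i, 1 <= a i) ->
  (1 - extinction n q a) * resistance n q a <= 2.
Proof.
elim: n q a => [|n IH] q a q01 a1 /=; first by rewrite subr0 mulr1 ler1n.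
have := IH (q \o S) (a \o S) (fun i => q01 i.+1) (fun i => a1 i.+1).
have := @extinction_itv n (q \o S) (a \o S)
  (fun i => ltac:(by have /andP[/ltW-> ->] := q01 i.+1)) (fun i => le_trans ler01 (a1 i.+1)).
set e := extinction _ _ _; set r := resistance _ _ _ => /andP[e0 e1] IHn.
have /andP[q0 q1] := q01 0%N; set q' := q 0%N in q0 q1 *.
have a1' := a1 0%N; set b := a 0%N in a1' *.
have b0 : 0 < b by exact: lt_le_trans a1'.
pose u := q' * (1 - e); rewrite -/u.
have u0 : 0 <= u by rewrite mulr_ge0 ?subr_ge0// ltW.
have u1 : u <= 1 by rewrite /u mulr_ile1//; lra.
have [u00|u00] := eqVneq u 0.
  by rewrite u00 subr0 powR1 subrr mul0r.
have up : 0 < u by rewrite lt_neqAle eq_sym u00.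
have P := @powR_ge_pade b u a1' ltac:(by rewrite u0 u1).
have D0 : 0 < 2 + (b - 1) * u by rewrite ltr_pwDl// mulr_ge0// subr_ge0.
(* Multiplying by [u * b] clears the denominators: the resistance becomes (b - 1) u + (1 - e) r, at
   most (b - 1) u + 2 by induction, and the rational lower bound for (1 - u)^b then leaves exactly 2
   u b. *)
rewrite -(ler_pM2r (mulr_gt0 up b0)) -[leLHS]mulrA.
have -> : (1 - b^-1 + q'^-1 * b^-1 * r) * (u * b) = (b - 1) * u + (1 - e) * r.
  by rewrite /u; field; rewrite !gt_eqF.
rewrite -subr_ge0 in IHn.
have s0 : 0 <= 1 - (1 - u) `^ b.
  have : (1 - u) `^ b <= 1 `^ b by apply: ge0_ler_powR; rewrite ?nnegrE; lra.
  by rewrite powR1; lra.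
apply: (@le_trans _ _ ((1 - (1 - u) `^ b) * (2 + (b - 1) * u))).
  by rewrite ler_wpM2l//; lra.
lra.
Qed.

End Numeric.

(** * Measurability and compactness of projections *)

Section Config.
Variables (R : realType) (I : Type).

Definition coordinate_sets : set (set (I -> R)) :=
  [set C | exists i (E : set R), measurable E /\ C = [set v | E (v i)]].

Definition config := g_sigma_algebraType coordinate_sets.

Lemma measurable_config_coord (i : I) :
  measurable_fun setT (fun v : config => v i).
Proof.
move=> _ E mE; rewrite setTI; apply: sub_sigma_algebra.
by exists i, E.
Qed.

Lemma measurable_to_config d (Z : measurableType d) (f : Z -> config) :
  (forall i, measurable_fun setT (fun z => f z i)) -> measurable_fun setT f.
Proof.
move=> mf; apply: (@measurability _ _ _ config _ _ coordinate_sets) => //.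
move=> _ [_ [i [E [mE ->]]] <-]; rewrite setTI.
by have := mf i measurableT _ mE; rewrite setTI.
Qed.

End Config.

Section Outer.
Local Open Scope ereal_scope.
Context d {T : measurableType d} {R : realType} (P : probability T R).

Lemma outer_measure_le1 (A : set T) : (P^*)%mu A <= 1.
Proof.
rewrite -(@probability_setT _ _ _ P) -(measurable_mu_extE P measurableT).
exact: le_mu_ext.
Qed.

Lemma outer_measure_fin (A : set T) : (P^*)%mu A \is a fin_num.
Proof.
rewrite ge0_fin_numE ?mu_ext_ge0//.
exact: le_lt_trans (outer_measure_le1 A) (ltry _).
Qed.

Lemma outer_measure_hull (A : set T) (e : R) : (0 < e)%R ->
  exists H, [/\ measurable H, A `<=` H & P H <= (P^*)%mu A + e%:E].
Proof.
move=> e0; have [_ [F [mF AF] <-] lt] := lb_ereal_inf_adherent e0 (outer_measure_fin A).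
exists (\bigcup_k F k); split => //; first exact: bigcupT_measurable.
apply: le_trans (ltW lt).
by apply: measure_sigma_subadditive => //; exact: bigcupT_measurable.
Qed.

Lemma outer_measure_hull_eq (A : set T) :
  exists H, [/\ measurable H, A `<=` H & P H = (P^*)%mu A].
Proof.
have /choice[F FP] n : exists H, [/\ measurable H, A `<=` H &
    P H <= (P^*)%mu A + (n.+1%:R^-1)%:E].
  by apply: outer_measure_hull; rewrite invr_gt0.
have mF : measurable (\bigcap_n F n).
  by apply: bigcapT_measurable => n; have [] := FP n.
have AF : A `<=` \bigcap_n F n by move=> x Ax n _; have [_ + _] := FP n; exact.
exists (\bigcap_n F n); split => //.
apply/eqP; rewrite eq_le -[X in _ && (_ <= X)]measurable_mu_extE// le_mu_ext// andbT.
apply/lee_addgt0Pr => e e0.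
have [n ne] : exists n, (n.+1%:R^-1 < e)%R.
  have [n] := near_infty_natSinv_lt (PosNum e0).
  by move=> _ /(_ n (leqnn n)) ?; exists n.
have [mFn _ PF] := FP n.
apply: (@le_trans _ _ (P (F n))); first by apply: le_measure; rewrite ?inE//; exact: bigcap_inf.
by apply: le_trans PF _; rewrite leeD2l// lee_fin ltW.
Qed.

(** Hulls of equal measure need not increase with n. Replacing each by the intersection [G n] of all
    later ones gives increasing measurable sets which still contain [A n] and have at most its outer
    measure, so continuity from below applies to them. *)
Lemma outer_measure_nondecreasing (A : nat -> set T) (e : R) :
  (0 < e)%R -> nondecreasing_seq A ->
  exists n, (P^*)%mu (\bigcup_n A n) <= (P^*)%mu (A n) + e%:E.
Proof.
move=> e0 ndA; have /choice[H HP] := fun n => outer_measure_hull_eq (A n).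
pose G n := \bigcap_(m in [set m | (n <= m)%N]) H m.
have mG n : measurable (G n).
  by apply: bigcap_measurableType => m _; have [] := HP m.
have AG n : A n `<=` G n.
  move=> x Ax m /= nm; have [_ + _] := HP m; apply.
  by move/subsetPset: (ndA _ _ nm); exact.
have ndG : nondecreasing_seq G.
  by move=> m n mn; apply/subsetPset => x Gx k /= nk; apply: Gx; exact: leq_trans nk.
have mUG : measurable (\bigcup_n G n) by exact: bigcupT_measurable.
have cG := nondecreasing_cvg_mu mG mUG ndG.
have PUG : P (\bigcup_n G n) \is a fin_num.
  by apply: fin_num_measure.
have lt : P (\bigcup_n G n) - e%:E < P (\bigcup_n G n).
  by rewrite lteBlDr// -[X in X < _]adde0 lteD2lE//.
have : \forall n \near \oo, P (\bigcup_n G n) - e%:E < P (G n).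
  apply: (cG _ P [set x | P (\bigcup_n G n) - e%:E < x]).
  by apply: open_nbhs_nbhs; split => //; exact: open_ereal_gt_ereal.
move=> [n _ /(_ n (leqnn n))] {}lt.
exists n; apply: (@le_trans _ _ (P (\bigcup_n G n))).
  rewrite -(measurable_mu_extE P mUG); apply: le_mu_ext.
  by move=> x [k _ Ak]; exists k => //; exact: AG.
rewrite -leeBlDr//; apply: (le_trans (ltW lt)).
have [mH _ <-] := HP n; apply: le_measure; rewrite ?inE//.
by move=> x; apply => /=.
Qed.

End Outer.

Section ShadowDef.
Variables (R : Type) (I : Type) (idx : I -> nat).
Implicit Types (B D : set (I -> R)) (x : nat -> R) (n m : nat).

(** The cylinder over the projection of [B], placed in the space of infinite sequences so that all
    levels share one measurable space. [idx] covers finite and infinite index types alike. *)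
Definition shadow B n : set (nat -> R) :=
  [set x | exists2 y, B y & forall i, (idx i < n)%N -> y i = x (idx i)].

Lemma shadowS B D n : B `<=` D -> shadow B n `<=` shadow D n.
Proof. by move=> BD x [y By yx]; exists y => //; exact: BD. Qed.

Lemma shadow_leq B n m : (m <= n)%N -> shadow B n `<=` shadow B m.
Proof.
by move=> mn x [y By yx]; exists y => // i im; apply: yx; exact: leq_trans mn.
Qed.

End ShadowDef.

Section Shadow.
Variables (R : realType) (I : eqType) (idx : I -> nat).
Hypothesis idx_inj : injective idx.
Implicit Types (B D : set (I -> R)) (x : nat -> R) (n m k : nat).
Local Notation shadow := (shadow idx).

(** A countable union, over rational grid points [q], of boxes around [q], kept only if [D] has a
    point near [q]. The condition on [D] does not involve x, so the result is measurable for
    arbitrary [D]. *)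
Definition fattening D n k : set (nat -> R) :=
  \bigcup_(q : seq rat) [set x | (forall j, (j < n)%N ->
      `|x j - ratr (nth 0 q j)| < k.+1%:R^-1) /\
    exists2 y, D y & forall i, (idx i < n)%N ->
      `|y i - ratr (nth 0 q (idx i))| < k.+1%:R^-1].

Lemma measurable_fattening D n k :
  measurable (fattening D n k : set (config R nat)).
Proof.
apply: (@countable_bigcupT_measurable _ (config R nat)); first exact: countableP.
move=> q; set Q := exists2 y, _ & _.
have -> : [set x : config R nat | (forall j, (j < n)%N ->
      `|x j - ratr (nth 0 q j)| < k.+1%:R^-1) /\ Q] =
   \bigcap_(j in [set j | (j < n)%N])
     [set x : config R nat | ball (ratr (nth 0 q j) : R) (k.+1%:R^-1) (x j)] `&` [set x | Q].
  apply/seteqP; split => x /= [xq HQ]; split => // j /= /xq.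
    by rewrite /ball/= distrC.
  by rewrite /ball/= distrC.
apply: measurableI; last first.
  have [HQ|nQ] := pselect Q.
    by rewrite (_ : [set _ | Q] = setT)//; apply/seteqP; split.
  by rewrite (_ : [set _ | Q] = set0)//; apply/seteqP; split.
apply: bigcap_measurableType => j _.
rewrite -[X in measurable X]setTI.
apply: (@measurable_config_coord R nat j) => //.
exact: measurable_ball.
Qed.

Lemma shadow_fattening D n k : shadow D n `<=` fattening D n k.
Proof.
move=> x [y Dy yx].
have /choice[q qx] : forall j, exists q : rat, `|x j - ratr q| < k.+1%:R^-1.
  move=> j; have /rat_in_itvoo[q] : x j - k.+1%:R^-1 < x j + k.+1%:R^-1.
    by rewrite ltrD2l gtrN// invr_gt0.
  rewrite in_itv/= => /andP[q1 q2]; exists q.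
  by move: q1 q2; move: (_^-1) => w q1 q2; rewrite ltr_norml; apply/andP; split; lra.
exists (mkseq q n) => //=; split; first by move=> j jn; rewrite nth_mkseq.
by exists y => // i ilt; rewrite nth_mkseq// yx.
Qed.

Definition bounded_at m (r : R) : set (I -> R) :=
  [set y | forall i, idx i = m -> `|y i| <= r].

(* Only the coordinates of D k below k are bounded, but along a sequence with
   a term in each D k every coordinate is bounded. *)
Lemma shadow_compactness B (D : nat -> set (I -> R)) (r : nat -> R) n :
  closed (B : set {ptws I -> R}) -> (forall k, D k `<=` B) ->
  (forall k, D k `<=` \bigcap_(m in [set m | (m < k)%N]) bounded_at m (r m)) ->
  \bigcap_k fattening (D k) n k `<=` shadow B n.
Proof.
move=> cB DB Dr x xD.
have /choice[y yP] : forall k, exists y, D k y /\ forall i, (idx i < n)%N ->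
    `|y i - x (idx i)| < 2 * k.+1%:R^-1.
  move=> k; have [q _ [xq [y Dy yq]]] := xD k Logic.I.
  exists y; split => // i ilt.
  have -> : y i - x (idx i) = (y i - ratr (nth 0 q (idx i))) - (x (idx i) - ratr (nth 0 q (idx i))).
    by ring.
  apply: le_lt_trans (ler_normB _ _) _; rewrite mulr2n mulrDl mul1r.
  by rewrite ltrD ?yq ?xq.
(* [D k] bounds the coordinate i only once k > idx i; the sum absorbs the finitely many earlier
   terms. The sequence then stays in a product of segments, and Tychonoff's theorem provides a
   cluster point. *)
pose C i : R := \sum_(k < (idx i).+1) `|y k i| + `|r (idx i)|.
have yC k i : `|y k i| <= C i.
  have [ki|ik] := leqP k (idx i).
    rewrite /C (bigD1 (Ordinal (ki : (k < (idx i).+1)%N)))//= -addrA lerDl.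
    by rewrite addr_ge0// sumr_ge0.
  have [/Dr/(_ _ ik)/(_ i erefl) H _] := yP k.
  by apply: (le_trans H); rewrite /C (le_trans (ler_norm _))// lerDr sumr_ge0.
pose K : set {ptws I -> R} := [set f | forall i, `[- C i, C i]%classic (f i)].
have cK : compact K.
  apply: (@tychonoff I (fun=> R) (fun i => `[- C i, C i]%classic)) => i.
  exact: segment_compact.
pose yy := y : nat -> {ptws I -> R}.
have FK : (yy @ \oo) K.
  by exists 0%N => // k _ i /=; rewrite in_itv/= -ler_norml; exact: yC.
have [p [_ clp]] := cK _ _ FK.
exists p.
  apply: cB => U Up.
  have FB : (yy @ \oo) (B : set {ptws I -> R}).
    by exists 0%N => // k _ /=; apply: (DB k); have [] := yP k.
  by have [z [Bz Uz]] := clp _ _ FB Up; exists z.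
move=> i ilt; apply/eqP; rewrite -subr_eq0 -normr_eq0.
rewrite eq_le normr_ge0 andbT; apply/ler_addgt0Pl => /= e e0; rewrite addr0; move: (e : R) e0 => {}e e0.
have e20 : 0 < e / 2 by rewrite divr_gt0.
have e40 : 0 < e / 4 by rewrite divr_gt0.
have [M _ MP] := near_infty_natSinv_lt (PosNum e40).
have FA : (yy @ \oo) [set f | `|f i - x (idx i)| < e / 2].
  exists M => // k /= Mk; have [_ /(_ i ilt) H] := yP k.
  apply: (lt_le_trans H); have := MP k Mk; rewrite /=; move: (k.+1%:R^-1) => w; lra.
have Up : nbhs (p : {ptws I -> R}) [set f | ball (p i) (e / 2) (f i)].
  by apply: (@proj_continuous I (fun=> R) i p); exact: nbhsx_ballx.
have [z [/= z1 z2]] := clp _ _ FA Up.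
have -> : p i - x (idx i) = (p i - z i) + (z i - x (idx i)) by ring.
apply: le_trans (ler_normD _ _) _; move: z2; rewrite /ball/= => z2; lra.
Qed.

(** Choquet's capacitability argument. Coordinates are bounded one after the other, the m-th at a
    cost of e / 2^(m+1) in outer measure, by continuity from below. The bounded sets [D m] decrease,
    and by compactness the intersection of their measurable fattenings lies in the shadow of [B];
    its measure is a limit of measures which have lost at most e in total. *)
Lemma shadow_capacitable (P : probability (config R nat) R) B n (e : R) :
  closed (B : set {ptws I -> R}) -> 0 < e ->
  exists A : set (config R nat), [/\ measurable A, A `<=` shadow B n &
    ((P^*)%mu (shadow B n) <= P A + e%:E)%E].
Proof.
move=> cB e0.
pose em m := e / 2 ^+ m.+1.
have em0 m : 0 < em m by rewrite divr_gt0// exprn_gt0.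
have /choice[rr rrP] : forall Dm : set (I -> R) * nat, exists r : R,
   ((P^*)%mu (shadow Dm.1 n) <=
    (P^*)%mu (shadow (Dm.1 `&` bounded_at Dm.2 r) n) + (em Dm.2)%:E)%E.
  move=> [D m] /=.
  pose A k := shadow (D `&` bounded_at m k%:R) n : set (config R nat).
  have ndA : nondecreasing_seq A.
    move=> k l kl; apply/subsetPset; apply: shadowS => y [Dy Hy]; split => //.
    by move=> i im; apply: le_trans (Hy i im) _; rewrite ler_nat.
  have [k kP] := outer_measure_nondecreasing P (em0 m) ndA.
  exists k%:R; apply: le_trans kP; apply: le_mu_ext => x [y Dy yx].
  (* At most one coordinate has position m, by injectivity of [idx], so one integer bounds all the
     values concerned. *)
  have [[i im]|ni] := pselect (exists i, idx i = m).
    exists (Num.bound `|y i|) => //; exists y => //; split => // j jm.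
    have -> : j = i by apply: idx_inj; rewrite jm im.
    by apply/ltW/archi_boundP.
  exists 0%N => //; exists y => //; split => // j jm.
  by exfalso; apply: ni; exists j.
pose D := fix D m : set (I -> R) :=
  if m is k.+1 then D k `&` bounded_at k (rr (D k, k)) else B.
have DB m : D m `<=` B by elim: m => //= m IH y [/IH].
have ndD m k : (m <= k)%N -> D k `<=` D m.
  move=> /subnKC <-; elim: (k - m)%N => [|j IH]; first by rewrite addn0.
  by rewrite addnS => y [/IH].
have DP m : ((P^*)%mu (shadow B n) <=
    (P^*)%mu (shadow (D m) n) + (e - e / 2 ^+ m)%:E)%E.
  elim: m => [|m IH]; first by rewrite expr0 divr1 subrr adde0.
  apply: (le_trans IH).
  have := rrP (D m, m); rewrite -/(D m.+1)/= => H.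
  apply: le_trans (leeD2r _ H) _; rewrite -addeA -EFinD leeD2l// lee_fin /em.
  have p0 : 2 ^+ m != 0 :> R by rewrite expf_neq0.
  by rewrite exprS le_eqVlt; apply/orP; left; apply/eqP; field.
pose F m : set (config R nat) := \bigcap_(k in [set k | (k <= m)%N]) fattening (D k) n k.
have mF m : measurable (F m).
  by apply: bigcap_measurableType => k _; exact: measurable_fattening.
have DF m : shadow (D m) n `<=` F m.
  move=> x Dx k /= km; apply: shadow_fattening; move: Dx; apply: shadowS.
  exact: ndD.
have niF : nonincreasing_seq F.
  move=> m k mk; apply/subsetPset => x Fx j /= jm; apply: Fx => /=.
  exact: leq_trans mk.
have mIF : measurable (\bigcap_m F m) by exact: bigcapT_measurable.
have cF : P \o F @ \oo --> P (\bigcap_m F m).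
  apply: nonincreasing_cvg_mu => //.
  exact: le_lt_trans (probability_le1 _ (mF 0%N)) (ltry _).
exists (\bigcap_m F m); split => //.
  move=> x xF.
  apply: (@shadow_compactness B D (fun k => rr (D k, k)) n cB DB).
    by move=> k y Dy m /= mk; have [] := ndD _ _ mk _ Dy.
  by move=> k _; apply: (xF k Logic.I) => /=.
rewrite -leeBlDr//; rewrite -(cvg_lim _ cF)//.
apply: lime_ge; first by apply/cvg_ex; eexists; exact: cF.
near=> m; rewrite leeBlDr//=; apply: (le_trans (DP m)).
apply: leeD; last by rewrite lee_fin gerBl divr_ge0 ?(ltW e0)// exprn_ge0.
by rewrite -(measurable_mu_extE P (mF m)); apply: le_mu_ext; exact: DF.
Unshelve. all: by end_near. Qed.

End Shadow.

(** * The operator Psi on sets of label sequences *)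

Local Open Scope ereal_scope.

Section Integral.
Context d (T : measurableType d) (R : realType).

(* No measurability: the integral of a nonnegative function is a supremum. *)
Lemma ge0_le_lower_integral (mu : {measure set T -> \bar R}) (f g : T -> \bar R) :
  (forall x, 0 <= f x) -> (forall x, f x <= g x) ->
  \int[mu]_x f x <= \int[mu]_x g x.
Proof.
move=> f0 fg; have g0 x : 0 <= g x by exact: le_trans (fg x).
rewrite !ge0_integralTE//; apply: le_ereal_sup => _ [h hf <-].
by exists h => // x; exact: le_trans (hf x) (fg x).
Qed.

Lemma poweR_le1 (x : \bar R) (r : R) : (0 <= r)%R -> 0 <= x <= 1 -> x `^ r <= 1.
Proof.
move=> r0 /andP[x0 x1]; rewrite -(poweR1r r); apply: gt0_ler_poweR => //;
  by rewrite in_itv/= ?lexx ?leey ?andbT.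
Qed.

Lemma poweR_le (x y : \bar R) (r : R) : (0 <= r)%R -> 0 <= x -> x <= y ->
  x `^ r <= y `^ r.
Proof.
move=> r0 x0 xy; apply: gt0_ler_poweR => //; rewrite in_itv/= ?leey ?andbT//.
exact: le_trans xy.
Qed.

Variable mu : probability T R.

Lemma ge0_le_lower_integral1 (f : T -> \bar R) :
  (forall x, 0 <= f x <= 1) -> 0 <= \int[mu]_x f x <= 1.
Proof.
move=> f01; rewrite integral_ge0/=; last by move=> x _; have /andP[] := f01 x.
apply: (@le_trans _ _ (\int[mu]_x cst 1 x)).
  by apply: ge0_le_lower_integral => x; have /andP[] := f01 x.
by rewrite integral_cst//= mul1e probability_setT.
Qed.

(** Hoelder's inequality for the (s + t)-th roots of f and g, with the conjugate exponents (s + t) /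
    s and (s + t) / t, raised to the power s + t. *)
Lemma hoelder_powers (f g : T -> \bar R) (s t : R) :
  measurable_fun setT f -> measurable_fun setT g ->
  (forall x, 0 <= f x <= 1) -> (forall x, 0 <= g x <= 1) ->
  (0 < s)%R -> (0 < t)%R ->
  (\int[mu]_x (f x * g x) `^ (s + t)^-1) `^ (s + t) <=
  (\int[mu]_x f x `^ s^-1) `^ s * (\int[mu]_x g x `^ t^-1) `^ t.
Proof.
move=> mf mg f01 g01 s0 t0; have st0 : (0 < s + t)%R by rewrite addr_gt0.
have finf x : f x \is a fin_num.
  by have /andP[f0 f1] := f01 x; rewrite ge0_fin_numE// (le_lt_trans f1) ?ltry.
have fing x : g x \is a fin_num.
  by have /andP[f0 f1] := g01 x; rewrite ge0_fin_numE// (le_lt_trans f1) ?ltry.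
pose F x := (fine (f x) `^ (s + t)^-1)%R; pose G x := (fine (g x) `^ (s + t)^-1)%R.
have FE x : (F x)%:E = f x `^ (s + t)^-1 by rewrite /F -{2}(fineK (finf x)) poweR_EFin.
have GE x : (G x)%:E = g x `^ (s + t)^-1 by rewrite /G -{2}(fineK (fing x)) poweR_EFin.
have mF : measurable_fun setT F.
  rewrite /F; apply: (@measurableT_comp _ _ _ _ _ _ (@powR R ^~ (s + t)^-1%R) _ (fine \o f)).
    exact: measurable_powR.
  by apply: measurableT_comp.
have mG : measurable_fun setT G.
  rewrite /G; apply: (@measurableT_comp _ _ _ _ _ _ (@powR R ^~ (s + t)^-1%R) _ (fine \o g)).
    exact: measurable_powR.
  by apply: measurableT_comp.
pose p : R := ((s + t) / s)%R; pose q : R := ((s + t) / t)%R.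
have p0 : (0 < p)%R by rewrite divr_gt0.
have q0 : (0 < q)%R by rewrite divr_gt0.
have pq : (p^-1 + q^-1 = 1)%R by rewrite /p /q; field; rewrite !gt_eqF.
have H := @hoelder _ _ _ mu F G p q mF mG p0 q0 pq.
have F0 x : (0 <= F x)%R by exact: powR_ge0.
have G0 x : (0 <= G x)%R by exact: powR_ge0.
rewrite Lnorm1 in H.
have EL : \int[mu]_x (f x * g x) `^ (s + t)^-1 = \int[mu]_x `|((F \* G)%R x)%:E|.
  apply: eq_integral => x _; rewrite gee0_abs ?lee_fin ?mulr_ge0// [RHS]EFinM FE GE.
  by rewrite poweRM//; [have /andP[] := f01 x|have /andP[] := g01 x].
have EF : 'N[mu]_p%:E[EFin \o F] `^ (s + t) = (\int[mu]_x f x `^ s^-1) `^ s.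
  have -> : (s + t = p * s)%R by rewrite /p; field; rewrite gt_eqF.
  rewrite poweRrM poweR_Lnorm ?gt_eqF//; congr (_ `^ _).
  apply: eq_integral => x _; rewrite gee0_abs ?lee_fin// /comp FE -poweRrM.
  by congr (_ `^ _); rewrite /p; field; rewrite !gt_eqF.
have EG : 'N[mu]_q%:E[EFin \o G] `^ (s + t) = (\int[mu]_x g x `^ t^-1) `^ t.
  have -> : (s + t = q * t)%R by rewrite /q; field; rewrite gt_eqF.
  rewrite poweRrM poweR_Lnorm ?gt_eqF//; congr (_ `^ _).
  apply: eq_integral => x _; rewrite gee0_abs ?lee_fin// /comp GE -poweRrM.
  by congr (_ `^ _); rewrite /q; field; rewrite !gt_eqF.
rewrite -EF -EG -poweRM ?Lnorm_ge0// EL.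
by apply: poweR_le => //; [exact: ltW|exact: integral_ge0].
Qed.

End Integral.

Section Avoid.
Context {R : realType} (mu : probability R R).
Implicit Types (A : set (nat -> R)) (a M : nat -> R) (n : nat).

Definition scons (x : R) (v : nat -> R) : nat -> R :=
  fun i => if i is j.+1 then v j else x.

Definition section A (x : R) : set (nat -> R) := [set v | A (scons x v)].

(* Psi(A; a_0, ..., a_(n-1)) for a set A of sequences which depends on the
   first n coordinates. *)
Fixpoint avoidance n A a : \bar R :=
  if n is m.+1 then
    (\int[mu]_x avoidance m (section A x) (a \o S)) `^ (a 0%N)
  else (\1_(~` A) (fun=> 0))%:E.

Lemma measurable_scons d (Z : measurableType d) (f : Z -> R)
    (g : Z -> config R nat) :
  measurable_fun setT f -> measurable_fun setT g ->
  measurable_fun setT (fun z => scons (f z) (g z) : config R nat).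
Proof.
move=> mf mg; apply: measurable_to_config => -[|i] //=.
exact: (measurableT_comp (@measurable_config_coord R nat i) mg).
Qed.

Lemma measurable_section A x : measurable (A : set (config R nat)) ->
  measurable (section A x : set (config R nat)).
Proof.
move=> mA.
rewrite -[X in measurable X]setTI.
have H : measurable_fun setT (fun v : config R nat => scons x v : config R nat).
  by apply: measurable_scons; [exact: measurable_cst|exact: measurable_id].
exact: H.
Qed.

Lemma avoidance_ge0 n A a : 0 <= avoidance n A a.
Proof. by case: n => [|n] /=; [rewrite lee_fin|exact: poweR_ge0]. Qed.

Lemma avoidance_le1 n A a : (forall i, (i < n)%N -> (0 <= a i)%R) ->
  avoidance n A a <= 1.
Proof.
elim: n A a => [|n IH] A a a0 /=.
  by rewrite lee_fin indicE; case: (_ \in _).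
apply: poweR_le1; first exact: a0.
apply: ge0_le_lower_integral1 => x; rewrite avoidance_ge0/=.
by apply: IH => i ilt; exact: a0.
Qed.

Lemma avoidance_set0 n a : avoidance n set0 a = 1.
Proof.
elim: n a => [|n IH] a /=; first by rewrite indicE in_setC in_set0.
under eq_integral do rewrite (_ : section set0 _ = set0) ?IH//.
by rewrite integral_cst//= mul1e probability_setT poweR1r.
Qed.

Lemma eq_avoidance n A a b : (forall i, (i < n)%N -> a i = b i) ->
  avoidance n A a = avoidance n A b.
Proof.
elim: n A a b => // n IH A a b ab /=; rewrite ab//; congr (_ `^ _).
by apply: eq_integral => x _; apply: IH => i ilt /=; rewrite ab.
Qed.

(** The parameter space [Z] is arbitrary so that the induction can move the first coordinate of the
    sequence into it; by Tonelli the integral over that coordinate is measurable in the remaining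
    parameter. *)
Lemma measurable_avoidance n d (Z : measurableType d)
    (A : set (Z * config R nat)) a : measurable A ->
  measurable_fun setT (fun z => avoidance n [set v | A (z, v)] a).
Proof.
elim: n d Z A a => [|n IH] d Z A a mA /=.
  apply/measurable_EFinP.
  rewrite (_ : (fun z => _) = \1_((fun z : Z => (z, (fun=> 0%R) : config R nat)) @^-1` (~` A))).
    apply: measurable_indic; rewrite -[X in measurable X]setTI.
    have H : measurable_fun setT (fun z : Z => (z, (fun=> 0%R) : config R nat)).
      by apply/measurable_fun_pairP; split; [exact: measurable_id|exact: measurable_cst].
    by apply: H => //; exact: measurableC.
  by apply/funext => z; rewrite !indicE.
apply: (measurableT_comp (measurable_poweR _)).
pose A' : set ((Z * R) * config R nat) := [set w | A (w.1.1, scons w.1.2 w.2)].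
have mA' : measurable A'.
  rewrite -[X in measurable X]setTI.
  have H : measurable_fun setT (fun w : (Z * R) * config R nat =>
      (w.1.1, scons w.1.2 w.2 : config R nat)).
    apply/measurable_fun_pairP; split => /=.
      exact: (measurableT_comp measurable_fst measurable_fst).
    apply: measurable_scons; last exact: measurable_snd.
    exact: (measurableT_comp measurable_snd measurable_fst).
  exact: H.
have mF := IH _ _ A' (a \o S) mA'.
have := @measurable_fun_fubini_tonelli_F _ _ _ _ _ mu _ mF
  (fun z => avoidance_ge0 _ _ _).
by apply: eq_measurable_fun.
Qed.

Lemma measurable_avoidance_section n A a : measurable (A : set (config R nat)) ->
  measurable_fun setT (fun x => avoidance n (section A x) a).
Proof.
move=> mA; have H : measurable_fun setT (fun w : R * config R nat =>
    scons w.1 w.2 : config R nat).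
  by apply: measurable_scons.
have mA' : measurable [set w : R * config R nat | A (scons w.1 w.2)].
  by rewrite -[X in measurable X]setTI; exact: H.
exact: (measurable_avoidance n a mA').
Qed.

Lemma avoidance_anti n A B a : (forall i, (i < n)%N -> (0 <= a i)%R) ->
  A `<=` B -> avoidance n B a <= avoidance n A a.
Proof.
elim: n A B a => [|n IH] A B a a0 AB /=.
  rewrite lee_fin !indicE ler_nat; case: (boolP (_ \in ~` B)) => //= nB.
  by rewrite lt0b; apply/mem_set => /AB; exact: (set_mem nB).
apply: poweR_le; first exact: a0.
  by apply: integral_ge0 => x _; exact: avoidance_ge0.
apply: ge0_le_lower_integral => x; first exact: avoidance_ge0.
by apply: IH => [i ilt|v]; [exact: a0|exact: AB].
Qed.

(** The growth sequence with partial products M, for positive M. There is a shift: [M i] is the size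
    of level i + 1, level 0 having size 1. *)
Definition ratios M : nat -> R := fun i => if i is j.+1 then (M j.+1 / M j)%R else M 0%N.

Lemma avoidance_scale n A a (t : R) : (0 < t)%R ->
  avoidance n A (fun i => if i is 0%N then (t * a 0%N)%R else a i) =
  avoidance n A a `^ t.
Proof.
move=> t0; case: n => [|n] /=.
  by rewrite indicE; case: (_ \in _); rewrite /= ?powR1// powR0// gt_eqF.
by rewrite mulrC poweRrM.
Qed.

(** Below one of the M 0 vertices of the first level the sizes are M 1 / M 0, M 2 / M 0, ...; the
    common factor cancels in every ratio but the first, and so only affects the outermost
    exponent. *)
Lemma avoidance_ratiosS n A M : (0 < M 0%N)%R ->
  avoidance n A (ratios M \o S) = avoidance n A (ratios (M \o S)) `^ (M 0%N)^-1.
Proof.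
move=> M0; rewrite -avoidance_scale ?invr_gt0//; apply: eq_avoidance => -[|i] _ //=.
by rewrite mulrC.
Qed.

Lemma ratios_gt0 n M : (forall i, (i < n)%N -> (0 < M i)%R) ->
  forall i, (i < n)%N -> (0 < ratios M i)%R.
Proof.
by move=> M0 [|i] ilt /=; [exact: M0|rewrite divr_gt0// M0//; exact: ltnW].
Qed.

(* In terms of level sizes M_i = a_0 ... a_i, avoidance is the L^(1/M_0) norm
   of the avoidance of the sections, so this is Hoelder's inequality. *)
Lemma avoidance_ratiosD n A M M' : measurable (A : set (config R nat)) ->
  (forall i, (i < n)%N -> (0 < M i)%R) -> (forall i, (i < n)%N -> (0 < M' i)%R) ->
  avoidance n A (ratios (fun i => (M i + M' i)%R)) <=
  avoidance n A (ratios M) * avoidance n A (ratios M').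
Proof.
elim: n A M M' => [|n IH] A M M' mA M0 M0'.
  by rewrite /= indicE; case: (_ \in _); rewrite ?mule1 ?mule0.
have p0 := M0 0%N isT; have p0' := M0' 0%N isT.
have pD : (0 < M 0%N + M' 0%N)%R by rewrite addr_gt0.
pose V x := avoidance n (section A x) (ratios (M \o S)).
pose W x := avoidance n (section A x) (ratios (M' \o S)).
have E N : (0 < N 0%N)%R -> avoidance n.+1 A (ratios N) =
   (\int[mu]_x avoidance n (section A x) (ratios (N \o S)) `^ (N 0%N)^-1) `^ (N 0%N).
  move=> N0 /=; congr (_ `^ _).
  by apply: eq_integral => x _; rewrite avoidance_ratiosS.
rewrite !E//.
have V01 x : 0 <= V x <= 1.
  rewrite avoidance_ge0 avoidance_le1// => i ilt; apply/ltW.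
  by apply: ratios_gt0 ilt => j jlt; exact: M0.
have W01 x : 0 <= W x <= 1.
  rewrite avoidance_ge0 avoidance_le1// => i ilt; apply/ltW.
  by apply: ratios_gt0 ilt => j jlt; exact: M0'.
apply: le_trans (hoelder_powers mu (f := V) (g := W) _ _ V01 W01 p0 p0'); last 2 first.
- exact: measurable_avoidance_section.
- exact: measurable_avoidance_section.
apply: poweR_le; first exact: ltW.
  by apply: integral_ge0 => x _; exact: poweR_ge0.
apply: ge0_le_lower_integral => x; first exact: poweR_ge0.
apply: poweR_le; [by rewrite invr_ge0 ltW|exact: avoidance_ge0|].
apply: IH; first exact: measurable_section.
- by move=> i ilt; exact: M0.
- by move=> i ilt; exact: M0'.
Qed.

Lemma avoidance_ratios_sum (I : eqType) (s : seq I) (M : I -> nat -> R) n A :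
  measurable (A : set (config R nat)) -> s != [::] ->
  (forall i, i \in s -> forall j, (j < n)%N -> (0 < M i j)%R) ->
  avoidance n A (ratios (fun j => \sum_(i <- s) M i j)%R) <=
  \prod_(i <- s) avoidance n A (ratios (M i)).
Proof.
move=> mA s0 M0.
(* Positivity of the partial sums is carried through the induction because the two-term inequality
   asks for it. *)
suff : (forall j, (j < n)%N -> (0 < \sum_(i <- s) M i j)%R) /\
   avoidance n A (ratios (fun j => \sum_(i <- s) M i j)%R) <=
  \prod_(i <- s) avoidance n A (ratios (M i)) by case.
elim: s s0 M0 => // i s IH _ M0.
have [->|s0] := eqVneq s [::].
  rewrite !big_seq1 (_ : (fun j => _) = M i); last first.
    by apply/funext => j; rewrite big_seq1.
  by split => // j jn; rewrite big_seq1 M0// mem_head.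
have [pos le] := IH s0 (fun k ks => M0 k (mem_behead (s := i :: s) ks)).
have M0i j : (j < n)%N -> (0 < M i j)%R by apply: M0; exact: mem_head.
split => [j jn|]; first by rewrite big_cons addr_gt0// ?M0i ?pos.
rewrite big_cons (_ : (fun j => _) =
    (fun j => M i j + \sum_(i <- s) M i j)%R); last first.
  by apply/funext => j; rewrite big_cons.
apply: le_trans (avoidance_ratiosD mA M0i pos) _.
by apply: lee_pmul => //; exact: avoidance_ge0.
Qed.

(* With all exponents equal to 1, avoidance is the probability of avoiding a
   set, so this is the measure of A itself. *)
Definition iterated_measure n A : \bar R := avoidance n (~` A) (fun=> 1%R).

Lemma iterated_measureS n A :
  iterated_measure n.+1 A = \int[mu]_x iterated_measure n (section A x).
Proof. by rewrite /iterated_measure/= poweRe1// integral_ge0// => x _; exact: avoidance_ge0. Qed.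

Lemma iterated_measure_ge0 n A : 0 <= iterated_measure n A.
Proof. exact: avoidance_ge0. Qed.

Lemma iterated_measure_le1 n A : iterated_measure n A <= 1.
Proof. by apply: avoidance_le1. Qed.

Lemma measurable_iterated_measure_section n A : measurable (A : set (config R nat)) ->
  measurable_fun setT (fun x => iterated_measure n (section A x)).
Proof.
move=> mA; apply: (@measurable_avoidance_section n (~` A)); exact: measurableC.
Qed.

Definition depends_on n A := forall v w : nat -> R,
  (forall i, (i < n)%N -> v i = w i) -> A v -> A w.

Lemma depends_on_section n A x : depends_on n.+1 A -> depends_on n (section A x).
Proof. by move=> dA v w vw; apply: dA => -[|i] //=; exact: vw. Qed.

(* The coefficients c are those of the tangent plane at q: the survival
   probability of the virtual tree is a concave function of the probabilities
   p(B; k). *)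
Lemma avoidance_linear_bound n (q a : nat -> R) :
  (forall i, 0 <= q i <= 1)%R -> (forall i, 1 <= a i)%R ->
  exists c : nat -> R, [/\ (forall k, 0 <= c k)%R,
    (\sum_(k < n.+1) c k * \prod_(i < k) q i = 1 - extinction n q a)%R &
    forall A : nat -> set (nat -> R),
      (forall k, measurable (A k : set (config R nat))) ->
      (forall k, A k.+1 `<=` A k) -> (forall k, depends_on k (A k)) ->
      A 0%N = setT ->
      1 <= avoidance n (A n) a +
           \sum_(k < n.+1) (c k)%:E * iterated_measure k (A k)].
Proof.
elim: n q a => [|n IH] q a q01 a1.
  exists (fun=> 1%R); split => //.
    by rewrite big_ord1 big_ord0 mulr1/= subr0.
  move=> A mA ndA dA A0; rewrite big_ord1 mul1e /iterated_measure/= A0.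
  by rewrite setCK indicT; rewrite addeC leeDl// lee_fin.
have [c [c0 cE cP]] := IH (q \o S) (a \o S) (fun i => q01 i.+1) (fun i => a1 i.+1).
set e := extinction n _ _ in cE.
have a00 i : (0 <= a i)%R by apply: le_trans (a1 i).
have /andP[q0 q1] := q01 0%N.
have /andP[e0 e1] := @extinction_itv R n (q \o S) (a \o S) (fun i => q01 i.+1) (fun i => a00 i.+1).
have ub01 : (0 <= q 0%N * (1 - e) <= 1)%R.
  by rewrite mulr_ge0 ?subr_ge0//= mulr_ile1// ?subr_ge0// gerBl.
(* The point of tangency is the probability that a given edge at the root is retained and leads to a
   surviving subtree. The slope there multiplies the coefficients obtained for the subtree. *)
have [c' [d [c'0 d0 cdE cdP]]] := powR_compl_tangent (a1 0%N) ub01.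
exists (fun k => if k is j.+1 then d * c j else c')%R; split.
- by case=> // k; rewrite mulr_ge0.
- rewrite big_ord_recl big_ord0 mulr1 /= -/e -cdE -cE !mulr_sumr; congr (_ + _)%R.
  by apply: eq_bigr => i _; rewrite big_ord_recl/=; ring.
move=> A mA ndA dA A0.
pose w := \int[mu]_x avoidance n (section (A n.+1) x) (a \o S).
have w01 : 0 <= w <= 1.
  apply: ge0_le_lower_integral1 => x.
  by rewrite avoidance_ge0 avoidance_le1// => i _; exact: a00.
have AS k : A k.+1 `<=` A 1%N.
  by elim: k => // k IHk; apply: subset_trans (ndA _) IHk.
(* If x is not an admissible first label, the section is empty and is avoided with probability 1.
   Otherwise the section of [A 1] is everything, and the sections form a family that is one level
   shorter. *)
have key x : 1 <= avoidance n (section (A n.+1) x) (a \o S) +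
    \sum_(k < n.+1) (c k)%:E * iterated_measure k (section (A k.+1) x).
  have [Ax0|nAx0] := pselect (A 1%N (scons x (fun=> 0%R))); last first.
    rewrite (_ : section (A n.+1) x = set0); last first.
      apply/seteqP; split => // v /AS Av; apply: nAx0; move: Av.
      by apply: dA => -[].
    rewrite avoidance_set0 leeDl// sume_ge0// => k _.
    by rewrite mule_ge0 ?lee_fin// iterated_measure_ge0.
  have A1x : section (A 1%N) x = setT.
    by apply/seteqP; split => // v _; move: Ax0; apply: dA => -[].
  apply: (cP (fun k => section (A k.+1) x)) => //.
  - by move=> k; exact: measurable_section.
  - by move=> k v; exact: ndA.
  - by move=> k; exact: depends_on_section.
have wfin : w \is a fin_num.
  by have /andP[w0 w1] := w01; rewrite ge0_fin_numE// (le_lt_trans w1)// ltry.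
have wE : w = (fine w)%:E by rewrite fineK.
pose L := \sum_(k < n.+1) (c k)%:E * iterated_measure k.+1 (A k.+1).
have wL : 1 <= w + L.
  have mI k : measurable_fun setT (fun x => iterated_measure k (section (A k.+1) x)).
    exact: measurable_iterated_measure_section.
  have -> : L = \int[mu]_x \sum_(k < n.+1) (c k)%:E * iterated_measure k (section (A k.+1) x).
    rewrite ge0_integral_sum//; last 2 first.
    - by move=> k; apply: emeasurable_funM => //.
    - by move=> k x _; rewrite mule_ge0 ?lee_fin ?iterated_measure_ge0.
    apply: eq_bigr => k _; rewrite iterated_measureS ge0_integralZl//.
    - by move=> x _; exact: iterated_measure_ge0.
    - by rewrite lee_fin.
  rewrite /w -ge0_integralD//; last 4 first.
  - by move=> x _; exact: avoidance_ge0.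
  - exact: measurable_avoidance_section.
  - by move=> x _; apply: sume_ge0 => k _; rewrite mule_ge0 ?lee_fin ?iterated_measure_ge0.
  - by apply: emeasurable_sum => k; apply: emeasurable_funM.
  apply: (@le_trans _ _ (\int[mu]_x cst 1 x)).
    by rewrite integral_cst//= mul1e probability_setT.
  by apply: ge0_le_lower_integral.
rewrite big_ord_recl {1}/iterated_measure/= A0 setCK indicT mule1.
rewrite -/w.
have -> : \sum_(i < n.+1) (d * c i)%:E * iterated_measure (bump 0 i) (A (bump 0 i)) = d%:E * L.
  rewrite ge0_sume_distrr; last first.
    by move=> k _; rewrite mule_ge0 ?lee_fin ?iterated_measure_ge0.
  by apply: eq_bigr => k _; rewrite muleA -EFinM.
have Lfin : L \is a fin_num.
  apply/sum_fin_numP => k _ _; apply: fin_numM => //.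
  rewrite ge0_fin_numE ?iterated_measure_ge0//.
  exact: le_lt_trans (iterated_measure_le1 _ _) (ltry _).
move: w01 wL; rewrite wE -(fineK Lfin) poweR_EFin -EFinM -!EFinD !lee_fin.
move: (fine w) (fine L) => w' L' w01 wL.
have := cdP (1 - w')%R; rewrite subr_ge0 gerBl opprD opprK addNKr andbC w01 => /(_ isT).
have : (d * (1 - w') <= d * L')%R by rewrite ler_wpM2l//; lra.
lra.
Qed.

(** Fixing the first label x leaves the shifted product if x is in [E 0] and the empty set
    otherwise; so the inner integral is 1 - mu(E 0) (1 - e), with e the extinction probability one
    level down. *)
Lemma avoidance_product n (E : nat -> set R) a :
  (forall i, measurable (E i)) -> (forall i, (0 <= a i)%R) ->
  avoidance n [set v | forall i, (i < n)%N -> E i (v i)] a =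
  (extinction n (fun i => fine (mu (E i))) a)%:E.
Proof.
elim: n E a => [|n IH] E a mE a0; first by rewrite /= indicE memNset//=; exact.
have P01 i : (0 <= fine (mu (E i)) <= 1)%R.
  by rewrite fine_ge0//= -lee_fin fineK ?fin_num_measure// probability_le1.
rewrite /=; set e := extinction _ _ _.
have /andP[e0 e1] : (0 <= e <= 1)%R by apply: extinction_itv => i /=.
rewrite -poweR_EFin; congr (_ `^ _).
under eq_integral => x _.
  rewrite (_ : avoidance _ _ _ =
      (\1_(~` E 0%N) x)%:E + e%:E * (\1_(E 0%N) x)%:E); last first.
    have [Ex|nEx] := pselect (E 0%N x).
      rewrite !indicE (mem_set Ex) memNset//= mule1 add0e.
      have := IH (E \o S) (a \o S) (fun i => mE i.+1) (fun i => a0 i.+1).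
      rewrite -/e => <-; congr (avoidance n _ _).
      apply/seteqP; split => v /= H; first by move=> i im; exact: (H i.+1).
      by move=> [|i] //= im; exact: H.
    rewrite (_ : section _ x = set0); last first.
      by apply/seteqP; split => // v /= /(_ 0%N isT).
    by rewrite avoidance_set0 !indicE (memNset nEx) mem_set//= mule0 adde0.
  over.
rewrite ge0_integralD//; last 3 first.
- by apply/measurable_EFinP; apply: measurable_indic; exact: measurableC.
- by move=> x _; rewrite mule_ge0 ?lee_fin.
- by apply: emeasurable_funM => //; apply/measurable_EFinP; exact: measurable_indic.
rewrite ge0_integralZl//; last by apply/measurable_EFinP; exact: measurable_indic.
rewrite !integral_indic//; last exact: measurableC.
rewrite !setIT; have := probability_setC mu (mE 0%N); rewrite /= => ->.
rewrite -(fineK (fin_num_measure mu _ (mE 0%N))).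
by rewrite -EFinB -EFinM -EFinD; congr EFin; ring.
Qed.

End Avoid.

(** * Psi for closed targets *)

Lemma continuous_ptws (R : realType) (Z : topologicalType) (I : eqType)
    (f : Z -> {ptws I -> R}) :
  (forall i, continuous (fun z => f z i)) -> continuous f.
Proof.
move=> cf z; apply/cvg_sup => i A; rewrite nbhsE => -[B [[V oV <-] Vfz] BA].
by apply: filterS BA _; apply: (cf i z); apply: open_nbhs_nbhs.
Qed.

Lemma closed_section (R : realType) (B : set {ptws nat -> R}) (x : R) :
  closed B -> closed (section B x : set {ptws nat -> R}).
Proof.
move=> cB; apply: (@preimage_closed {ptws nat -> R} {ptws nat -> R} (scons x)) => // v _.
apply: continuous_ptws => -[|i] w /=; first exact: cst_continuous.
exact: (@proj_continuous nat (fun=> R) i w).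
Qed.

Section PsiTheory.
Context {R : realType} (mu : probability R R).
Implicit Types (A : set (nat -> R)) (a : nat -> R) (n : nat).

Definition prefix (v : nat -> R) n : n.-tuple R := [tuple v i | i < n].

Lemma nth_prefix v n i : (i < n)%N -> nth 0%R (prefix v n) i = v i.
Proof. by move=> ilt; rewrite -(tnth_mktuple (fun j : 'I_n => v j) (Ordinal ilt)) (tnth_nth 0%R). Qed.

Lemma prefix_scons x v n : [tuple of x :: prefix v n] = prefix (scons x v) n.+1.
Proof.
apply: eq_from_tnth => i; rewrite tnth_mktuple (tnth_nth 0%R)/=.
by case: i => -[|i]//= ilt; rewrite nth_prefix.
Qed.

Lemma prefix1 x v : [tuple x] = prefix (scons x v) 1.
Proof. by apply: eq_from_tnth => i; rewrite tnth_mktuple ord1. Qed.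

Lemma behead_prefix a n : behead_tuple (prefix a n.+1) = prefix (a \o S) n.
Proof.
apply: eq_from_tnth => i; rewrite tnth_mktuple tnth_behead tnth_mktuple /=.
by rewrite inordK// ltnS.
Qed.

Lemma thead_prefix a n : thead (prefix a n.+1) = a 0%N.
Proof. by rewrite /thead tnth_mktuple. Qed.

Lemma Psi1E (B : set (1.-tuple R)) a :
  Psi mu B (prefix a 1) = (Pr mu [set x | ~ B [tuple x]]) `^ (a 0%N).
Proof. by rewrite /= thead_prefix. Qed.

Lemma PsiSE n (B : set (n.+2.-tuple R)) a :
  Psi mu B (prefix a n.+2) =
  (\int[mu]_x Psi mu (section_target B x) (prefix (a \o S) n.+1)) `^ (a 0%N).
Proof. by rewrite -behead_prefix -(thead_prefix a n.+1). Qed.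

Lemma Psi_ge0 n (B : set (n.-tuple R)) a : 0 <= Psi mu B (prefix a n).
Proof.
by case: n B => [|[|n]] B //; rewrite ?Psi1E ?PsiSE; exact: poweR_ge0.
Qed.

Lemma Psi_le1 n (B : set (n.-tuple R)) a : (forall i, 0 <= a i)%R ->
  Psi mu B (prefix a n) <= 1.
Proof.
case: n B => [|n] B; first by move=> _; exact: lee01.
elim: n B a => [|n IH] B a a0.
  by rewrite Psi1E poweR_le1// mu_ext_ge0//= outer_measure_le1.
rewrite PsiSE poweR_le1//; apply: ge0_le_lower_integral1 => x.
by rewrite Psi_ge0 IH// => i; exact: a0.
Qed.

Lemma Psi_anti n (B C : set (n.-tuple R)) a : (forall i, 0 <= a i)%R ->
  B `<=` C -> Psi mu C (prefix a n) <= Psi mu B (prefix a n).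
Proof.
case: n B C => [|n] B C; first by [].
elim: n B C a => [|n IH] B C a a0 BC.
  rewrite !Psi1E poweR_le// ?mu_ext_ge0//.
  by apply: le_mu_ext => x /= nC /BC.
rewrite !PsiSE; apply: poweR_le => //.
  by apply: integral_ge0 => x _; exact: Psi_ge0.
apply: ge0_le_lower_integral => x; first exact: Psi_ge0.
by apply: IH => [i|t]; [exact: a0|exact: BC].
Qed.

(** For measurable targets the outer measure at the innermost step of [Psi] is a measure, hence the
    integral of an indicator, as in [avoidance]; the outer steps have the same form. *)
Lemma Psi_avoidance n (B : set (n.+1.-tuple R)) A a :
  (forall v, A v <-> B (prefix v n.+1)) -> measurable (A : set (config R nat)) ->
  Psi mu B (prefix a n.+1) = avoidance mu n.+1 A a.
Proof.
elim: n B A a => [|n IH] B A a AB mA.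
  have ABx x : (section A x (fun=> 0%R)) <-> B [tuple x].
    by rewrite (prefix1 x (fun=> 0%R)); exact: AB.
  have ABs : [set x | ~ B [tuple x]] = ~` ((fun x : R => scons x (fun=> 0%R)) @^-1` A).
    by apply/seteqP; split => x /= H /ABx.
  have mB : measurable [set x : R | ~ B [tuple x]].
    rewrite ABs; apply: measurableC; rewrite -[X in measurable X]setTI.
    have H : measurable_fun setT (fun x : R => scons x (fun=> 0%R) : config R nat).
      by apply: measurable_scons; [exact: measurable_id|exact: measurable_cst].
    exact: H.
  rewrite Psi1E /=; congr (_ `^ _); rewrite /Pr measurable_mu_extE//.
  rewrite -[in LHS](setIT [set x : R | ~ B [tuple x]]) -integral_indic//.
  by rewrite ABs; apply: eq_integral => x _; rewrite !indicE.
rewrite PsiSE; congr (_ `^ _); apply: eq_integral => x _.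
apply: IH; last exact: measurable_section.
by move=> v; rewrite /section_target/= prefix_scons; exact: AB.
Qed.

Lemma Psi_set0 n a : Psi mu (set0 : set (n.+1.-tuple R)) (prefix a n.+1) = 1.
Proof.
by rewrite (Psi_avoidance (A := set0))// avoidance_set0.
Qed.

End PsiTheory.

(** Half of the error goes into a measurable inner set obtained by capacitability and half into a
    measurable hull, both for the law of [f]. *)
Lemma shadow_sandwich d (T : measurableType d) (R : realType)
    (P : probability T R) (f : {mfun T >-> config R nat})
    (I : eqType) (idx : I -> nat) (B : set (I -> R)) n (e : R) :
  injective idx -> closed (B : set {ptws I -> R}) -> (0 < e)%R ->
  exists A H : set (config R nat), [/\ measurable A, measurable H,
    A `<=` shadow idx B n, shadow idx B n `<=` H &
    P (f @^-1` H) <= P (f @^-1` A) + e%:E].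
Proof.
move=> idx_inj cB e0; have e20 : (0 < e / 2)%R by rewrite divr_gt0.
have [A [mA AB PA]] := shadow_capacitable idx_inj (distribution P f) n cB e20.
have [H [mH BH PH]] := outer_measure_hull (distribution P f) (shadow idx B n) e20.
exists A, H; split => //; apply: (le_trans PH).
by rewrite [in leRHS](splitr e) EFinD addeA leeD2r.
Qed.

Section PsiProjection.
Context {R : realType} (mu : probability R R).
Implicit Types (B : set (nat -> R)) (a : nat -> R) (n : nat).

(** Carries the law [mu] of a single label into sequence space, where the sandwich is available;
    shadows at level 1 read coordinate 0 only. *)
Definition const_config (x : R) : config R nat := fun=> x.

Lemma measurable_const_config : measurable_fun setT const_config.
Proof. by apply: measurable_to_config => i; exact: measurable_id. Qed.

HB.instance Definition _ :=
  isMeasurableFun.Build _ _ _ _ const_config measurable_const_config.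

(** The sections reduce this to one label, where an outer measure has to be bounded above by a lower
    integral. The sandwich A, H closes this gap: the complement of A has at most the measure of the
    complement of H plus e, and for labels outside H the section is empty, so that the integrand is
    1. *)
Lemma Psi_shadowS n B a : closed (B : set {ptws nat -> R}) ->
  (forall i, 0 <= a i)%R ->
  Psi mu [set t : n.+1.-tuple R | shadow id B n.+1 (nth 0%R t)] (prefix a n.+1) <=
  Psi mu [set t : n.+2.-tuple R | shadow id B n.+2 (nth 0%R t)] (prefix a n.+2).
Proof.
have secE m C (x : R) : section_target [set t : m.+2.-tuple R | shadow id C m.+2 (nth 0%R t)] x
   = [set t : m.+1.-tuple R | shadow id (section C x) m.+1 (nth 0%R t)].
  apply/seteqP; split => t /= [y Cy yt].
    exists (y \o S); last by move=> i im; exact: (yt i.+1).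
    rewrite /section/= (_ : scons x _ = y)//; apply/funext => -[|i] //=.
    by rewrite (yt 0%N).
  by exists (scons x y) => // -[|i] //= im; exact: yt.
elim: n B a => [|n IH] B a cB a0; last first.
  rewrite !PsiSE; apply: poweR_le => //.
    by apply: integral_ge0 => x _; exact: Psi_ge0.
  apply: ge0_le_lower_integral => x; first exact: Psi_ge0.
  rewrite !secE; apply: IH => [|i]; [exact: closed_section|exact: a0].
rewrite Psi1E PsiSE; apply: poweR_le => //; first exact: mu_ext_ge0.
apply/lee_addgt0Pr => e e0.
have [A [H [mA mH AB BH PH]]] := shadow_sandwich mu const_config 1 (@inj_id nat) cB e0.
have mA' : measurable (const_config @^-1` A).
  by rewrite -[X in measurable X]setTI; exact: measurable_const_config.
have mH' : measurable (const_config @^-1` H).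
  by rewrite -[X in measurable X]setTI; exact: measurable_const_config.
apply: (@le_trans _ _ (mu (~` (const_config @^-1` A)))).
  rewrite -(measurable_mu_extE mu (measurableC mA')); apply: le_mu_ext => x /= nB Ax.
  apply: nB; have [y By yx] := AB _ Ax; exists y => // -[|i] //= _.
  by rewrite yx.
apply: (@le_trans _ _ (mu (~` (const_config @^-1` H)) + e%:E)).
  have -> := probability_setC mu mA'; have -> := probability_setC mu mH'.
  have fA := fin_num_measure mu _ mA'; have fH := fin_num_measure mu _ mH'.
  move: PH fA fH; rewrite /=; move: (mu _) (mu _) => [rH| |] [rA| |] //.
  by rewrite -!EFinB -!EFinD !lee_fin => PH _ _; lra.
apply: leeD2r; rewrite -[X in mu X]setIT -integral_indic//; last exact: measurableC.
apply: ge0_le_lower_integral => x; first by rewrite lee_fin.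
rewrite indicE; have [Hx|nHx] := pselect (H (const_config x)).
  by rewrite memNset ?Psi_ge0//= => /(_ Hx).
rewrite mem_set// secE.
have -> : [set t : 1.-tuple R | shadow id (section B x) 1 (nth 0%R t)] = set0.
  apply/seteqP; split => // t /= [y By yt]; apply: nHx; apply: BH.
  by exists (scons x y) => // -[|i].
by rewrite Psi_set0.
Qed.

End PsiProjection.

(** * Resampling labels *)

Section Boxes.
Context {R : realType} (I : choiceType).

(** A generating pi-system on which the i.i.d. hypothesis determines the law of the labels. *)
Definition boxes : set (set (config R I)) :=
  [set A | exists (J : {fset I}) (E : I -> set R), (forall s, measurable (E s)) /\
     A = [set v | forall s, s \in J -> E s (v s)]].

Lemma boxes_generate : @measurable _ (config R I) = <<s boxes >>.
Proof.
apply/seteqP; split.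
  apply: smallest_sub; first exact: smallest_sigma_algebra.
  move=> _ [i [E [mE ->]]]; apply: sub_sigma_algebra.
  exists [fset i]%fset, (fun=> E); split => //.
  by apply/seteqP; split => v /= H; [move=> s; rewrite in_fset1 => /eqP ->|apply: H; rewrite in_fset1].
apply: smallest_sub; first exact: sigma_algebra_measurable.
move=> _ [J [E [mE ->]]].
rewrite (_ : [set v | _] = \bigcap_(s in [set` J]) [set v : config R I | E s (v s)]); last first.
  by apply/seteqP; split => v /= H s; exact: H.
apply: fin_bigcap_measurable; first exact: finite_fset.
move=> s _; rewrite -[X in measurable X]setTI.
by apply: (@measurable_config_coord R I s).
Qed.

Lemma boxes_setI_closed : setI_closed boxes.
Proof.
move=> _ _ [J [E [mE ->]]] [K [F [mF ->]]].
exists (J `|` K)%fset, (fun s => (if s \in J then E s else setT) `&`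
  (if s \in K then F s else setT)); split.
  by move=> s; apply: measurableI; case: ifP.
apply/seteqP; split => v /=.
  by move=> [HJ HK] s _; split; case: ifP => // sJ; [exact: HJ|exact: HK].
by move=> H; split => s sJ; have := H s; rewrite in_fsetU sJ ?orbT => /(_ isT)[].
Qed.

Lemma boxesT : boxes setT.
Proof. by exists fset0, (fun=> setT); split => //; apply/seteqP; split. Qed.

Definition update (v : I -> R) (s : I) (y : R) : I -> R :=
  fun t => if t == s then y else v t.

Lemma measurable_update d (Z : measurableType d) (f : Z -> config R I) (g : Z -> R) s :
  measurable_fun setT f -> measurable_fun setT g ->
  measurable_fun setT (fun z => update (f z) s (g z) : config R I).
Proof.
move=> mf mg; apply: measurable_to_config => t; rewrite /update; case: eqP => _ //.
exact: (measurableT_comp (@measurable_config_coord R I t) mf).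
Qed.

End Boxes.

Section Resample.
Context {R : realType} {d : measure_display} {Omega : measurableType d}.
Variables (P : probability Omega R) (T : rooted_tree).
Variables (X : T -> {RV P >-> R}) (mu : probability R R).
Hypothesis iidX : iid X mu.

(* The label of the root, which is not part of the i.i.d. family, is erased. *)
Definition labels (w : Omega) : config R T :=
  fun s => if s == tree_root then 0%R else X s w.

Lemma measurable_labels : measurable_fun setT labels.
Proof.
apply: measurable_to_config => s; rewrite /labels; case: eqP => _ //.
Qed.

HB.instance Definition _ := isMeasurableFun.Build _ _ _ _ labels measurable_labels.

Definition labels_off (t : T) (w : Omega) : config R T := update (labels w) t 0%R.

Lemma measurable_labels_off t : measurable_fun setT (labels_off t).
Proof.
by apply: measurable_update; [exact: measurable_labels|exact: measurable_cst].
Qed.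

HB.instance Definition _ t :=
  isMeasurableFun.Build _ _ _ _ (labels_off t) (@measurable_labels_off t).

(** For fixed [B] both sides are finite measures in [A], so they need only be compared on boxes. A
    box constrains the erased labels, at the root and at [t], only through the value 0; the other
    constraints are covered by the i.i.d. hypothesis. *)
Lemma labels_off_indep t (A : set (config R T)) (B : set R) :
  t <> tree_root -> measurable A -> measurable B ->
  P ((labels_off t @^-1` A) `&` (X t @^-1` B)) = P (labels_off t @^-1` A) * mu B.
Proof.
move=> tr mA mB; have [Xmu Xind] := iidX.
have mXB : measurable (X t @^-1` B).
  by rewrite -[X in measurable X]setTI; exact: measurable_funPT.
pose m1 : {measure set (config R T) -> \bar R} :=
  measure_function_pushforward__canonical__measure_function_Measure
    (mrestr P mXB) (@measurable_labels_off t).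
have mB0 : (0 <= fine (mu B))%R by rewrite fine_ge0.
pose m2 : {measure set (config R T) -> \bar R} :=
  mscale (NngNum mB0) (distribution P (labels_off t)).
have m1E C : m1 C = P ((labels_off t @^-1` C) `&` (X t @^-1` B)) by [].
have m2E C : m2 C = P (labels_off t @^-1` C) * mu B.
  by rewrite muleC -[X in X * _](fineK (fin_num_measure mu _ mB)).
rewrite -m1E -m2E.
apply: (@measure_unique _ R (config R T) (@boxes R T) (fun=> setT) _ _ _ _ m1 m2) => //.
- exact: boxes_generate.
- exact: boxes_setI_closed.
- by move=> _; exact: boxesT.
- by apply/seteqP; split => // v _; exists 0%N.
- move=> _ [J [E [mE ->]]].
  rewrite m1E m2E.
  (* If the box excludes the value 0 at an erased vertex, both sides vanish. *)
  have [ok|nok] := pselect (forall s, s \in J -> s = tree_root \/ s = t -> E s 0%R); last first.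
    rewrite (_ : _ @^-1` _ = set0) ?set0I ?measure0 ?mul0e//.
    apply/seteqP; split => // w /= H; apply: nok => s sJ st.
    have := H s sJ; rewrite /labels_off /update /labels.
    by case: eqP => // ?; case: eqP => // ?; case: st.
  pose K := (J `\ tree_root `\ t)%fset.
  pose F s := if s == t then B else E s.
  have mF s : measurable (F s) by rewrite /F; case: ifP.
  have KE s : s \in K = [&& s != t, s != tree_root & s \in J].
    by rewrite !inE.
  have E1 : labels_off t @^-1` [set v | forall s, s \in J -> E s (v s)] =
      \bigcap_(s in [set` K]) (X s @^-1` F s).
    apply/seteqP; split => w /= H s.
      rewrite /= KE => /and3P[st sr sJ]; have := H s sJ.
      by rewrite /labels_off /update /labels /F (negbTE st) (negbTE sr).
    move=> sJ; rewrite /labels_off /update /labels.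
    case: eqP => [st|/eqP st]; first by apply: ok => //; right.
    case: eqP => [sr|/eqP sr]; first by apply: ok => //; left.
    by have := H s; rewrite /= KE st sr sJ /F (negbTE st); exact.
  have rK : tree_root \notin K by rewrite KE eqxx andbF.
  have tK : t \notin K by rewrite KE eqxx.
  rewrite E1 (Xind K F rK mF).
  have -> : (\bigcap_(s in [set` K]) (X s @^-1` F s)) `&` (X t @^-1` B) =
      \bigcap_(s in [set` (t |` K)%fset]) (X s @^-1` F s).
    apply/seteqP; split => w /=.
      move=> [H Bt] s /=; rewrite in_fset1U => /orP[/eqP ->|]; last exact: H.
      by rewrite /F eqxx.
    move=> H; split => [s sK|]; first by apply: H => /=; rewrite in_fset1U sK orbT.
    by have := H t; rewrite /= in_fset1U eqxx /F eqxx; exact.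
  rewrite Xind//; last by rewrite in_fset1U negb_or rK andbT; apply/eqP => /esym.
  by rewrite big_fsetU1//= {1}/F eqxx Xmu// muleC.
- move=> _; rewrite m1E.
  by rewrite preimage_setT setTI ltey_eq fin_num_measure.
Qed.

Lemma update_update (I : choiceType) (v : I -> R) s x y :
  update (update v s x) s y = update v s y.
Proof. by apply/funext => t; rewrite /update; case: eqP. Qed.

Lemma labels_update t w : t <> tree_root -> labels w = update (labels_off t w) t (X t w).
Proof.
move=> tr; apply/funext => s; rewrite /labels_off /update /labels.
have [->|_] := eqVneq s t => //; by case: eqP.
Qed.

Let labels_pair t (w : Omega) : config R T * R := (labels_off t w, X t w).

Let measurable_labels_pair t : measurable_fun setT (labels_pair t).
Proof. by apply/measurable_fun_pairP; split; [exact: measurable_labels_off|exact: measurable_funPT]. Qed.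

HB.instance Definition _ t :=
  isMeasurableFun.Build _ _ _ _ (labels_pair t) (@measurable_labels_pair t).

(** The label at [t] is independent of all the others together, so the pair they form has a product
    law, and Tonelli's theorem allows the label at [t] to be integrated for given values of the
    others. *)
Lemma resample t (F : config R T -> \bar R) : t <> tree_root ->
  measurable_fun setT F -> (forall v, 0 <= F v) ->
  \int[P]_w F (labels w) = \int[P]_w \int[mu]_y F (update (labels w) t y).
Proof.
move=> tr mF F0.
pose G (z : config R T * R) := F (update z.1 t z.2).
have mG : measurable_fun setT G.
  apply: (measurableT_comp mF); apply: measurable_update; first exact: measurable_fst.
  exact: measurable_snd.
have G0 z : 0 <= G z by exact: F0.
have -> : \int[P]_w F (labels w) = \int[P]_w (G \o labels_pair t) w.
  by apply: eq_integral => w _; rewrite /G /= -labels_update.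
rewrite -ge0_integral_distribution//.
pose D := distribution P (labels_off t).
have -> : \int[distribution P (labels_pair t)]_z G z = \int[D \x mu]_z G z.
  apply: eq_measure_integral => A mA _; symmetry.
  apply: product_measure_unique => // A1 A2 mA1 mA2 /=.
  by rewrite -labels_off_indep.
rewrite (fubini_tonelli1 G mG G0).
rewrite (@ge0_integral_distribution _ _ _ _ _ P (labels_off t)); last 2 first.
- exact: (@measurable_fun_fubini_tonelli_F _ _ _ _ _ mu _ mG G0).
- by move=> v; apply: integral_ge0.
apply: eq_integral => w _ /=; apply: eq_integral => y _.
by rewrite /G /labels_off/= update_update.
Qed.

End Resample.

(** * Percolation on trees *)

Section TreeCombinatorics.
Variable T : rooted_tree.
Implicit Types s t : T.

Definition kids s : {fset T} := fset_set (children s).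
Definition generation n : {fset T} := fset_set (@level_set T n).

Lemma in_kids s t : (t \in kids s) = (t != tree_root) && (parent t == s).
Proof.
rewrite in_fset_set; last exact: locally_finite.
apply/idP/idP => [/set_mem[/eqP -> ->]|/andP[/eqP tr /eqP ts]]; first by rewrite eqxx.
by apply/mem_set.
Qed.

Lemma level_kid s t : t \in kids s -> level t = (level s).+1.
Proof. by rewrite in_kids => /andP[/eqP tr /eqP <-]; exact: level_parent. Qed.

Lemma level_eq0 s : level s = 0%N -> s = tree_root.
Proof. by move=> s0; apply: contrapT => /level_parent; rewrite s0. Qed.

Lemma level_set_finite n : finite_set (@level_set T n).
Proof.
elim: n => [|n IH].
  by apply: (@sub_finite_set _ _ [set tree_root]) => // s /level_eq0.
apply: (@sub_finite_set _ _ (\bigcup_(s in @level_set T n) children s)); last first.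
  by apply: bigcup_finite => // s _; exact: locally_finite.
move=> t tn; have tr : t <> tree_root by move=> te; move: tn; rewrite /level_set/= te level_tree_root.
exists (parent t) => //; rewrite /level_set/=.
by have := level_parent tr; rewrite tn => -[].
Qed.

Lemma in_generation n s : (s \in generation n) = (level s == n).
Proof.
rewrite in_fset_set; last exact: level_set_finite.
by apply/idP/eqP => [/set_mem//|sn]; apply/mem_set.
Qed.

Lemma generation0 : generation 0 = [fset (tree_root : T)]%fset.
Proof.
apply/fsetP => s; rewrite in_generation in_fset1; apply/eqP/eqP => [/level_eq0//|->].
exact: level_tree_root.
Qed.

Lemma big_generationS (R : Type) (idx : R) (op : Monoid.com_law idx) n (F : T -> R) :
  \big[op/idx]_(t <- generation n.+1) F t =
  \big[op/idx]_(s <- generation n) \big[op/idx]_(t <- kids s) F t.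
Proof.
have kidsE s : s \in generation n -> kids s = [fset t in generation n.+1 | parent t == s]%fset.
  rewrite in_generation => /eqP sn; apply/fsetP => t.
  rewrite in_kids !inE /= in_generation.
  apply/andP/andP => -[H1 /eqP H2]; split; rewrite ?H2//.
    by rewrite (level_parent (elimN eqP H1)) H2 sn.
  by apply/eqP => tr; move: H1; rewrite tr level_tree_root.
transitivity (\big[op/idx]_(s <- generation n) \big[op/idx]_(t <- generation n.+1 | parent t == s) F t).
  rewrite (exchange_big_dep xpredT)//= big_seq [RHS]big_seq; apply: eq_bigr => t.
  rewrite in_generation => /eqP tn.
  have tr : t <> tree_root by move=> te; move: tn; rewrite te level_tree_root.
  have pn : parent t \in generation n.
    by rewrite in_generation; apply/eqP; have := level_parent tr; rewrite tn => -[].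
  rewrite big_mkcond (big_fsetD1 (parent t))//= eqxx big1_seq ?Monoid.mulm1// => s.
  by rewrite /= !inE => /andP[/negbTE sp _]; rewrite eq_sym sp.
rewrite big_seq [RHS]big_seq; apply: eq_bigr => s sn.
by rewrite (kidsE s sn) -big_fset_condE.
Qed.

Fixpoint descendants (j : nat) s : nat :=
  if j is i.+1 then \sum_(t <- kids s) descendants i t else 1.

Lemma level_size_descendants k j :
  level_size T (k + j) = (\sum_(s <- generation k) descendants j s)%N.
Proof.
elim: j k => [|j IH] k /=.
  by rewrite addn0 /level_size sum1_size.
by rewrite addnS -addSn IH big_generationS.
Qed.

Lemma level_size_root j : level_size T j = descendants j tree_root.
Proof. by rewrite -[j]add0n level_size_descendants generation0 big_seq_fset1. Qed.

Lemma level_size0 : level_size T 0 = 1%N.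
Proof. by rewrite level_size_root. Qed.

Variable N : option nat.
Hypothesis heightT : has_height T N.

(** A vertex beyond level m would have an ancestor at level m + 1, whose parent is at level m and
    hence a leaf; the induction climbs to it one parent at a time. *)
Lemma leh_level s : leh (level s) N.
Proof.
case: N heightT => // m h /=; rewrite leqNgt; apply/negP => ms.
have [k] : exists k, level s = (m + k.+1)%N by exists (level s - m.+1)%N; lia.
elim: k s {ms} => [|k IH] s sk.
  have sr : s <> tree_root by move=> se; move: sk; rewrite se level_tree_root; lia.
  have := level_parent sr => pl.
  have : leaf (parent s) by apply/h; congr Some; lia.
  by move/seteqP => [/(_ s) + _]; apply.
have sr : s <> tree_root by move=> se; move: sk; rewrite se level_tree_root; lia.
by apply: (IH (parent s)); have := level_parent sr; lia.
Qed.

Lemma kids_neq0 s : lth (level s) N -> kids s != fset0.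
Proof.
move=> sN; apply/negP => /eqP k0.
have : leaf s.
  apply/seteqP; split => // t ts; have : t \in kids s.
    by rewrite in_fset_set ?mem_set//; exact: locally_finite.
  by rewrite k0 inE.
by move/heightT => E; move: sN; rewrite E /= ltnn.
Qed.

Lemma lth_leh n k : (k < n)%N -> leh n N -> lth k N.
Proof. by case: N => //= m; exact: leq_trans. Qed.

Lemma leh_leq n k : (k <= n)%N -> leh n N -> leh k N.
Proof. by case: N => //= m; exact: leq_trans. Qed.

Lemma descendants_gt0 j s : leh (level s + j) N -> (0 < descendants j s)%N.
Proof.
elim: j s => //= j IH s sj.
have /fset0Pn[t ts] : kids s != fset0.
  by apply: kids_neq0; apply: lth_leh sj; rewrite addnS ltnS leq_addr.
rewrite (big_fsetD1 t)//= addn_gt0 IH//.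
by rewrite (level_kid ts) addSn -addnS.
Qed.

Lemma level_size_gt0 n : leh n N -> (0 < level_size T n)%N.
Proof. by move=> nN; rewrite level_size_root descendants_gt0// level_tree_root. Qed.

Lemma level_size_leS n : lth n N -> (level_size T n <= level_size T n.+1)%N.
Proof.
move=> nN; rewrite -(addn0 n) -addnS !level_size_descendants /=.
rewrite !big_seq; apply: leq_sum => s.
rewrite in_generation => /eqP sn.
have /fset0Pn[t ts] : kids s != fset0 by apply: kids_neq0; rewrite sn.
by rewrite (big_fsetD1 t)//= leq_addr.
Qed.

Lemma level_inhabited n : leh n N -> exists s : T, level s = n.
Proof.
move=> /level_size_gt0; rewrite /level_size cardfs_gt0 => /fset0Pn[s].
by rewrite -/(generation n) in_generation => /eqP sn; exists s.
Qed.

Lemma level_iter_parent k s : (k <= level s)%N ->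
  level (iter k parent s) = (level s - k)%N.
Proof.
elim: k => [|k IH] kl; first by rewrite subn0.
rewrite iterS; have := IH (ltnW kl) => E.
have : iter k parent s <> tree_root.
  by move=> r; move: E; rewrite r level_tree_root; lia.
by move=> /level_parent; lia.
Qed.

Lemma level_ancestor s j : (j <= level s)%N -> level (ancestor s j) = j.
Proof. by move=> js; rewrite /ancestor level_iter_parent ?leq_subr// subKn. Qed.

Lemma ancestor_level s : ancestor s (level s) = s.
Proof. by rewrite /ancestor subnn. Qed.

Lemma ancestor_parent t j : t <> tree_root -> (j <= level (parent t))%N ->
  ancestor t j = ancestor (parent t) j.
Proof.
by move=> tr jt; rewrite /ancestor (level_parent tr) subSn// iterSr.
Qed.

End TreeCombinatorics.

Section Glue.
Context {R : realType} {T : rooted_tree}.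
Implicit Types (s t : T) (v : T -> R) (y : nat -> R).

(** The labels met on the way to s, continued by y. Coordinate i is the label at level i + 1, since
    the root carries no label. *)
Definition glue s v y : nat -> R :=
  fun i => if (i < level s)%N then v (ancestor s i.+1) else y (i - level s)%N.

Lemma glue_root v y : glue tree_root v y = y.
Proof. by apply/funext => i; rewrite /glue level_tree_root subn0. Qed.

Lemma glue_scons t v y : t <> tree_root ->
  glue t v y = glue (parent t) v (scons (v t) y).
Proof.
move=> tr; apply/funext => i; rewrite /glue (level_parent tr).
have [ilt|ige] := ltnP i (level (parent t)).
  by rewrite ltnS ltnW// ancestor_parent.
rewrite ltnS; have [->|ine] := eqVneq i (level (parent t)).
  by rewrite leqnn subnn /= -(level_parent tr) ancestor_level.
rewrite leqNgt ltn_neqAle eq_sym ine ige /= subnS.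
have : (0 < i - level (parent t))%N by rewrite subn_gt0 ltn_neqAle eq_sym ine.
by case: (i - _)%N.
Qed.

(** A vertex other than s at the same level or deeper does not lie on the path to s, so its label is
    not read. *)
Lemma glue_update s t x v y : (level s <= level t)%N -> s <> t ->
  glue s (update v t x) y = glue s v y.
Proof.
move=> st snt; apply/funext => i; rewrite /glue /update; case: ltnP => // ilt.
case: eqP => // E; have := level_ancestor ilt; rewrite E => Et.
have il : i.+1 = level s by apply/eqP; rewrite eqn_leq ilt -Et st.
by case: snt; rewrite -E il ancestor_level.
Qed.

(** What remains of the target, for the coordinates below s, once the labels up to s are known. *)
Definition conditioned (A : set (nat -> R)) s v : set (nat -> R) :=
  [set y | A (glue s v y)].

Lemma conditioned_root A v : conditioned A tree_root v = A.
Proof. by apply/funext => y; rewrite /conditioned/= glue_root. Qed.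

Lemma conditioned_child A t v : t <> tree_root ->
  conditioned A t v = section (conditioned A (parent t) v) (v t).
Proof.
by move=> tr; apply/funext => y; rewrite /conditioned/section/= glue_scons.
Qed.

Lemma conditioned_update A s t v x : (level s <= level t)%N -> s <> t ->
  conditioned A s (update v t x) = conditioned A s v.
Proof. by move=> st snt; apply/funext => y; rewrite /conditioned/= glue_update. Qed.

Lemma measurable_conditioned A s : measurable (A : set (config R nat)) ->
  measurable [set z : config R T * config R nat | conditioned A s z.1 z.2].
Proof.
move=> mA; rewrite -[X in measurable X]setTI.
have H : measurable_fun setT (fun z : config R T * config R nat =>
    glue s z.1 z.2 : config R nat).
  apply: measurable_to_config => i; rewrite /glue.
  have [_|_] := ltnP i (level s).
    exact: (measurableT_comp (@measurable_config_coord R T _) measurable_fst).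
  exact: (measurableT_comp (@measurable_config_coord R nat _) measurable_snd).
exact: H.
Qed.

End Glue.

Section TreeAvoidance.
Context {R : realType} {d : measure_display} {Omega : measurableType d}.
Variables (P : probability Omega R) (T : rooted_tree).
Variables (X : T -> {RV P >-> R}) (mu : probability R R).
Hypothesis iidX : iid X mu.
Variables (A : set (nat -> R)) (mA : measurable (A : set (config R nat))).
Implicit Types (s t : T) (v : config R T) (n m : nat).

Lemma measurable_avoidance_conditioned m s a :
  measurable_fun setT (fun v : config R T => avoidance mu m (conditioned A s v) a).
Proof. exact: (@measurable_avoidance _ mu m _ _ _ a (measurable_conditioned s mA)). Qed.

Lemma measurable_prod_e d' (Z : measurableType d') (I : Type) (L : seq I)
    (F : I -> Z -> \bar R) : (forall i, measurable_fun setT (F i)) ->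
  measurable_fun setT (fun z => \prod_(i <- L) F i z).
Proof.
move=> mF; elim: L => [|i L IH].
  by under eq_fun do rewrite big_nil; exact: measurable_cst.
by under eq_fun do rewrite big_cons; apply: emeasurable_funM.
Qed.

Lemma prod_e_ge0 (I : Type) (L : seq I) (F : I -> \bar R) :
  (forall i, 0 <= F i) -> 0 <= \prod_(i <- L) F i.
Proof. by move=> F0; elim/big_ind: _ => // x y; exact: mule_ge0. Qed.

Lemma lee_prod_e (I : eqType) (L : seq I) (F G : I -> \bar R) :
  (forall i, 0 <= F i) -> (forall i, i \in L -> F i <= G i) ->
  \prod_(i <- L) F i <= \prod_(i <- L) G i.
Proof.
move=> F0; elim: L => [|i L IH] FG; first by rewrite !big_nil.
rewrite !big_cons lee_pmul ?prod_e_ge0// ?FG ?mem_head//.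
by apply: IH => j jL; apply: FG; rewrite inE jL orbT.
Qed.

Variables (m : nat) (a : T -> nat -> R).
Hypothesis a0 : forall t, a t 0%N = 1%R.

(** Labels of one generation are integrated out one vertex at a time. [W] collects the factors
    already integrated and must not read the labels still in [L]. Since [a t 0] is 1, the outer
    power in the recursion of [avoidance] is trivial, and the recursion is precisely the integral
    over the label at t. *)
Lemma resample_generation k (L : seq T) (W : config R T -> \bar R) :
  uniq L -> (forall t, t \in L -> level t = k.+1) ->
  measurable_fun setT W -> (forall v, 0 <= W v) ->
  (forall t v x, t \in L -> W (update v t x) = W v) ->
  \int[P]_w (W (labels X w) *
     \prod_(t <- L) avoidance mu m (conditioned A t (labels X w)) (a t \o S)) =
  \int[P]_w (W (labels X w) *
     \prod_(t <- L) avoidance mu m.+1 (conditioned A (parent t) (labels X w)) (a t)).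
Proof.
elim: L W => [|t L IH] W; first by move=> *; apply: eq_integral => w _; rewrite !big_nil.
move=> /= /andP[tL uL] Lk mW W0 WL.
have tr : t <> tree_root.
  by move=> te; have := Lk t (mem_head _ _); rewrite te level_tree_root.
pose bar (v : config R T) := avoidance mu m.+1 (conditioned A (parent t) v) (a t).
pose Phi (v : config R T) := \prod_(i <- L) avoidance mu m (conditioned A i v) (a i \o S).
have mPhi : measurable_fun setT Phi.
  by apply: measurable_prod_e => i; exact: measurable_avoidance_conditioned.
have Phi0 v : 0 <= Phi v by apply: prod_e_ge0 => i; exact: avoidance_ge0.
have mbar : measurable_fun setT bar by exact: measurable_avoidance_conditioned.
have parent_lt i : i \in t :: L -> (level (parent i)).+1 = k.+1.
  move=> iL; have ir : i <> tree_root.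
    by move=> ie; have := Lk i iL; rewrite ie level_tree_root.
  by rewrite -(level_parent ir) Lk.
pose F (v : config R T) := W v * (avoidance mu m (conditioned A t v) (a t \o S) * Phi v).
have mF : measurable_fun setT F.
  apply: emeasurable_funM => //; apply: emeasurable_funM => //.
  exact: measurable_avoidance_conditioned.
have F0 v : 0 <= F v by rewrite !mule_ge0 ?avoidance_ge0.
transitivity (\int[P]_w F (labels X w)).
  by apply: eq_integral => w _; rewrite big_cons.
rewrite (resample iidX tr mF F0).
transitivity (\int[P]_w ((W (labels X w) * bar (labels X w)) * Phi (labels X w))).
  apply: eq_integral => w _; set v := labels X w.
  under eq_integral => y _.
    have -> : F (update v t y) = W v * Phi v *
        avoidance mu m (section (conditioned A (parent t) v) y) (a t \o S).
      rewrite /F WL ?mem_head// [X in _ * X]muleC muleA; congr (_ * _ * _).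
        rewrite /Phi !big_seq; apply: eq_bigr => i iL; rewrite conditioned_update//.
          by rewrite !Lk ?mem_head// inE iL orbT.
        by move=> it; move: tL; rewrite -it iL.
      rewrite conditioned_child// conditioned_update; last 2 first.
      - by rewrite (level_parent tr).
      - by move=> pt; have := level_parent tr; rewrite pt; lia.
      by rewrite /update eqxx.
    over.
  rewrite ge0_integralZl//; last 3 first.
  - apply: measurable_avoidance_section.
    by have := @measurable_xsection _ _ _ _ _ v (measurable_conditioned (parent t) mA); rewrite /xsection/=; congr (measurable _); apply/seteqP; split => y /=; rewrite ?in_setE.
  - by move=> y _; exact: avoidance_ge0.
  - by rewrite mule_ge0.
  rewrite -muleA [Phi v * _]muleC muleA; congr (_ * _ * _).
  by rewrite /bar /= a0 poweRe1// integral_ge0// => y _; exact: avoidance_ge0.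
rewrite (IH (fun v => W v * bar v)) //; last first.
- move=> i v x iL; rewrite WL ?inE ?iL ?orbT//; congr (_ * _).
  rewrite /bar conditioned_update//.
    by rewrite -ltnS parent_lt ?mem_head// Lk ?inE ?iL ?orbT.
  move=> pi; have := parent_lt t (mem_head _ _); rewrite pi Lk ?inE ?iL ?orbT//; lia.
- by move=> v; rewrite mule_ge0// avoidance_ge0.
- exact: emeasurable_funM.
- by move=> i iL; apply: Lk; rewrite inE iL orbT.
by apply: eq_integral => w _; rewrite big_cons muleA.
Qed.

End TreeAvoidance.

Section TreeTheorem.
Context {R : realType} {d : measure_display} {Omega : measurableType d}.
Variables (P : probability Omega R) (T : rooted_tree) (N : option nat).
Variables (X : T -> {RV P >-> R}) (mu : probability R R).
Hypotheses (heightT : has_height T N) (iidX : iid X mu).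
Variables (A : set (nat -> R)) (mA : measurable (A : set (config R nat))).
Implicit Types (s t : T) (v : config R T) (n m : nat).

Definition path_sequence s (w : Omega) : config R nat := glue s (labels X w) (fun=> 0%R).

Lemma measurable_path_sequence s :
  measurable_fun setT (path_sequence s).
Proof.
apply: measurable_to_config => i; rewrite /path_sequence /glue.
have [_|_] := ltnP i (level s); last exact: measurable_cst.
exact: (measurableT_comp (@measurable_config_coord R T _) (measurable_labels X)).
Qed.

HB.instance Definition _ s :=
  isMeasurableFun.Build _ _ _ _ (path_sequence s) (measurable_path_sequence s).

Lemma measurable_path_sequence_preimage s : measurable (path_sequence s @^-1` A).
Proof. by rewrite -[X in measurable X]setTI; exact: measurable_path_sequence. Qed.

(** With all exponents equal to 1, removing the outermost integral of [avoidance] amounts to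
    resampling the label of the next vertex on the path. Once all labels are revealed, an indicator
    is left. *)
Lemma iterated_measure_path s :
  iterated_measure mu (level s) A = P (path_sequence s @^-1` A).
Proof.
have mAC : measurable (~` A : set (config R nat)) by exact: measurableC.
have step j : (j <= level s)%N ->
   \int[P]_w avoidance mu (level s - j) (conditioned (~` A) (ancestor s j) (labels X w)) (fun=> 1%R) =
   iterated_measure mu (level s) A.
  elim: j => [|j IH] js.
    have -> : ancestor s 0 = tree_root by apply: level_eq0; exact: level_ancestor.
    under eq_integral do rewrite conditioned_root subn0.
    by rewrite integral_cst//= probability_setT mule1.
  rewrite -(IH (ltnW js)); set t := ancestor s j.+1.
  have lt : level t = j.+1 by exact: level_ancestor.
  have tr : t <> tree_root by move=> te; move: lt; rewrite te level_tree_root.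
  have pt : parent t = ancestor s j.
    by rewrite /t /ancestor -iterS -subSn.
  pose F v := avoidance mu (level s - j.+1) (conditioned (~` A) t v) (fun=> 1%R).
  have mF : measurable_fun setT F by exact: (measurable_avoidance_conditioned mu mAC).
  rewrite (resample iidX tr mF (fun=> avoidance_ge0 _ _ _ _)).
  apply: eq_integral => w _; rewrite -(subnSK js) /= poweRe1; last first.
    by apply: integral_ge0 => y _; exact: avoidance_ge0.
  apply: eq_integral => y _; rewrite /F conditioned_child// conditioned_update.
  - by rewrite /update eqxx pt.
  - by rewrite (level_parent tr).
  - by move=> pte; have := level_parent tr; rewrite pte; lia.
rewrite -(step (level s) (leqnn _)) subnn ancestor_level.
rewrite -[X in _ = P X]setIT -integral_indic//; last first.
  exact: measurable_path_sequence_preimage.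
apply: eq_integral => w _ /=.
have -> : conditioned (~` A) s (labels X w) = ~` conditioned A s (labels X w) by [].
by rewrite setCK !indicE.
Qed.

(** Interpolation between the virtual and the actual tree: the first k generations are real, and
    each vertex of generation k carries an independent virtual tree with the level sizes of its true
    subtree. The expected product of the avoidance probabilities does not decrease with k; k = 0 is
    the virtual tree, and at k = n the factors are indicators. *)
Lemma tree_avoidance n : leh n N ->
  avoidance mu n A (ratios (fun i => (level_size T i.+1)%:R)) <=
  P [set w | forall s, level s = n -> ~ A (path_sequence s w)].
Proof.
move=> nN.
pose M t i : R := (descendants i t)%:R.
pose Phi s v := avoidance mu (n - level s) (conditioned A s v) (ratios (M s \o S)).
have mPhi s : measurable_fun setT (Phi s) by exact: measurable_avoidance_conditioned.
have Phi0 s v : 0 <= Phi s v by exact: avoidance_ge0.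
have key k : (k <= n)%N ->
  avoidance mu n A (ratios (fun i => (level_size T i.+1)%:R)) <=
  \int[P]_w \prod_(s <- generation T k) Phi s (labels X w).
  elim: k => [|k IH] kn.
    rewrite generation0; under eq_integral do rewrite big_seq_fset1 /Phi conditioned_root level_tree_root subn0.
    rewrite integral_cst//= probability_setT mule1.
    rewrite (_ : (fun i => (level_size T i.+1)%:R) = M tree_root \o S)//.
    by apply/funext => i; rewrite level_size_root.
  apply: (le_trans (IH (ltnW kn))).
  have genk t : t \in generation T k.+1 -> level t = k.+1.
    by rewrite in_generation => /eqP.
  apply: (@le_trans _ _ (\int[P]_w (cst 1 (labels X w) * \prod_(t <- generation T k.+1)
      avoidance mu (n - k.+1).+1 (conditioned A (parent t) (labels X w)) (ratios (M t))))).
    apply: ge0_le_lower_integral => w; first by apply: prod_e_ge0 => s.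
    rewrite mul1e big_generationS; apply: lee_prod_e => // s.
    rewrite in_generation => /eqP sk.
    (* The level sizes below s are sums over the children t of the sizes [M t], which count t itself
       as the first level. As [M t 0] is 1, each summand is a virtual tree with a single first edge,
       the one leading to t. *)
    apply: (@le_trans _ _ (\prod_(t <- kids s)
        avoidance mu (n - k) (conditioned A s (labels X w)) (ratios (M t)))).
      have -> : Phi s (labels X w) = avoidance mu (n - k) (conditioned A s (labels X w))
          (ratios (fun j => \sum_(t <- kids s) M t j)%R).
        rewrite /Phi sk; congr avoidance; congr ratios; apply/funext => i.
        by rewrite /M /= natr_sum.
      apply: avoidance_ratios_sum.
      - have := @measurable_xsection _ _ _ _ _ (labels X w) (measurable_conditioned s mA).
        rewrite /xsection/=; congr (measurable _).
        by apply/seteqP; split => y /=; rewrite ?in_setE.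
      - have sN : lth (level s) N by rewrite sk; exact: lth_leh nN.
        have /fset0Pn[t ts] := kids_neq0 heightT sN.
        by apply/eqP => k0; have : t \in enum_fset (kids s) by []; rewrite k0.
      - move=> t ts j jn; rewrite ltr0n; apply: (descendants_gt0 heightT).
        apply: leh_leq nN; rewrite (level_kid ts) sk; lia.
    rewrite le_eqVlt; apply/orP; left; apply/eqP.
    rewrite big_seq [RHS]big_seq; apply: eq_bigr => t; rewrite in_kids => /andP[_ /eqP ->].
    by rewrite -subSn.
  have a0 t : ratios (M t) 0%N = 1%R by [].
  rewrite -(resample_generation (a := fun t => ratios (M t)) iidX mA _ a0 (fset_uniq _) genk)//.
  rewrite le_eqVlt; apply/orP; left; apply/eqP; apply: eq_integral => w _.
  rewrite mul1e big_seq [RHS]big_seq; apply: eq_bigr => t /genk tk.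
  by rewrite /Phi tk avoidance_ratiosS ?ltr01// /M/= invr1 poweRe1// avoidance_ge0.
apply: (le_trans (key n (leqnn n))).
have mE s : measurable (path_sequence s @^-1` (~` A)).
  by rewrite preimage_setC; apply: measurableC; exact: measurable_path_sequence_preimage.
rewrite (_ : [set w | _] = \bigcap_(s in [set` generation T n]) (path_sequence s @^-1` (~` A))); last first.
  apply/seteqP; split => w /= H s; first by rewrite /= in_generation => /eqP; exact: H.
  by move=> sn; apply: (H s); rewrite /= in_generation sn.
have mI : measurable (\bigcap_(s in [set` generation T n]) (path_sequence s @^-1` (~` A))).
  by apply: fin_bigcap_measurable => //; exact: finite_fset.
rewrite -[X in _ <= P X]setIT -integral_indic//.
apply: ge0_le_lower_integral => w; first by apply: prod_e_ge0.
rewrite indicE; have [H|nH] := pselect ((\bigcap_(s in [set` generation T n]) (path_sequence s @^-1` (~` A))) w).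
  rewrite mem_set//=.
  apply: (@le_trans _ _ (\prod_(s <- generation T n) 1)); last by rewrite big1.
  apply: lee_prod_e => // s; rewrite in_generation => /eqP sn.
  by rewrite /Phi sn subnn /= lee_fin indicE; case: (_ \in _).
rewrite memNset//=.
have [s [sn As]] : exists s, level s = n /\ A (path_sequence s w).
  apply: contrapT => nE; apply: nH => s; rewrite /= in_generation => /eqP sn As.
  by apply: nE; exists s.
rewrite (big_fsetD1 s)/=; last by rewrite in_generation sn.
by rewrite /Phi sn subnn /= indicE memNset ?mul0e// => /(_ As).
Qed.

End TreeTheorem.

(** * Comparison of survival probabilities *)

Lemma proj_target_shadow (R : realType) (N : option nat)
    (B : set (coordinate N -> R)) k :
  @proj_target R N B k = [set t | shadow (@coordinate_index N) B k (nth 0%R t)].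
Proof. by []. Qed.

Lemma depends_on_shadow (R : realType) (I : Type) (idx : I -> nat) (B : set (I -> R)) n :
  depends_on n (shadow idx B n).
Proof. by move=> v w vw [y By yv]; exists y => // i im; rewrite yv// vw. Qed.

Lemma coordinate_sandwich d (T : measurableType d) (R : realType)
    (P : probability T R) (f : {mfun T >-> config R nat}) (N : option nat)
    (B : set {ptws coordinate N -> R}) n (e : R) :
  closed B -> (0 < e)%R ->
  exists A H : set (config R nat), [/\ measurable A, measurable H,
    A `<=` shadow (@coordinate_index N) B n, shadow (@coordinate_index N) B n `<=` H &
    P (f @^-1` H) <= P (f @^-1` A) + e%:E].
Proof.
case: N B => [m|] B cB e0.
  exact: (@shadow_sandwich _ _ _ P f 'I_m (@nat_of_ord m) B n e (@ord_inj m) cB e0).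
exact: (@shadow_sandwich _ _ _ P f nat (fun i => i) B n e (@inj_id nat) cB e0).
Qed.

Lemma measure_bigsetU_le d (T : measurableType d) (R : realType)
    (P : {measure set T -> \bar R}) (I : Type) (L : seq I) (F : I -> set T) :
  (forall i, measurable (F i)) ->
  P (\big[setU/set0]_(i <- L) F i) <= \sum_(i <- L) P (F i).
Proof.
move=> mF; elim: L => [|i L IH]; first by rewrite !big_nil measure0.
rewrite !big_cons; apply: le_trans (measureU2 _ _ _) _ => //.
  by apply: bigsetU_measurable.
exact: leeD.
Qed.

Lemma lee_addgt0_mul (R : realType) (x y : \bar R) (C : R) :
  (forall e, (0 < e)%R -> x <= y + (C * e)%:E) -> x <= y.
Proof.
move=> H; apply/lee_addgt0Pr => e e0.
have C0 : (0 < `|C| + 1)%R by rewrite ltr_wpDl.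
apply: le_trans (H (e / (`|C| + 1))%R _) _; first by rewrite divr_gt0.
rewrite leeD2l// lee_fin mulrA ler_pdivrMr// mulrC ler_wpM2l ?(ltW e0)//.
by rewrite (le_trans (ler_norm _))// lerDl.
Qed.

Section Assembly.
Context {R : realType} {d : measure_display} {Omega : measurableType d}.
Variables (P : probability Omega R) (T : rooted_tree) (N : option nat).
Variables (X : T -> {RV P >-> R}) (mu : probability R R).
Hypotheses (heightT : has_height T N) (iidX : iid X mu).
Variables (B : set {ptws coordinate N -> R}) (closedB : closed B).
Implicit Types (s t : T) (n k : nat) (w : Omega).
Local Notation sh := (shadow (@coordinate_index N)).
Local Notation pth := (path_sequence X).

Lemma path_sequence_nth s w i : (i < level s)%N ->
  pth s w i = nth 0%R (path_labels X s w) i.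
Proof.
move=> ilt; rewrite (_ : i = Ordinal ilt)// -tnth_nth tnth_mktuple.
rewrite /path_sequence /glue ilt /labels; case: eqP => // E.
by have := level_ancestor ilt; rewrite E level_tree_root.
Qed.

Lemma retainedE s w : s <> tree_root ->
  retained X B w s <-> sh B (level s) (pth s w).
Proof.
move=> sr; rewrite /retained/= proj_target_shadow; split.
  case=> // H; apply: depends_on_shadow H => i ilt.
  by rewrite path_sequence_nth.
move=> H; right; apply: depends_on_shadow H => i ilt.
by rewrite path_sequence_nth.
Qed.

Lemma path_sequence_ancestor s j w i : (i < j <= level s)%N ->
  pth (ancestor s j) w i = pth s w i.
Proof.
move=> /andP[ij js]; rewrite /path_sequence /glue level_ancestor// ij.
rewrite (leq_trans ij js) /ancestor; congr labels.
rewrite -/(ancestor s j) level_ancestor// -iterD; congr iter; lia.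
Qed.

(** The projections of [B] are nested, so the condition at s implies those at its ancestors. The
    root is set apart because it is retained even when [B] is empty. *)
Lemma connected_toE s : level s <> 0%N ->
  connected_to X B s = pth s @^-1` sh B (level s).
Proof.
move=> s0; have sr : s <> tree_root by move=> se; apply: s0; rewrite se level_tree_root.
apply/seteqP; split => w /=.
  by move=> /(_ _ (leqnn _)); rewrite ancestor_level => /retainedE; apply.
move=> H j js; have lj := level_ancestor js.
have [->|/eqP aj] := eqVneq (ancestor s j) tree_root; first by left.
apply/retainedE => //; rewrite lj.
apply: (@depends_on_shadow _ _ _ _ _ (pth s w)).
  by move=> i ij; rewrite path_sequence_ancestor// ij js.
exact: shadow_leq H.
Qed.

Lemma connected_to_level s : level s = 0%N -> connected_to X B s = setT.
Proof.
move=> s0; apply/seteqP; split => // w _ j; rewrite s0 leqn0 => /eqP ->.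
by left; apply: level_eq0; rewrite level_ancestor.
Qed.

(** The event need not be measurable, so the equality in law of the two paths is applied to
    sandwiching sets, whose probabilities along a path are iterated measures and depend on the level
    only. *)
Lemma pr_connected_to_le s t : level s = level t ->
  Pr P (connected_to X B s) <= Pr P (connected_to X B t).
Proof.
move=> st; have [s0|/eqP s0] := eqVneq (level s) 0%N.
  by rewrite !connected_to_level// -?st.
rewrite !connected_toE//; last by rewrite -st.
apply/lee_addgt0Pr => e e0.
have [A [H [mA mH AB BH PH]]] := coordinate_sandwich P (pth s) (level s) closedB e0.
apply: (@le_trans _ _ (P (pth s @^-1` H))).
  rewrite -(measurable_mu_extE P (measurable_path_sequence_preimage X mH s)).
  by apply: le_mu_ext => w; exact: BH.
apply: (le_trans PH); apply: leeD2r.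
rewrite -(iterated_measure_path iidX mA) st (iterated_measure_path iidX mA).
rewrite -(measurable_mu_extE P (measurable_path_sequence_preimage X mA t)).
by apply: le_mu_ext => w /AB; rewrite st.
Qed.

Local Notation p := (hit_prob X B).

Lemma hit_probE s : leh (level s) N -> p (level s) = Pr P (connected_to X B s).
Proof.
move=> sN; rewrite /hit_prob; case: xgetP => [t _ ts|/(_ s)]; last by case.
by apply/eqP; rewrite eq_le !pr_connected_to_le.
Qed.

Lemma hit_prob0 : p 0 = 1.
Proof.
rewrite -(@level_tree_root T) hit_probE ?level_tree_root//; last by case: N.
rewrite connected_to_level ?level_tree_root// /Pr measurable_mu_extE//.
exact: probability_setT.
Qed.

Lemma hit_prob_ge0 k : 0 <= p k.
Proof. exact: mu_ext_ge0. Qed.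

Lemma hit_prob_fin k : p k \is a fin_num.
Proof. exact: outer_measure_fin. Qed.

Lemma hit_probS k : leh k.+1 N -> p k.+1 <= p k.
Proof.
move=> kN; have [s sk] := level_inhabited heightT kN.
have ak : level (ancestor s k) = k by rewrite level_ancestor// sk.
rewrite -{1}sk -ak !hit_probE ?sk ?ak//; last exact: leh_leq kN.
apply: le_mu_ext => w H j; rewrite ak => jk.
have -> : ancestor (ancestor s k) j = ancestor s j.
  by rewrite /ancestor -/(ancestor s k) ak sk -iterD; congr iter; lia.
by apply: H; rewrite sk; exact: leq_trans jk _.
Qed.

Lemma connected_to_boundary_sub n : leh n N -> (0 < n)%N ->
  connected_to_boundary X B `<=`
  \bigcup_(s in @level_set T n) (pth s @^-1` sh B n).
Proof.
move=> nN n0 w [xi H].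
have lev k : leh k N -> level (sval xi k) = k.
  elim: k => [|k IH] kN; first by have [-> _] := svalP xi; exact: level_tree_root.
  have lk := IH (leh_leq (leqnSn k) kN).
  have [_ /(_ k) [[tr pt]|[lf _]]] := svalP xi.
    by have := level_parent tr; rewrite pt lk.
  have := (heightT (sval xi k)).1 lf; rewrite lk => E.
  by move: kN; rewrite E /= ltnn.
exists (sval xi n); first exact: lev.
have := H n; rewrite retainedE ?lev//.
by move=> E; have := lev n nN; rewrite E level_tree_root; lia.
Qed.

(** Pulling a set back along [truncate n] makes it depend on n coordinates only; preimages under the
    path to a vertex of level n do not change, because path sequences are padded with zeros. *)
Definition truncate n (x : config R nat) : config R nat :=
  fun i => if (i < n)%N then x i else 0%R.

Lemma measurable_truncate n : measurable_fun setT (truncate n).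
Proof.
apply: measurable_to_config => i; rewrite /truncate.
have [_|_] := ltnP i n; last exact: measurable_cst.
exact: measurable_config_coord.
Qed.

Lemma truncate_path_sequence s w : truncate (level s) (pth s w) = pth s w.
Proof. by apply/funext => i; rewrite /truncate /path_sequence /glue; case: ltnP. Qed.

Lemma level_sandwich s k (e : R) : level s = k -> (0 < e)%R ->
  exists A H : set (config R nat), [/\ measurable A /\ depends_on k A,
    measurable H /\ depends_on k H, A `<=` sh B k, sh B k `<=` H &
    P (pth s @^-1` H) <= P (pth s @^-1` A) + e%:E].
Proof.
move=> sk e0.
have [A [H [mA mH AB BH PH]]] := coordinate_sandwich P (pth s) k closedB e0.
have tE C : pth s @^-1` (truncate k @^-1` C) = pth s @^-1` C.
  by apply/seteqP; split => w; rewrite /preimage/= -sk truncate_path_sequence.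
have mt C : measurable C -> measurable (truncate k @^-1` C).
  by move=> mC; rewrite -[X in measurable X]setTI; exact: measurable_truncate.
have dt (C : set (config R nat)) : depends_on k (truncate k @^-1` C).
  move=> v w vw; rewrite /preimage/= (_ : truncate k v = truncate k w)//.
  by apply/funext => i; rewrite /truncate; case: ifP => // /vw.
exists (truncate k @^-1` A), (truncate k @^-1` H); split.
- by split; [exact: mt|exact: dt].
- by split; [exact: mt|exact: dt].
- move=> x /AB; apply: depends_on_shadow => i ilt.
  by rewrite /truncate ilt.
- move=> x Bx; apply: BH; apply: depends_on_shadow Bx => i ilt.
  by rewrite /truncate ilt.
- by rewrite !tE.
Qed.

Lemma level_hull k (e : R) : leh k N -> (0 < k)%N -> (0 < e)%R ->
  exists H : set (config R nat), [/\ measurable H, depends_on k H,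
    sh B k `<=` H & iterated_measure mu k H <= p k + e%:E].
Proof.
move=> kN k0 e0; have [s sk] := level_inhabited heightT kN.
have [A [H [[mA _] [mH dH] AB BH PH]]] := level_sandwich sk e0.
exists H; split => //; rewrite -{1}sk (iterated_measure_path iidX mH s).
apply: (le_trans PH); apply: leeD2r.
rewrite -sk hit_probE ?sk// connected_toE; last by rewrite sk => E; rewrite E in k0.
rewrite -(measurable_mu_extE P (measurable_path_sequence_preimage X mA s)) sk.
by apply: le_mu_ext => w; exact: AB.
Qed.

Lemma iterated_measure_subset k (C D : set (nat -> R)) : C `<=` D ->
  iterated_measure mu k C <= iterated_measure mu k D.
Proof.
move=> CD; apply: avoidance_anti => [i _|]; first exact: ler01.
exact: subsetC.
Qed.

(** Intersecting the hulls of the levels from 1 to the minimum of k and n makes the family nested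
    and does not increase measures, and the result at level n still contains the shadow because the
    shadows are nested. At k = 0 the intersection ranges over nothing and is the whole space. *)
Lemma hull_family n (e : R) : leh n N -> (0 < e)%R ->
  exists H : nat -> set (nat -> R), [/\
    (forall k, measurable (H k : set (config R nat))),
    (forall k, H k.+1 `<=` H k), (forall k, depends_on k (H k)), H 0%N = setT &
    sh B n `<=` H n \/ n = 0%N] /\
    (forall k, (k <= n)%N -> iterated_measure mu k (H k) <= p k + e%:E).
Proof.
move=> nN e0.
have /choice[F FP] k : exists F : set (config R nat), (0 < k <= n)%N ->
   [/\ measurable F, depends_on k F, sh B k `<=` F & iterated_measure mu k F <= p k + e%:E].
  have [kn|nk] := boolP (0 < k <= n)%N; last by exists setT.
  have /andP[k0 kn'] := kn.
  by have [F FP] := level_hull (leh_leq kn' nN) k0 e0; exists F.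
exists (fun k => \bigcap_(j in [set j | (0 < j <= minn k n)%N]) F j); split; [split|].
- move=> k; apply: bigcap_measurableType => j /= /andP[j0].
  by rewrite leq_min => /andP[_ jn]; have [] := FP j; rewrite ?j0.
- move=> k x Hx j /= /andP[j0 jk]; apply: Hx => /=; rewrite j0/=.
  by apply: leq_trans jk _; rewrite leq_min geq_minr andbT (leq_trans (geq_minl _ _)).
- move=> k v w vw Hv j /= jk; have := Hv j jk.
  move: jk; rewrite leq_min => /and3P[j0 jk jn].
  have [|_ dF _ _] := FP j; first by rewrite j0.
  by apply: dF => i ij; apply: vw; exact: leq_trans jk.
- by apply/seteqP; split => // x _ j /=; rewrite min0n; case: j.
- left => x Bx j /=; rewrite minnn => jn.
  have [_ _ + _] := FP j jn; apply; apply: shadow_leq Bx.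
  by have /andP[] := jn.
move=> [|k] kn.
  rewrite hit_prob0 (le_trans (iterated_measure_le1 _ _ _))// leeDl// lee_fin ltW//.
have [_ _ _] := FP k.+1 kn; apply: le_trans; apply: iterated_measure_subset.
by apply: bigcap_inf => /=; rewrite leq_min leqnn kn.
Qed.

(** Continued by 1 beyond the height, so that [1 <= a i] is available at every index. *)
Definition growth_seq i : R := if pselect (lth i N) is left _ then growth R T i.+1 else 1%R.

Lemma growth_seqE i : lth i N -> growth_seq i = growth R T i.+1.
Proof. by rewrite /growth_seq; case: pselect. Qed.

Lemma growth_seq_ge1 i : (1 <= growth_seq i)%R.
Proof.
rewrite /growth_seq; case: pselect => // iN; rewrite /growth /=.
have g0 : (0 < level_size T i)%N.
  by apply: (level_size_gt0 heightT); case: (N) iN => //= m /ltnW.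
by rewrite ler_pdivlMr ?ltr0n// mul1r ler_nat (level_size_leS heightT).
Qed.

Lemma growth_ge0 i : (0 <= growth R T i)%R.
Proof. by rewrite /growth divr_ge0. Qed.

Lemma prefix_growth n : leh n N ->
  [tuple growth R T i.+1 | i < n] = prefix growth_seq n.
Proof.
move=> nN; apply: eq_from_tnth => i; rewrite !tnth_mktuple growth_seqE//.
exact: lth_leh nN.
Qed.

Lemma ratios_level_size n i : leh n N -> (i < n)%N ->
  ratios (fun i => (level_size T i.+1)%:R) i = growth_seq i.
Proof.
move=> nN ilt; rewrite growth_seqE /growth /=; last exact: lth_leh nN.
by case: i ilt => [|i] ilt /=; rewrite ?level_size0 ?divr1.
Qed.

(** The tangent coefficients are determined by [q] before the hulls are chosen, so the excess of the
    hulls over the p(B; k) costs at most e times the sum of the coefficients, and e tends to 0. *)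
Lemma survival_le_extinction n (q : nat -> R) : leh n N ->
  (forall i, 0 <= q i <= 1)%R ->
  (forall k, (k <= n)%N -> (\prod_(i < k) q i)%:E = p k) ->
  survival mu (@proj_target R N B n) (growth R T) <= (1 - extinction n q growth_seq)%:E.
Proof.
move=> nN q01 qp; rewrite /survival prefix_growth//.
case: n nN qp => [|n] nN qp; first by rewrite /= subr0 sube0.
have [c [c0 cE cP]] := avoidance_linear_bound mu n.+1 q01 growth_seq_ge1.
rewrite EFinB leeB// .
apply: (@lee_addgt0_mul _ _ _ (\sum_(k < n.+2) c k)%R) => e e0.
have [H [[mH ndH dH H0 [shH|//]] pH]] := hull_family nN e0.
have := cP H mH ndH dH H0.
have : Psi mu [set t : n.+1.-tuple R | H n.+1 (nth 0%R t)] (prefix growth_seq n.+1) <=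
    Psi mu (@proj_target R N B n.+1) (prefix growth_seq n.+1).
  apply: Psi_anti; first by move=> i; exact: le_trans ler01 (growth_seq_ge1 i).
  by move=> t; exact: shH.
rewrite (@Psi_avoidance _ mu _ _ (H n.+1))//; last first.
  move=> v; split; apply: dH => i ilt; first by rewrite nth_prefix.
  by rewrite nth_prefix.
set Y := Psi _ _ _; set a := avoidance _ _ _ _ => aY le1.
have le2 : \sum_(k < n.+2) (c k)%:E * iterated_measure mu k (H k) <=
   (1 - extinction n.+1 q growth_seq + (\sum_(k < n.+2) c k) * e)%:E.
  rewrite -cE mulr_suml -big_split/= -sumEFin; apply: lee_sum => k _.
  rewrite -mulrDr EFinM lee_wpmul2l ?lee_fin//.
  by apply: le_trans (pH k _) _; rewrite ?EFinD ?qp// -ltnS.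
have : 1 <= Y + (1 - extinction n.+1 q growth_seq + (\sum_(k < n.+2) c k) * e)%:E.
  by apply: le_trans le1 _; apply: leeD.
have : Y \is a fin_num.
  rewrite ge0_fin_numE ?Psi_ge0//.
  apply: le_lt_trans (Psi_le1 _ _ _) (ltry 1) => i.
  by apply: le_trans ler01 _; exact: growth_seq_ge1.
by case: Y aY => [y| |] // _ _; rewrite -!EFinD !lee_fin; lra.
Qed.

Lemma growth_seq_ge0 i : (0 <= growth_seq i)%R.
Proof. exact: le_trans ler01 (growth_seq_ge1 i). Qed.

Lemma survival_ge0 (C : set {ptws coordinate N -> R}) n : leh n N ->
  0 <= survival mu (@proj_target R N C n) (growth R T).
Proof.
move=> nN; rewrite /survival prefix_growth// sube_ge0 ?orbT// Psi_le1//.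
exact: growth_seq_ge0.
Qed.

(** Survival is tested on the measurable inner set A; the event that some path of length n falls
    into H but not into A has probability at most |Gamma_n| e. One pair A, H, chosen along the path
    to [s0], serves all vertices of the level, as their paths have the same law. *)
Lemma boundary_le_survival n : leh n N ->
  Pr P (connected_to_boundary X B) <=
  survival mu (@proj_target R N B n) (growth R T).
Proof.
move=> nN; have [n0|n0] := posnP n.
  by rewrite n0 /survival /= sube0 outer_measure_le1.
apply: (@lee_addgt0_mul _ _ _ (#|` generation T n|%:R)%R) => e e0.
have [s0 s0n] := level_inhabited heightT nN.
have [A [H [[mA dA] [mH _] AB BH PH]]] := level_sandwich s0n e0.
pose U := [set w | forall s, level s = n -> ~ A (pth s w)].
pose V := \big[setU/set0]_(s <- generation T n) (pth s @^-1` (H `\` A)).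
have mHA : measurable (H `\` A) by exact: measurableD.
have mV : measurable V.
  by apply: bigsetU_measurable => s _; exact: (measurable_path_sequence_preimage X mHA).
have mU : measurable U.
  rewrite (_ : U = \bigcap_(s in [set` generation T n]) ~` (pth s @^-1` A)).
    apply: fin_bigcap_measurable; first exact: finite_fset.
    by move=> s _; apply: measurableC; exact: (measurable_path_sequence_preimage X mA).
  apply/seteqP; split => w /= HU s; first by rewrite /= in_generation => /eqP; exact: HU.
  by move=> sn; apply: HU; rewrite /= in_generation sn.
have PV : P V <= (#|` generation T n|%:R * e)%:E.
  apply: (@le_trans _ _ (\sum_(s <- generation T n) P (pth s @^-1` (H `\` A)))).
    apply: measure_bigsetU_le => s; exact: (measurable_path_sequence_preimage X mHA).
  apply: (@le_trans _ _ (\sum_(s <- generation T n) e%:E)).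
    rewrite !big_seq; apply: lee_sum => s; rewrite in_generation => /eqP sn.
    rewrite -(iterated_measure_path iidX mHA) sn -s0n (iterated_measure_path iidX mHA).
    have mA' := measurable_path_sequence_preimage X mA s0.
    have mH' := measurable_path_sequence_preimage X mH s0.
    rewrite (_ : _ @^-1` _ = (pth s0 @^-1` H) `\` (pth s0 @^-1` A))//.
    rewrite measureD//; last exact: le_lt_trans (probability_le1 _ mH') (ltry _).
    rewrite (_ : _ `&` _ = pth s0 @^-1` A); last by rewrite setIidr// => w /AB /BH.
    by rewrite leeBlDr ?fin_num_measure// addeC.
  by rewrite sumEFin lee_fin big_const_seq count_predT iter_addr addr0 mulr_natl.
have sub : connected_to_boundary X B `<=` ~` U `|` V.
  move=> w /(connected_to_boundary_sub nN n0)[s sn Bs].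
  have [As|nAs] := pselect (A (pth s w)); first by left => /(_ s sn).
  right; rewrite /V -bigcup_fset; exists s => /=; first by rewrite in_generation sn.
  by split => //; apply: BH.
apply: (@le_trans _ _ (P (~` U `|` V))).
  by rewrite -(measurable_mu_extE P (measurableU _ _ (measurableC mU) mV)); exact: le_mu_ext.
apply: le_trans (measureU2 _ (measurableC mU) mV) _.
apply: leeD => //; have := probability_setC P mU; rewrite /= => ->.
rewrite /survival prefix_growth//; apply: leeB => //.
apply: le_trans (tree_avoidance heightT iidX mA nN).
rewrite (eq_avoidance _ _ (fun i => ratios_level_size nN)).
case: n nN n0 s0n AB dA {BH PH U V mV mU PV sub} => // n nN n0 s0n AB dA.
rewrite -(@Psi_avoidance _ mu n [set t | A (nth 0%R t)] A)//.
  apply: Psi_anti; first exact: growth_seq_ge0.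
  by move=> t /AB.
by move=> v; split; apply: dA => i ilt; rewrite nth_prefix.
Qed.

Lemma prod_growth_seq n : leh n N -> (\prod_(i < n) growth_seq i)%R = (level_size T n)%:R.
Proof.
elim: n => [|n IH] nN; first by rewrite big_ord0 level_size0.
have nN' := leh_leq (leqnSn n) nN.
rewrite big_ord_recr/= IH// growth_seqE; last exact: lth_leh nN.
rewrite /growth/= mulrC divfK// pnatr_eq0 -lt0n.
exact: (level_size_gt0 heightT).
Qed.

Lemma level_size_incr_inv k : lth k N ->
  (0 <= (level_size T k)%:R^-1 - (level_size T k.+1)%:R^-1 :> R)%R.
Proof.
move=> kN; rewrite subr_ge0 lef_pV2 ?posrE ?ltr0n ?ler_nat ?(level_size_leS heightT)//.
  by apply: (level_size_gt0 heightT); case: (N) kN.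
by apply: (level_size_gt0 heightT); case: (N) kN => //= m /ltnW.
Qed.

Section Upper.
Variables (q : nat -> R) (q01 : forall i, (0 <= q i <= 1)%R).
Hypothesis qp : forall k, leh k N -> (\prod_(i < k) q i)%:E = p k.
Let pr k : R := (\prod_(i < k) q i)%R.

Lemma extinction_prod0 n : pr n = 0%R -> extinction n q growth_seq = 1%R.
Proof.
by move=> /eqP /prodf_eq0[i _ /eqP qi]; exact: extinction1 (ltn_ord i) qi.
Qed.

Lemma pr_gt0 n k : (k <= n)%N -> pr n != 0%R -> (0 < pr k)%R.
Proof.
move=> kn pn; rewrite /pr prodr_gt0// => i _; have /andP[qi0 _] := q01 i.
rewrite lt_neqAle qi0 andbT eq_sym; apply/negP => /eqP qi; move/negP: pn; apply.
by apply/eqP/eqP/prodf_eq0; exists (widen_ord kn i) => //=; rewrite qi.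
Qed.

Lemma extinction_resistance n : leh n N -> pr n != 0%R ->
  ((1 - extinction n q growth_seq) *
   ((pr n)^-1 * (level_size T n)%:R^-1 +
    \sum_(k < n) (pr k)^-1 * ((level_size T k)%:R^-1 - (level_size T k.+1)%:R^-1))
   <= 2)%R.
Proof.
move=> nN pn.
(* The entries from index n on are replaced by 1, so that all of them are positive. *)
pose q' i : R := if (i < n)%N then q i else 1%R.
have q'01 i : (0 < q' i <= 1)%R.
  rewrite /q'; case: ltnP => [ilt|_]; last by rewrite ltr01 lexx.
  have /andP[qi0 ->] := q01 i; rewrite andbT lt_neqAle qi0 andbT eq_sym.
  apply/negP => /eqP qi; move/negP: pn; apply.
  by apply/eqP/eqP/prodf_eq0; exists (Ordinal ilt) => //=; rewrite qi.
have eE : extinction n q growth_seq = extinction n q' growth_seq.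
  apply: eq_extinction => i ilt //; by rewrite /q' ilt.
have := survival_resistance_le2 n q'01 growth_seq_ge1; rewrite -eE.
rewrite (@resistanceE _ n q' growth_seq (fun k => \prod_(i < k) q' i)%R
   (fun k => \prod_(i < k) growth_seq i)%R)//.
have prE k : (k <= n)%N -> (\prod_(i < k) q' i)%R = pr k.
  by move=> kn; apply: eq_bigr => i _; rewrite /q' (leq_trans (ltn_ord i)).
rewrite prE// prod_growth_seq//; congr (_ * (_ + _) <= _)%R.
apply: eq_bigr => k _; rewrite (prE k (ltnW (ltn_ord k))).
by rewrite (prod_growth_seq (leh_leq (ltnW (ltn_ord k)) nN)) (prod_growth_seq (leh_leq (ltn_ord k) nN)).
Qed.

Lemma inverse_sum_term k : lth k N -> pr k != 0%R ->
  (p k)^-1 * ((level_size T k)%:R^-1 - (level_size T k.+1)%:R^-1)%:E =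
  ((pr k)^-1 * ((level_size T k)%:R^-1 - (level_size T k.+1)%:R^-1))%:E.
Proof.
move=> kN pk; rewrite -qp; last by case: (N) kN => //= m /ltnW.
by rewrite inver (negbTE pk) EFinM.
Qed.

(** Testing with reals [U] covers an infinite bracket. If p(B; n) = 0 the bracket is infinite, but
    the survival probability vanishes and any [U] will do. *)
Lemma level_survival_upper n (U : R) : leh n N -> (0 <= U)%R ->
  U%:E <= (p n)^-1 * ((level_size T n)%:R^-1)%:E + \sum_(0 <= k < n)
     (p k)^-1 * ((level_size T k)%:R^-1 - (level_size T k.+1)%:R^-1)%:E ->
  ((1 - extinction n q growth_seq) * U <= 2)%R.
Proof.
move=> nN U0; have [pn|pn] := eqVneq (pr n) 0%R.
  by rewrite (extinction_prod0 pn) subrr mul0r.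
have -> : (p n)^-1 * ((level_size T n)%:R^-1)%:E = ((pr n)^-1 * (level_size T n)%:R^-1)%:E.
  by rewrite -qp// inver (negbTE pn) EFinM.
rewrite big_mkord (eq_bigr (fun k : 'I_n => ((pr k)^-1 *
    ((level_size T k)%:R^-1 - (level_size T k.+1)%:R^-1))%:E)); last first.
  move=> k _; apply: inverse_sum_term; first exact: lth_leh nN.
  by rewrite gt_eqF// (pr_gt0 (ltnW (ltn_ord k)) pn).
rewrite sumEFin -EFinD lee_fin => Ur.
apply: le_trans (extinction_resistance nN pn); apply: ler_wpM2l => //.
by rewrite subr_ge0; have /andP[] := extinction_itv n q01 growth_seq_ge0.
Qed.

End Upper.

End Assembly.

(** * Passage to infinite height *)

Section Limits.
Context {R : realType}.

Lemma le_real_bound (l : R) (x : \bar R) : (0 < l)%R -> 0 <= x ->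
  (forall U : R, (0 <= U)%R -> U%:E <= x -> (l * U <= 2)%R) -> x <= (2 / l)%:E.
Proof.
move=> l0; case: x => [r| |] // r0 H.
  by rewrite lee_fin ler_pdivlMr// mulrC H.
(* An infinite x would admit U = 3 / l and give 3 <= 2. *)
have := H (3 / l)%R; rewrite leey mulrCA divff ?gt_eqF// divr_ge0 ?(ltW l0)// => /(_ isT isT).
by rewrite mulr1 ler_nat.
Qed.

Lemma le_twice_inv (s : R) (S : \bar R) : 0 <= S ->
  (forall U : R, (0 <= U)%R -> U%:E <= S -> (s * U <= 2)%R) ->
  s%:E <= 2%:E * S^-1.
Proof.
move=> S0 H; have [s0|s0] := leP s 0%R.
  by apply: (@le_trans _ _ 0); rewrite ?lee_fin// mule_ge0// inve_ge0.
have {H} := le_real_bound s0 S0 H.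
case: S S0 => [r| |] // S0 H.
rewrite inver; have [_|r0] := eqVneq r 0%R; first by rewrite gt0_muley// leey.
have rp : (0 < r)%R by rewrite lt_neqAle eq_sym r0 -lee_fin.
by rewrite -EFinM lee_fin ler_pdivlMr// mulrC -ler_pdivlMr.
Qed.

Variables (mu : probability R R) (f : nat -> R) (f0 : forall i, (0 <= f i)%R).

Lemma survival_nonincreasing (C : set {ptws coordinate None -> R}) : closed C ->
  nonincreasing_seq (fun n => survival mu (@proj_target R None C n) f).
Proof.
move=> cC; apply/nonincreasing_seqP => -[|n]; rewrite /survival.
  by apply: leeB => //; exact: (Psi_ge0 mu _ (f \o S)).
apply: leeB => //.
exact: (@Psi_shadowS _ mu n C (f \o S) cC (fun i => f0 i.+1)).
Qed.

Lemma survival_cvg (C : set {ptws coordinate None -> R}) : closed C ->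
  cvgn (fun n => survival mu (@proj_target R None C n) f).
Proof. by move=> cC; apply: ereal_nonincreasing_is_cvgn; exact: survival_nonincreasing. Qed.

Lemma virtual_survival_le (C : set {ptws coordinate None -> R}) n : closed C ->
  virtual_survival (N := None) mu C f <= survival mu (@proj_target R None C n) f.
Proof.
move=> cC; apply: lime_le; first exact: survival_cvg.
by exists n => // m /= nm; exact: survival_nonincreasing.
Qed.

Lemma virtual_survival_ge (C : set {ptws coordinate None -> R}) (x : \bar R) : closed C ->
  (forall n, x <= survival mu (@proj_target R None C n) f) ->
  x <= virtual_survival (N := None) mu C f.
Proof.
by move=> cC H; apply: lime_ge; [exact: survival_cvg|exact: nearW].
Qed.

(** Only the last level or a limit matters, so a comparison from some level on suffices. At lower
    levels it can fail for a product target with an empty factor. *)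
Lemma virtual_survival_mono N (C D : set {ptws coordinate N -> R}) n0 :
  closed C -> closed D -> leh n0 N ->
  (forall n, leh n N -> (n0 <= n)%N ->
    survival mu (@proj_target R N C n) f <= survival mu (@proj_target R N D n) f) ->
  virtual_survival mu C f <= virtual_survival mu D f.
Proof.
case: N C D => [n|] C D cC cD n0N H; first exact: (H n (leqnn n) n0N).
apply: lee_lim; [exact: survival_cvg|exact: survival_cvg|].
by exists n0 => // n /= nn; exact: H.
Qed.

End Limits.

Lemma coordinate_indexP N i : lth i N -> exists c : coordinate N, coordinate_index c = i.
Proof. by case: N => [n iN|_]; [exists (Ordinal iN)|exists i]. Qed.

Lemma lth_coordinate_index N (c : coordinate N) : lth (coordinate_index c) N.
Proof. by case: N c => //= n c; exact: ltn_ord. Qed.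

(** * Product targets made of half-lines *)

Section HalfLines.
Context {R : realType}.

Definition half_line (b : \bar R) : set R := [set x | x%:E <= b].

Lemma measurable_half_line b : measurable (half_line b).
Proof.
rewrite /half_line; case: b => [r| |].
- by rewrite (_ : [set x | _] = `]-oo, r]%classic).
- rewrite (_ : [set x | _] = setT)//.
  by apply/seteqP; split => // x _ /=; rewrite leey.
- rewrite (_ : [set x | _] = set0)//.
  by apply/seteqP; split => // x /=; rewrite leNgt ltNyr.
Qed.

Lemma closed_half_line b : closed (half_line b).
Proof.
rewrite /half_line; case: b => [r| |].
- rewrite (_ : [set x | _] = [set x | x <= r]%R); first exact: closed_le.
  by apply/funext => x /=; rewrite lee_fin.
- rewrite (_ : [set x | _] = setT); first exact: closedT.
  by apply/seteqP; split => // x _ /=; rewrite leey.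
- rewrite (_ : [set x | _] = set0); first exact: closed0.
  by apply/seteqP; split => // x /=; rewrite leNgt ltNyr.
Qed.

Lemma closed_product_target N (b : nat -> \bar R) :
  closed (@product_target R N b : set {ptws coordinate N -> R}).
Proof.
have gen (I : eqType) (c : I -> \bar R) :
    closed ([set y | forall i, half_line (c i) (y i)] : set {ptws I -> R}).
  rewrite (_ : [set y | _] = \bigcap_(i : I) [set y : {ptws I -> R} | half_line (c i) (y i)]); last first.
    by apply/seteqP; split => y /= H i; [move=> _|]; exact: H.
  apply: closed_bigI => i _.
  apply: (@preimage_closed {ptws I -> R} R (fun y => y i)); last exact: closed_half_line.
  by move=> y _; exact: (@proj_continuous I (fun=> R) i y).
by case: N => [n|]; exact: gen.
Qed.

End HalfLines.

Section Parts.
Context {R : realType} {d : measure_display} {Omega : measurableType d}.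
Variables (P : probability Omega R) (T : rooted_tree).
Variables (X : T -> {RV P >-> R}) (mu : probability R R).
Hypothesis iidX : iid X mu.

Lemma boundary_le_virtual_survival N (B : set {ptws coordinate N -> R}) :
  has_height T N -> closed B ->
  Pr P (connected_to_boundary X B) <= virtual_survival mu B (growth R T).
Proof.
case: N B => [n|] B heightT cB.
  exact: (boundary_le_survival heightT iidX cB (leqnn n)).
apply: virtual_survival_ge => //; first by move=> i; exact: growth_ge0.
by move=> n; exact: (boundary_le_survival heightT iidX cB).
Qed.

(** [B] provides the hitting probabilities, and [C] is the target: either [B] itself or the product
    target. For infinite height, the limit is below [1 - extinction n] for every n, so its product
    with any nonnegative real below a partial sum is at most 2. *)
Lemma virtual_survival_le_upper N (B C : set {ptws coordinate N -> R}) (q : nat -> R) :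
  has_height T N -> closed B -> closed C ->
  (forall i, 0 <= q i <= 1)%R ->
  (forall k, leh k N -> (\prod_(i < k) q i)%:E = hit_prob X B k) ->
  (forall n, leh n N -> survival mu (@proj_target R N C n) (growth R T) <=
     (1 - extinction n q (growth_seq T N))%:E) ->
  virtual_survival mu C (growth R T) <=
    2%:E * (inverse_sum N (hit_prob X B) (level_size T))^-1.
Proof.
move=> heightT cB cC q01 qp H.
have term0 k : lth k N -> 0 <= (hit_prob X B k)^-1 *
    ((level_size T k)%:R^-1 - (level_size T k.+1)%:R^-1)%:E.
  by move=> kN; rewrite mule_ge0 ?inve_ge0 ?hit_prob_ge0// lee_fin (level_size_incr_inv heightT).
case: N B C heightT cB cC qp H term0 => [n|] B C heightT cB cC qp H term0.
  apply: le_trans (H n (leqnn n)) _; apply: le_twice_inv.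
    rewrite /inverse_sum adde_ge0 ?mule_ge0 ?inve_ge0 ?hit_prob_ge0//.
    by rewrite big_mkord sume_ge0// => k _; exact: (term0 k (ltn_ord k)).
  move=> U U0; exact: (level_survival_upper heightT q01 qp (leqnn n)).
set L := virtual_survival _ _ _.
have L0 : 0 <= L.
  apply: virtual_survival_ge => //; first by move=> i; exact: growth_ge0.
  by move=> n; exact: survival_ge0.
have Ln n : L <= (1 - extinction n q (growth_seq T None))%:E.
  apply: le_trans (H n Logic.I); apply: virtual_survival_le => // i; exact: growth_ge0.
have : L \is a fin_num by rewrite ge0_fin_numE// (le_lt_trans (Ln 0%N)) ?ltry.
case: L L0 Ln => [l| |] // L0 Ln _.
apply: le_twice_inv => [|U U0 US]; first by apply: nneseries_ge0 => k _ _; exact: term0.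
have [l0|l0] := leP l 0%R; first by rewrite (@le_trans _ _ 0%R)// mulr_le0_ge0.
suff : U%:E <= (2 / l)%:E by rewrite lee_fin ler_pdivlMr// mulrC.
apply: (le_trans US); apply: lime_le.
  by apply: is_cvg_nneseries => k _ _; exact: term0.
apply: nearW => n; apply: le_real_bound => //.
  by rewrite big_mkord sume_ge0// => k _; exact: term0.
move=> V V0 VS; apply: (@le_trans _ _ ((1 - extinction n q (growth_seq T None)) * V)%R).
  by apply: ler_wpM2r => //; rewrite -lee_fin.
apply: (level_survival_upper heightT q01 qp (n := n) Logic.I V0).
(* The partial sum is below the level-n bracket, which has one more nonnegative term. *)
apply: (le_trans VS); rewrite leeDr// mule_ge0 ?inve_ge0 ?hit_prob_ge0//.
Qed.

(** Successive ratios of a nonincreasing sequence that starts at 1. Once p(B; k) is 0 it stays 0, so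
    the products remain correct when a ratio has denominator 0. *)
Lemma hit_prob_ratios N (B : set {ptws coordinate N -> R}) :
  has_height T N -> closed B ->
  exists q : nat -> R, (forall i, 0 <= q i <= 1)%R /\
    (forall k, leh k N -> (\prod_(i < k) q i)%:E = hit_prob X B k).
Proof.
move=> heightT cB; pose r k := fine (hit_prob X B k).
have rE k : (r k)%:E = hit_prob X B k by rewrite fineK ?hit_prob_fin.
have r0 k : (0 <= r k)%R by rewrite -lee_fin rE hit_prob_ge0.
have rS k : leh k.+1 N -> (r k.+1 <= r k)%R.
  by move=> kN; rewrite -lee_fin !rE; exact: (hit_probS heightT iidX).
exists (fun i => if pselect (leh i.+1 N) is left _ then r i.+1 / r i else 1)%R; split.
  move=> i; case: pselect => [iN|_]; last by rewrite ler01 lexx.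
  rewrite divr_ge0//=; have [->|ri] := eqVneq (r i) 0%R; first by rewrite invr0 mulr0 ler01.
  by rewrite ler_pdivrMr ?mul1r ?rS// lt_neqAle eq_sym ri r0.
elim=> [|k IH] kN; first by rewrite big_ord0 (hit_prob0 iidX cB).
rewrite big_ord_recr/= EFinM IH; last exact: leh_leq kN.
case: pselect => // _; rewrite -!rE -EFinM; congr EFin.
have [rk|rk] := eqVneq (r k) 0%R; last by rewrite mulrC divfK.
rewrite rk mul0r; apply/eqP; rewrite eq_le r0/=.
by rewrite -rk rS.
Qed.

Lemma virtual_survival_upper N (B : set {ptws coordinate N -> R}) :
  has_height T N -> closed B ->
  virtual_survival mu B (growth R T) <=
    2%:E * (inverse_sum N (hit_prob X B) (level_size T))^-1.
Proof.
move=> heightT cB; have [q [q01 qp]] := hit_prob_ratios heightT cB.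
apply: (virtual_survival_le_upper heightT cB cB q01 qp) => n nN.
apply: (survival_le_extinction heightT iidX cB nN q01) => k kn.
by apply: qp; exact: leh_leq nN.
Qed.

Section ProductTarget.
Variables (N : option nat) (B : set {ptws coordinate N -> R}) (b : nat -> \bar R).
Hypotheses (heightT : has_height T N) (closedB : closed B).
Hypothesis pb : forall n, leh n N ->
  \prod_(i < n) mu [set x : R | x%:E <= b i] = hit_prob X B n.
Let q i : R := fine (mu (half_line (b i))).
Let SB : set {ptws coordinate N -> R} := @product_target R N b.
Let g := growth_seq (R := R) T N.

Lemma product_probability_itv i : (0 <= q i <= 1)%R.
Proof.
have mb := measurable_half_line (b i).
by rewrite /q fine_ge0//= -lee_fin fineK ?probability_le1// fin_num_measure.
Qed.

Lemma product_probability k : leh k N -> (\prod_(i < k) q i)%:E = hit_prob X B k.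
Proof.
move=> kN; rewrite -pb// -prodEFin; apply: eq_bigr => i _.
by rewrite /q fineK//; apply: fin_num_measure; exact: measurable_half_line.
Qed.

Lemma Psi_half_lines n :
  Psi mu [set t : n.+1.-tuple R | forall i, (i < n.+1)%N -> half_line (b i) (nth 0%R t i)]
    (prefix g n.+1) = (extinction n.+1 q g)%:E.
Proof.
have g0 i : (0 <= g i)%R by exact: (growth_seq_ge0 heightT).
have mE i : measurable (half_line (b i)) by exact: measurable_half_line.
rewrite -avoidance_product//; apply: Psi_avoidance.
  move=> v; split => /= H i ilt; first by rewrite nth_prefix//; exact: H.
  by have := H i ilt; rewrite nth_prefix.
rewrite (_ : [set v | _] = \bigcap_(i in [set i | (i < n.+1)%N]) [set v : config R nat | half_line (b i) (v i)]).
  apply: bigcap_measurableType => i _; rewrite -[X in measurable X]setTI.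
  exact: measurable_config_coord.
by apply/seteqP; split => v /= H i; exact: H.
Qed.

Lemma survival_product_le n : leh n N ->
  survival mu (@proj_target R N SB n) (growth R T) <= (1 - extinction n q g)%:E.
Proof.
move=> nN; rewrite /survival (prefix_growth _ nN).
case: n nN => [|n] nN; first by rewrite /= subr0 sube0.
rewrite EFinB leeB//= -Psi_half_lines; apply: Psi_anti.
  by move=> i; exact: (growth_seq_ge0 heightT).
move=> t /= [y Sy yt] i ilt.
have [c ci] := coordinate_indexP (lth_leh ilt nN).
by have := Sy c; rewrite yt ci.
Qed.

(** A prefix inside the half-lines extends to a point of the whole product because each later
    half-line is nonempty. *)
Lemma survival_product_ge n : leh n N -> (forall i, lth i N -> b i != -oo) ->
  (1 - extinction n q g)%:E <= survival mu (@proj_target R N SB n) (growth R T).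
Proof.
move=> nN b0; rewrite /survival (prefix_growth _ nN).
case: n nN => [|n] nN; first by rewrite /= subr0 sube0.
rewrite EFinB leeB//= -Psi_half_lines; apply: Psi_anti.
  by move=> i; exact: (growth_seq_ge0 heightT).
move=> t Ht.
have /choice[z zb] : forall i, exists z : R, lth i N -> half_line (b i) z.
  move=> i; have := b0 i; rewrite /half_line/=; case: (b i) => [r| |] bi.
  - by exists r.
  - by exists 0%R; rewrite leey.
  - by exists 0%R => /bi; rewrite eqxx.
exists (fun c => if (coordinate_index c < n.+1)%N then nth 0%R t (coordinate_index c)
    else z (coordinate_index c)); last by move=> c ->.
move=> c; case: ifP => [clt|_]; first exact: Ht.
by apply: zb; exact: lth_coordinate_index.
Qed.

Lemma virtual_survival_product :
  virtual_survival mu B (growth R T) <= virtual_survival mu SB (growth R T) /\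
  virtual_survival mu SB (growth R T) <=
    2%:E * (inverse_sum N (hit_prob X B) (level_size T))^-1.
Proof.
have q01 := product_probability_itv; have qp := product_probability.
have cS : closed SB by exact: closed_product_target.
have le n : leh n N -> survival mu (@proj_target R N B n) (growth R T) <=
    (1 - extinction n q g)%:E.
  move=> nN; apply: (survival_le_extinction heightT iidX closedB nN q01) => k kn.
  by apply: qp; exact: leh_leq nN.
split; last by apply: (virtual_survival_le_upper heightT closedB cS q01 qp); exact: survival_product_le.
(* If some [b i] is -oo, the product target is empty; but then [q i] is 0, and the survival
   probability for [B] also vanishes from level i + 1 on. *)
have [n0 [n0N n0P]] : exists n0, leh n0 N /\ forall n, leh n N -> (n0 <= n)%N ->
    survival mu (@proj_target R N B n) (growth R T) <=
    survival mu (@proj_target R N SB n) (growth R T).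
  have [b0|] := pselect (forall i, lth i N -> b i != -oo).
    exists 0%N; split; first by case: (N).
    by move=> n nN _; apply: le_trans (le n nN) _; exact: survival_product_ge.
  move=> /existsNP[i /not_implyP[iN /negP/negPn/eqP bi]].
  exists i.+1; split; first by case: (N) iN.
  move=> n nN ilt; apply: (@le_trans _ _ 0); last exact: (survival_ge0 mu heightT).
  apply: le_trans (le n nN) _; rewrite (extinction1 _ ilt) ?subrr// /q.
  rewrite (_ : half_line (b i) = set0) ?measure0//.
  by apply/seteqP; split => // x; rewrite /half_line/= bi leNgt ltNyr.
by apply: (virtual_survival_mono _ closedB cS n0N n0P) => i; exact: growth_ge0.
Qed.

End ProductTarget.

End Parts.

(** * Energy and capacity *)

(* Summation by parts, arranged so that the weights may be infinite. *)
Lemma abel_le (R : realType) (w : nat -> \bar R) (M m : nat -> R) K :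
  (forall k, (k <= K)%N -> 0 <= w k) ->
  (forall k, (k < K)%N -> w k <= w k.+1) ->
  (forall k, (k <= K)%N -> (m k <= M k)%R) ->
  (forall k, (k < K)%N -> (M k.+1 <= M k)%R) ->
  (forall k, (k < K)%N -> (m k.+1 <= m k)%R) ->
  (0 <= m K)%R ->
  \sum_(k < K) w k * (m k - m k.+1)%:E + w K * (m K)%:E + w 0%N * (M 0%N - m 0%N)%:E <=
  \sum_(k < K) w k * (M k - M k.+1)%:E + w K * (M K)%:E.
Proof.
elim: K w M m => [|K IH] w M m w0 ww mM MM mm mK.
  rewrite !big_ord0 !add0e -ge0_muleDr ?lee_fin//; last first.
    by rewrite subr_ge0 mM.
  by rewrite -EFinD subrKC.
rewrite !big_ord_recl.
have := IH (w \o S) (M \o S) (m \o S) (fun k kK => w0 k.+1 kK) (fun k kK => ww k.+1 kK)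
  (fun k kK => mM k.+1 kK) (fun k kK => MM k.+1 kK) (fun k kK => mm k.+1 kK) mK.
rewrite /=; set a := \sum_(k < K) _; set b := \sum_(k < K) _ => le1.
rewrite -!addeA [leLHS]addeA; apply: le_trans (leeD2l _ le1).
rewrite -addeA [a + _]addeA [X in _ + X <= _]addeC [X in _ <= _ + X]addeC !addeA.
do 2 apply: leeD2r; apply: le_trans (leeD2l _ (lee_wpmul2r _ (ww 0%N isT))).
  rewrite -!ge0_muleDr ?lee_fin ?subr_ge0 ?mM ?mm ?MM//.
  rewrite -!EFinD; apply: lee_wpmul2l; first exact: w0.
  by rewrite lee_fin; lra.
by rewrite lee_fin subr_ge0 mM.
Qed.

Section Rays.
Variables (T : rooted_tree) (N : option nat).
Hypothesis heightT : has_height T N.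
Implicit Types (xi eta : ray T) (s t : T).

Lemma ray_ext xi eta : (forall n, sval xi n = sval eta n) -> xi = eta.
Proof.
case: xi eta => [x hx] [y hy] /= xy; have {}xy : x = y by exact/funext.
by subst y; congr exist; exact: Prop_irrelevance.
Qed.

Lemma ray_level xi k : leh k N -> level (sval xi k) = k.
Proof.
elim: k => [|k IH] kN; first by have [-> _] := svalP xi; exact: level_tree_root.
have lk := IH (leh_leq (leqnSn k) kN).
have [_ /(_ k) [[tr pt]|[lf _]]] := svalP xi.
  by have := level_parent tr; rewrite pt lk.
have := (heightT (sval xi k)).1 lf; rewrite lk => E.
by move: kN; rewrite E /= ltnn.
Qed.

Lemma ray_parent xi k : leh k.+1 N -> parent (sval xi k.+1) = sval xi k.
Proof.
move=> kN; have [_ /(_ k) [[tr pt]|[lf _]]] := svalP xi => //.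
have := (heightT (sval xi k)).1 lf; rewrite (ray_level _ (leh_leq (leqnSn k) kN)) => E.
by move: kN; rewrite E /= ltnn.
Qed.

Lemma ray_stay xi n k : N = Some n -> (n <= k)%N -> sval xi k = sval xi n.
Proof.
move=> Nn; elim: k => [|k IH]; first by rewrite leqn0 => /eqP ->.
rewrite leq_eqVlt => /predU1P[->//|nk]; rewrite -(IH nk).
have [_ /(_ k) [[tr pt]|[_ ->//]]] := svalP xi.
have lvl : level (sval xi n) = n by apply: ray_level; rewrite Nn /=.
have := level_parent tr; rewrite pt (IH nk) lvl => l1.
by have := leh_level heightT (sval xi k.+1); rewrite Nn /= l1 ltnn.
Qed.

Lemma ray_agree_leq xi eta j k : leh k N -> (j <= k)%N ->
  sval xi k = sval eta k -> sval xi j = sval eta j.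
Proof.
elim: k => [|k IH] kN; first by rewrite leqn0 => /eqP ->.
rewrite leq_eqVlt => /predU1P[->//|jk] E.
apply: (IH (leh_leq (leqnSn k) kN) jk).
by rewrite -(ray_parent xi kN) -(ray_parent eta kN) E.
Qed.

Lemma meet_level_lt xi eta k : leh k N -> sval xi k <> sval eta k ->
  exists m, [/\ (m < k)%N, meet_level N xi eta = Some m, sval xi m = sval eta m &
    sval xi m.+1 <> sval eta m.+1].
Proof.
move=> kN ne; rewrite /meet_level; case: pselect => [e|]; last first.
  by case; exists k; apply/eqP.
case: ex_minnP => m /eqP mne mmin.
case: m mne mmin => [|m] mne mmin.
  by case: mne; have [-> _] := svalP xi; have [-> _] := svalP eta.
exists m; split => //; first by apply: mmin; apply/eqP.
by apply/eqP/negPn/negP => /mmin; rewrite ltnn.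
Qed.

Lemma meet_level_ge xi eta k : leh k N -> sval xi k = sval eta k ->
  if meet_level N xi eta is Some m then (k <= m)%N /\ leh m N else N = None.
Proof.
move=> kN eqk; rewrite /meet_level; case: pselect => [e|e]; last first.
  by move: kN; case: (N) => // m km; split => /=.
case: ex_minnP => m /eqP mne mmin.
case: m mne mmin => [|m] mne mmin.
  by case: mne; have [-> _] := svalP xi; have [-> _] := svalP eta.
have eqm : sval xi m = sval eta m.
  by apply/eqP/negPn/negP => /mmin; rewrite ltnn.
have mN : leh m.+1 N.
  case EN : N => [n|//] /=; rewrite ltnNge; apply/negP => nm; apply: mne.
  by rewrite !(ray_stay _ EN (leqW nm)) -!(ray_stay _ EN nm).
split; last exact: leh_leq (leqnSn m) mN.
by rewrite leqNgt; apply/negP => mk; apply: mne; exact: (ray_agree_leq kN mk).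
Qed.

End Rays.

Section Energy.
Variables (R : realType) (T : rooted_tree) (N : option nat).
Hypothesis heightT : has_height T N.
Variable p : nat -> \bar R.
Hypothesis p_ge0 : forall k, 0 <= p k.
Hypothesis p_anti : forall k, leh k.+1 N -> p k.+1 <= p k.
Implicit Types (xi eta : boundary T).
Local Notation w k := ((p k)^-1).

Definition cylinder k (s : T) : set (boundary T) := [set xi | sval xi k = s].

Lemma measurable_cylinder k s : measurable (cylinder k s).
Proof. by apply: sub_sigma_algebra; exists k, s. Qed.

(** For k below the height, the rays eta with |xi /\ eta| = k. *)
Definition split_set k xi := cylinder k (sval xi k) `\` cylinder k.+1 (sval xi k.+1).

Lemma measurable_split_set k xi : measurable (split_set k xi).
Proof. by apply: measurableD; exact: measurable_cylinder. Qed.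

(* The reciprocal gauge, with the contribution of the levels from K on lowered
   to the value at level K. *)
Definition meet_kernel K xi eta : \bar R :=
  \sum_(k < K) w k * (\1_(split_set k xi) eta)%:E
  + w K * (\1_(cylinder K (sval xi K)) eta)%:E.

Lemma weight_ge0 k : 0 <= w k.
Proof. by rewrite inve_ge0. Qed.

Lemma gauge_leq j k : leh k N -> (j <= k)%N -> p k <= p j.
Proof.
elim: k => [|k IH] kN; first by rewrite leqn0 => /eqP ->.
rewrite leq_eqVlt => /predU1P[->//|jk].
by apply: le_trans (p_anti kN) _; exact: (IH (leh_leq (leqnSn k) kN)).
Qed.

Lemma weight_leq j k : leh k N -> (j <= k)%N -> w j <= w k.
Proof. by move=> kN jk; rewrite lee_pV2 ?inE//; exact: gauge_leq. Qed.

Lemma meet_kernel_eq K xi eta : leh K N -> sval xi K = sval eta K ->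
  meet_kernel K xi eta = w K.
Proof.
move=> KN E; rewrite /meet_kernel big1 => [|k _].
  by rewrite add0e indicE mem_set//= mule1.
rewrite indicE memNset ?mule0//= => -[_] []; apply/esym.
by apply: (ray_agree_leq heightT KN) E.
Qed.

Lemma meet_kernel_neq K xi eta : leh K N -> sval xi K <> sval eta K ->
  meet_kernel K xi eta = (gauge_at p (meet_level N xi eta))^-1.
Proof.
move=> KN ne; have [m [mK -> eqm nem]] := meet_level_lt KN ne.
rewrite /meet_kernel [X in _ + w K * X](_ : _ = 0) ?mule0 ?adde0; last first.
  by rewrite indicE memNset// => /esym.
rewrite (bigD1 (Ordinal mK))//= big1 ?adde0 => [|k].
  rewrite indicE mem_set ?mule1//; split => /=; first by rewrite /cylinder/= eqm.
  by move/esym.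
rewrite -val_eqE /= indicE => km; rewrite memNset ?mule0// => -[/= e1 e2].
have [lkm|lmk|E] := ltngtP k m; last by rewrite E eqxx in km.
  apply: e2; apply/esym; apply: (ray_agree_leq heightT _ _ eqm) => //.
  exact: leh_leq (ltnW mK) KN.
apply: nem; apply: (ray_agree_leq heightT _ lmk) (esym e1).
by apply: (leh_leq _ KN); exact: ltnW.
Qed.

(** Rays that agree at level K meet at level K or deeper; if they meet at infinity, p(K) is compared
    with the limit of the nonincreasing gauge. *)
Lemma weight_le_gauge K xi eta : leh K N -> sval xi K = sval eta K ->
  w K <= (gauge_at p (meet_level N xi eta))^-1.
Proof.
move=> KN /(meet_level_ge heightT KN).
case: (meet_level N xi eta) => [m [Km mN]|NN] /=; first exact: weight_leq.
have ni : nonincreasing_seq p.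
  by move=> i j ij; apply: gauge_leq => //; rewrite NN.
have cv := ereal_nonincreasing_is_cvgn ni.
rewrite lee_pV2 ?inE//; first by apply: lime_le => //; exists K => // j /= /ni.
by apply: lime_ge => //; exact: nearW.
Qed.

Lemma meet_kernel_le K xi eta : leh K N ->
  meet_kernel K xi eta <= (gauge_at p (meet_level N xi eta))^-1.
Proof.
move=> KN; have [E|ne] := pselect (sval xi K = sval eta K).
  by rewrite meet_kernel_eq//; exact: weight_le_gauge.
by rewrite meet_kernel_neq.
Qed.

Lemma meet_kernel_height n xi eta : N = Some n ->
  meet_kernel n xi eta = (gauge_at p (meet_level N xi eta))^-1.
Proof.
move=> Nn; have nN : leh n N by rewrite Nn /=.
have [E|ne] := pselect (sval xi n = sval eta n); last by rewrite meet_kernel_neq.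
rewrite meet_kernel_eq//; have := meet_level_ge heightT nN E.
case: (meet_level N xi eta) => [m [nm]|]; last by rewrite Nn.
by rewrite Nn /= => mn; congr (p _)^-1; apply/eqP; rewrite eqn_leq nm mn.
Qed.

Variable mu : probability (boundary T) R.

Definition mass k s : R := fine (mu (cylinder k s)).

Lemma mass_ge0 k s : (0 <= mass k s)%R.
Proof. exact: fine_ge0. Qed.

Lemma massE k s : mu (cylinder k s) = (mass k s)%:E.
Proof. by rewrite fineK//; exact: fin_num_measure (measurable_cylinder k s). Qed.

Lemma mass_ray k xi : leh k.+1 N -> (mass k.+1 (sval xi k.+1) <= mass k (sval xi k))%R.
Proof.
move=> kN; rewrite -lee_fin -!massE le_measure ?inE//; try exact: measurable_cylinder.
by move=> eta /= E; apply: (ray_agree_leq heightT kN).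
Qed.

Lemma measure_split_set k xi : leh k.+1 N ->
  mu (split_set k xi) = (mass k (sval xi k) - mass k.+1 (sval xi k.+1))%:E.
Proof.
move=> kN; rewrite EFinB -!massE measureD; try exact: measurable_cylinder.
  congr (_ - mu _); apply/setIidPr => eta /= E.
  by apply: (ray_agree_leq heightT kN).
exact: le_lt_trans (probability_le1 _ (measurable_cylinder _ _)) (ltry _).
Qed.

Lemma level_functionE k (c : T -> R) xi : leh k N ->
  c (sval xi k) = (\sum_(s <- generation T k) c s * \1_(cylinder k s) xi)%R.
Proof.
move=> kN; have gk : sval xi k \in generation T k.
  by rewrite in_generation (ray_level heightT).
rewrite (bigD1_seq _ gk (fset_uniq _))/= big1 => [|s /eqP sk].
  by rewrite indicE mem_set// mulr1 addr0.
by rewrite indicE memNset ?mulr0// => /esym.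
Qed.

Lemma measurable_level_function k (c : T -> R) : leh k N ->
  measurable_fun setT (fun xi => (c (sval xi k))%:E).
Proof.
move=> kN; apply/measurable_EFinP.
rewrite (_ : (fun xi => _) = (fun xi => \sum_(s <- generation T k) c s * \1_(cylinder k s) xi)%R).
  by apply: measurable_sum => s; apply: measurable_funM => //; apply: measurable_indic;
    exact: measurable_cylinder.
by apply/funext => xi; exact: level_functionE.
Qed.

Lemma integral_level_function k (c : T -> R) : leh k N -> (forall s, 0 <= c s)%R ->
  \int[mu]_xi (c (sval xi k))%:E = (\sum_(s <- generation T k) c s * mass k s)%:E.
Proof.
move=> kN c0.
under eq_integral do rewrite (level_functionE _ _ kN) -sumEFin.
rewrite ge0_integral_sum//.
- rewrite -sumEFin; apply: eq_bigr => s _; under eq_integral do rewrite EFinM.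
  rewrite ge0_integralZl//.
  + rewrite integral_indic//; last exact: measurable_cylinder.
    by rewrite setIT EFinM; congr (_ * _); exact: massE.
  + by apply/measurable_EFinP/measurable_indic; exact: measurable_cylinder.
  + by rewrite lee_fin.
- by move=> s; apply/measurable_EFinP/measurable_funM => //; apply: measurable_indic;
    exact: measurable_cylinder.
- by move=> s xi _; rewrite lee_fin mulr_ge0.
Qed.

(** The probability that two independent rays of law [mu] pass through the same vertex of level
    k. *)
Definition collision k : R := (\sum_(s <- generation T k) mass k s * mass k s)%R.

Lemma sum_mass k : leh k N -> (\sum_(s <- generation T k) mass k s)%R = 1%R.
Proof.
move=> kN; have := integral_level_function kN (c := fun=> 1%R) (fun=> ler01).
rewrite (_ : \int[mu]_xi _ = 1) => [[->]|].
  by apply: eq_bigr => s _; rewrite mul1r.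
by have := integral_cst mu measurableT 1; rewrite mul1e => ->; exact: probability_setT.
Qed.

Lemma integral_mass_drop k : leh k.+1 N ->
  \int[mu]_xi (mass k (sval xi k) - mass k.+1 (sval xi k.+1))%:E =
  (collision k - collision k.+1)%:E.
Proof.
move=> kN; have kN' := leh_leq (leqnSn k) kN.
(* Moving the negative term to the other side leaves an identity between integrals of nonnegative
   functions. *)
suff : (collision k.+1)%:E + \int[mu]_xi (mass k (sval xi k) - mass k.+1 (sval xi k.+1))%:E =
    (collision k)%:E.
  by case: (\int[mu]_xi _) => // r [<-]; rewrite [X in (X - _)%R]addrC addrK.
rewrite -!integral_level_function//; try exact: mass_ge0.
rewrite -ge0_integralD//; first by apply: eq_integral => xi _; rewrite -EFinD subrKC.
- by move=> xi _; rewrite lee_fin mass_ge0.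
- exact: measurable_level_function.
- by move=> xi _; rewrite lee_fin subr_ge0 mass_ray.
- by under eq_fun do rewrite EFinB; apply: emeasurable_funB; exact: measurable_level_function.
Qed.

Lemma integral_meet_kernel K xi : leh K N ->
  \int[mu]_eta meet_kernel K xi eta =
  \sum_(k < K) w k * (mass k (sval xi k) - mass k.+1 (sval xi k.+1))%:E
  + w K * (mass K (sval xi K))%:E.
Proof.
move=> KN.
have mI C : measurable C -> measurable_fun setT (fun eta : boundary T => (\1_C eta : R)%:E).
  by move=> mC; apply/measurable_EFinP/measurable_indic.
have I0 (C : set (boundary T)) eta : 0 <= (\1_C eta : R)%:E by rewrite lee_fin.
have ZI k C : measurable C -> \int[mu]_eta (w k * (\1_C eta)%:E) = w k * mu C.
  move=> mC; rewrite ge0_integralZl ?weight_ge0//; last exact: mI.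
  by rewrite integral_indic ?setIT.
rewrite ge0_integralD//=.
- rewrite ge0_integral_sum//.
  + rewrite ZI; last exact: measurable_cylinder.
    congr (_ + _ * _); last exact: massE.
    apply: eq_bigr => k _; rewrite ZI; last exact: measurable_split_set.
    by rewrite measure_split_set//; exact: leh_leq KN.
  + by move=> k; apply: measurable_funeM; apply: mI; exact: measurable_split_set.
  + by move=> k eta _; rewrite mule_ge0 ?weight_ge0.
- by move=> eta _; rewrite sume_ge0// => k _; rewrite mule_ge0 ?weight_ge0.
- apply: emeasurable_sum => k; apply: measurable_funeM; apply: mI.
  exact: measurable_split_set.
- by move=> eta _; rewrite mule_ge0 ?weight_ge0.
- by apply: measurable_funeM; apply: mI; exact: measurable_cylinder.
Qed.

Lemma integral2_meet_kernel K : leh K N ->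
  \int[mu]_xi \int[mu]_eta meet_kernel K xi eta =
  \sum_(k < K) w k * (collision k - collision k.+1)%:E + w K * (collision K)%:E.
Proof.
move=> KN; have kN (k : 'I_K) : leh k.+1 N by exact: leh_leq KN.
under eq_integral do rewrite (integral_meet_kernel _ KN).
have md (k : 'I_K) : measurable_fun setT
    (fun xi : boundary T => (mass k (sval xi k) - mass k.+1 (sval xi k.+1))%:E).
  under eq_fun do rewrite EFinB; apply: emeasurable_funB; apply: measurable_level_function => //.
  exact: leh_leq (leqnSn k) (kN k).
have d0 (k : 'I_K) (xi : boundary T) :
    0 <= (mass k (sval xi k) - mass k.+1 (sval xi k.+1))%:E.
  by rewrite lee_fin subr_ge0 mass_ray.
have m0 (xi : boundary T) : 0 <= (mass K (sval xi K))%:E by rewrite lee_fin mass_ge0.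
rewrite ge0_integralD//=.
- rewrite ge0_integral_sum//.
  + rewrite ge0_integralZl ?weight_ge0//; last exact: measurable_level_function.
    rewrite integral_level_function//; last exact: mass_ge0.
    congr (_ + _); apply: eq_bigr => k _; rewrite ge0_integralZl ?weight_ge0//.
    by rewrite integral_mass_drop.
  + by move=> k; exact: measurable_funeM.
  + by move=> k xi _; rewrite mule_ge0 ?weight_ge0.
- by move=> xi _; rewrite sume_ge0// => k _; rewrite mule_ge0 ?weight_ge0.
- by apply: emeasurable_sum => k; exact: measurable_funeM.
- by move=> xi _; rewrite mule_ge0 ?weight_ge0.
- by apply: measurable_funeM; exact: measurable_level_function.
Qed.

Local Notation g := (level_size T).

(** Expand the nonnegative sum of the squared deviations of the masses from 1 / |Gamma_k|; the
    masses add up to 1. *)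
Lemma collision_ge k : leh k N -> ((g k)%:R^-1 <= collision k)%R.
Proof.
move=> kN; set a : R := (g k)%:R^-1%R.
have g0 : ((g k)%:R : R) != 0%R by rewrite pnatr_eq0 -lt0n (level_size_gt0 heightT).
have : (0 <= \sum_(s <- generation T k) (mass k s - a) ^+ 2)%R.
  by apply: sumr_ge0 => s _; exact: sqr_ge0.
rewrite (eq_bigr (fun s => mass k s * mass k s + (- (a *+ 2) * mass k s + a * a))%R); last first.
  by move=> s _; ring.
rewrite !big_split/= -mulr_sumr sum_mass// big_const_seq count_predT iter_addr_0.
rewrite -/(g k) -/(collision k) -[X in (_ + (_ + X))%R]mulr_natl mulrA mulfV// mul1r.
by rewrite mulr1 => ?; lra.
Qed.

Lemma collision_anti k : leh k.+1 N -> (collision k.+1 <= collision k)%R.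
Proof.
move=> kN; rewrite -subr_ge0 -lee_fin -integral_mass_drop//.
by apply: integral_ge0 => xi _; rewrite lee_fin subr_ge0 mass_ray.
Qed.

(** The truncated kernel lies below the kernel of the energy, and its double integral is a finite
    sum, to which summation by parts applies with 1 / |Gamma_k| as lower bound for the collision
    probabilities. *)
Lemma energy_ge K : leh K N ->
  \sum_(k < K) w k * ((g k)%:R^-1 - (g k.+1)%:R^-1)%:E + w K * ((g K)%:R^-1)%:E <=
  energy N p mu.
Proof.
move=> KN; have KNl k : (k <= K)%N -> leh k N by move=> kK; exact: leh_leq KN.
apply: (@le_trans _ _ (\int[mu]_xi \int[mu]_eta meet_kernel K xi eta)); last first.
  have k0 xi eta : 0 <= meet_kernel K xi eta.
    by rewrite adde_ge0 ?sume_ge0//= => *; rewrite mule_ge0 ?weight_ge0 ?lee_fin.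
  apply: ge0_le_lower_integral => xi; first exact: integral_ge0.
  by apply: ge0_le_lower_integral => // eta; exact: meet_kernel_le.
rewrite integral2_meet_kernel//.
apply: le_trans (@abel_le R (fun k => w k) collision (fun k => (g k)%:R^-1%R) K _ _ _ _ _ _).
- by rewrite leeDl// mule_ge0 ?weight_ge0// lee_fin subr_ge0; apply: collision_ge; exact: KNl.
- by move=> k _; exact: weight_ge0.
- by move=> k kK; apply: weight_leq => //; exact: KNl.
- by move=> k kK; apply: collision_ge; exact: KNl.
- by move=> k kK; apply: collision_anti; exact: KNl.
- move=> k kK; rewrite lef_pV2 ?posrE ?ltr0n ?(level_size_gt0 heightT)//; try exact: KNl.
    by rewrite ler_nat (level_size_leS heightT)//; exact: lth_leh KN.
  by apply: KNl; exact: ltnW.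
- by rewrite invr_ge0.
Qed.

Lemma inverse_sum_le_energy : inverse_sum N p g <= energy N p mu.
Proof.
case EN : N => [n|] /=; rewrite -[in leRHS]EN.
  by rewrite addeC big_mkord; apply: energy_ge; rewrite EN /=.
apply: lime_le.
  apply: is_cvg_nneseries => k _ _; rewrite mule_ge0 ?weight_ge0// lee_fin subr_ge0.
  rewrite lef_pV2 ?posrE ?ltr0n ?(level_size_gt0 heightT) ?EN//.
  by rewrite ler_nat (level_size_leS heightT)// EN.
apply: nearW => K; have KN : leh K N by rewrite EN.
apply: le_trans (energy_ge KN); rewrite big_mkord leeDl//.
by rewrite mule_ge0 ?weight_ge0// lee_fin invr_ge0.
Qed.

Hypothesis equidistributed : forall k s, leh k N -> level s = k ->
  mu (cylinder k s) = ((g k)%:R^-1)%:E.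
Hypothesis unbounded : N = None -> forall m : nat, exists n, (m <= g n)%N.

Lemma mass_equidistributed k xi : leh k N -> mass k (sval xi k) = (g k)%:R^-1%R.
Proof. by move=> kN; rewrite /mass equidistributed// (ray_level heightT). Qed.

(** A ray lies in cylinders of mass 1 / |Gamma_n| for all n, and unbounded level sizes make these
    arbitrarily small. Hence the diagonal contributes nothing to the energy. *)
Lemma singleton_null xi : N = None -> measurable [set xi] /\ mu [set xi] = 0.
Proof.
move=> NN; have E : [set xi] = \bigcap_k cylinder k (sval xi k).
  apply/seteqP; split => [eta -> //|eta /= h]; apply: (@ray_ext T) => k.
  exact: (h k).
have mx : measurable [set xi].
  by rewrite E; apply: bigcap_measurable => // k _; exact: measurable_cylinder.
split => //; apply/eqP; rewrite eq_le measure_ge0 andbT; apply/lee_addgt0Pr => e e0.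
have [n en] := unbounded NN (Num.truncn e^-1%R).+1.
rewrite add0e; apply: (@le_trans _ _ (mu (cylinder n (sval xi n)))).
  rewrite le_measure ?inE//; first exact: measurable_cylinder.
  by move=> eta ->.
have nN : leh n N by rewrite NN.
rewrite equidistributed//; last exact: (ray_level heightT).
rewrite lee_fin invf_ple ?posrE ?ltr0n ?(level_size_gt0 heightT)//.
apply: le_trans (_ : ((Num.truncn e^-1%R).+1%:R <= _)%R); last by rewrite ler_nat.
by apply: ltW; exact: truncnS_gt.
Qed.

Lemma integral_constant (f : boundary T -> \bar R) (c : \bar R) :
  (forall xi, f xi = c) -> \int[mu]_xi f xi = c.
Proof.
move=> fc; rewrite (_ : f = cst c); last exact/funext.
by rewrite integral_cst//= [X in c * X]probability_setT mule1.
Qed.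

Lemma energy_equidistributed : energy N p mu = inverse_sum N p g.
Proof.
have term0 k : leh k.+1 N -> 0 <= w k * ((g k)%:R^-1 - (g k.+1)%:R^-1)%:E.
  move=> kN; have kN' := leh_leq (leqnSn k) kN.
  rewrite mule_ge0 ?weight_ge0// lee_fin subr_ge0.
  rewrite lef_pV2 ?posrE ?ltr0n ?(level_size_gt0 heightT)//.
  by rewrite ler_nat (level_size_leS heightT)//; exact: lth_leh kN.
apply/eqP; rewrite eq_le inverse_sum_le_energy andbT; case EN : N => [n|] /=.
  have nN : leh n N by rewrite EN /=.
  rewrite -EN /energy (@integral_constant _ (inverse_sum N p g)) ?EN// => xi.
  rewrite -EN; under eq_integral do rewrite -(meet_kernel_height _ _ EN).
  rewrite integral_meet_kernel// EN /= addeC big_mkord mass_equidistributed//.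
  congr (_ + _); apply: eq_bigr => k _; rewrite !mass_equidistributed//.
    exact: leh_leq nN.
  by apply: leh_leq nN; exact: ltnW.
have kN k : leh k N by rewrite EN.
(* A majorant of the kernel whose series part integrates to the inverse sum. On the diagonal it is
   simply +oo, which costs nothing since singletons are null. *)
pose h xi eta := \sum_(0 <= k <oo) w k * (\1_(split_set k xi) eta)%:E
  + +oo * (\1_[set xi] eta)%:E.
have h0 xi eta : 0 <= \sum_(0 <= k <oo) w k * (\1_(split_set k xi) eta)%:E.
  by apply: nneseries_ge0 => k _ _; rewrite mule_ge0 ?weight_ge0 ?lee_fin.
have le_h xi eta : (gauge_at p (meet_level N xi eta))^-1 <= h xi eta.
  have [->|ne] := pselect (eta = xi).
    rewrite /h indicE mem_set// mule1 addey ?leey//.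
    by rewrite gt_eqF// (lt_le_trans _ (h0 _ _)) ?ltNyr.
  have [n nen] : exists n, sval xi n <> sval eta n.
    apply: contrapT => no; apply: ne; apply: (@ray_ext T) => n.
    by apply: contrapT => nen; apply: no; exists n => /esym.
  rewrite -(meet_kernel_neq (kN n) nen) /h /meet_kernel.
  rewrite [X in _ + w n * X](_ : _ = 0); last by rewrite indicE memNset// => /esym.
  rewrite [X in _ <= _ + _ * X](_ : _ = 0); last by rewrite indicE memNset.
  rewrite !mule0 !adde0 -(big_mkord xpredT (fun k => w k * (\1_(split_set k xi) eta)%:E)).
  by apply: nneseries_lim_ge => k _ _; rewrite mule_ge0 ?weight_ge0 ?lee_fin.
apply: (@le_trans _ _ (\int[mu]_xi \int[mu]_eta h xi eta)).
  have g0 xi eta : 0 <= (gauge_at p (meet_level N xi eta))^-1.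
    by apply: le_trans (meet_kernel_le xi eta (kN 0%N)); rewrite /meet_kernel big_ord0 add0e
      mule_ge0 ?weight_ge0 ?lee_fin.
  rewrite -EN; apply: ge0_le_lower_integral => xi; first exact: integral_ge0.
  exact: ge0_le_lower_integral.
rewrite (@integral_constant _ (\sum_(0 <= k <oo) w k * ((g k)%:R^-1 - (g k.+1)%:R^-1)%:E))// => xi.
have [mx x0] := singleton_null xi EN.
have mI C : measurable C -> measurable_fun setT (fun eta : boundary T => (\1_C eta : R)%:E).
  by move=> mC; apply/measurable_EFinP/measurable_indic.
rewrite ge0_integralD//=.
- rewrite ge0_integralZl//; last exact: mI.
  rewrite integral_indic// setIT [X in _ + _ * X]x0 mule0 adde0.
  rewrite integral_nneseries//.
  + apply: eq_eseriesr => k _; rewrite ge0_integralZl ?weight_ge0//.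
    * rewrite integral_indic ?setIT//; last exact: measurable_split_set.
      by rewrite [X in _ * X]measure_split_set// !mass_equidistributed.
    * by apply: mI; exact: measurable_split_set.
  + by move=> k; apply: measurable_funeM; apply: mI; exact: measurable_split_set.
  + by move=> k eta _; rewrite mule_ge0 ?weight_ge0 ?lee_fin.
- apply: ge0_emeasurable_sum => [k eta _ _|k _].
    by rewrite mule_ge0 ?weight_ge0 ?lee_fin.
  by apply: measurable_funeM; apply: mI; exact: measurable_split_set.
- by apply: measurable_funeM; exact: mI.
Qed.

End Energy.

(** * The uniform measure on the boundary of a spherically symmetric tree *)

Section UniformRay.
Variables (R : realType) (T : rooted_tree) (N : option nat).
Hypothesis heightT : has_height T N.
Variable F : nat -> nat.
Hypothesis card_kids : forall s : T, lth (level s) N -> #|` kids s| = F (level s).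
Local Notation g := (level_size T).

Lemma level_size_regular k : lth k N -> g k.+1 = (g k * F k)%N.
Proof.
move=> kN; rewrite [LHS](_ : _ = (\sum_(t <- generation T k.+1) 1)%N); last first.
  by rewrite sum1_size.
rewrite big_generationS [in LHS]big_seq.
rewrite (eq_bigr (fun=> F k)) => [|s]; last first.
  rewrite in_generation sum1_size => /eqP sk; rewrite -sk.
  by have := @card_kids s; rewrite sk => ->.
by rewrite -big_seq big_const_seq count_predT iter_addn_0 mulnC.
Qed.

Lemma branching_gt0 k : lth k N -> (0 < F k)%N.
Proof.
move=> kN; have kN' : leh k.+1 N by case: N kN.
by have := level_size_gt0 heightT kN'; rewrite level_size_regular// muln_gt0 => /andP[].
Qed.

(** A mixed-radix numbering of each level: vertex j of level n + 1 is the child of rank j mod F n of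
    vertex j / F n, so an integer division gives the number of the parent. *)
Fixpoint nth_vertex (n j : nat) : T :=
  if n is m.+1 then nth tree_root (kids (nth_vertex m (j %/ F m)%N)) (j %% F m)%N
  else tree_root.

Lemma leh_lthS k : leh k.+1 N -> lth k N.
Proof. by case: N. Qed.

Lemma level_nth_vertex n j : leh n N -> (j < g n)%N -> level (nth_vertex n j) = n.
Proof.
elim: n j => [|n IH] j nN jn /=; first exact: level_tree_root.
have nlt := leh_lthS nN; have F0 := branching_gt0 nlt.
have lv : level (nth_vertex n (j %/ F n)%N) = n.
  by apply: (IH _ (leh_leq (leqnSn n) nN)); rewrite ltn_divLR// -level_size_regular.
rewrite -[RHS](congr1 S lv); apply: level_kid; apply: mem_nth.
by rewrite card_kids lv// ltn_mod.
Qed.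

Lemma nth_vertexS_kid n j : leh n.+1 N -> (j < g n.+1)%N ->
  nth_vertex n.+1 j \in kids (nth_vertex n (j %/ F n)%N).
Proof.
move=> nN jn; have nlt := leh_lthS nN; have F0 := branching_gt0 nlt.
have lv : level (nth_vertex n (j %/ F n)%N) = n.
  apply: (level_nth_vertex (leh_leq (leqnSn n) nN)).
  by rewrite ltn_divLR// -level_size_regular.
by apply: mem_nth; rewrite card_kids lv// ltn_mod.
Qed.

Lemma vertex_number n s : leh n N -> level s = n ->
  exists2 j, (j < g n)%N & forall i, (i < g n)%N -> (nth_vertex n i == s) = (i == j).
Proof.
elim: n s => [|n IH] s nN sn.
  rewrite (level_eq0 sn) level_size0; exists 0%N => // i.
  by rewrite ltnS leqn0 => /eqP -> /=; rewrite !eqxx.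
have nlt := leh_lthS nN; have F0 := branching_gt0 nlt.
have str : s <> tree_root by move=> E; rewrite E level_tree_root in sn.
have pn : level (parent s) = n by have := level_parent str; rewrite sn => -[].
have sk : s \in kids (parent s) by rewrite in_kids eqxx andbT; exact/eqP.
have [j jn jP] := IH _ (leh_leq (leqnSn n) nN) pn.
have szF : size (kids (parent s)) = F n by rewrite -pn -card_kids// pn.
have iF : (index s (kids (parent s)) < F n)%N by rewrite -szF index_mem.
exists (j * F n + index s (kids (parent s)))%N.
  by rewrite level_size_regular//; nia.
move=> i ig; have dg : (i %/ F n < g n)%N by rewrite ltn_divLR// -level_size_regular.
apply/eqP/eqP => [E|->]; last first.
  rewrite /= divnMDl// divn_small// addn0 modnMDl modn_small//.
  by rewrite (eqP (_ : nth_vertex n j == parent s)) ?jP// nth_index.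
have := nth_vertexS_kid nN ig; rewrite E in_kids => /andP[_ /eqP pE].
have dj : (i %/ F n)%N = j by apply/eqP; rewrite -jP// pE.
rewrite [LHS](divn_eq i (F n)) dj; congr (_ + _)%N.
by rewrite -{1}E /= -pE index_uniq ?fset_uniq// szF ltn_mod.
Qed.

Lemma parent_nth_vertex n j : leh n.+1 N -> (j < g n.+1)%N ->
  children (nth_vertex n (j %/ F n)%N) (nth_vertex n.+1 j).
Proof. by move=> nN /(nth_vertexS_kid nN); rewrite in_kids => /andP[/eqP ? /eqP]. Qed.

(** Rays of a tree of finite height stay at their leaf from that level on. *)
Definition capped (k : nat) : nat := if N is Some n then minn k n else k.

Lemma leh_capped k : leh (capped k) N.
Proof. by rewrite /capped; case: N => //= n; exact: geq_minr. Qed.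

Lemma cappedE k : leh k N -> capped k = k.
Proof. by rewrite /capped; case: N => //= n /minn_idPl. Qed.

Lemma truncn_scale_lt (x : R) n : (0 <= x < 1)%R -> leh n N ->
  (Num.truncn (x * (g n)%:R)%R < g n)%N.
Proof.
move=> /andP[x0 x1] nN; have g0 := level_size_gt0 heightT nN.
rewrite -(ltr_nat R); apply: (@le_lt_trans _ _ (x * (g n)%:R)%R).
  by rewrite truncn_le mulr_ge0.
by rewrite gtr_pMl ?ltr0n.
Qed.

(** Makes the vertices read off from one real at successive levels consistent: the number at level k
    is the quotient of the number at level k + 1. *)
Lemma truncn_divn (y : R) m : (0 <= y)%R -> (0 < m)%N ->
  (Num.truncn (y * m%:R)%R %/ m)%N = Num.truncn y.
Proof.
move=> y0 m0; have m0' : (0 < m%:R :> R)%R by rewrite ltr0n.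
have /andP[lo up] := truncn_itv (mulr_ge0 y0 (ltW m0')).
set j := Num.truncn (y * m%:R)%R in lo up *.
apply/esym/truncn_def; apply/andP; split.
  rewrite -(ler_pM2r m0') -natrM; apply: le_trans lo; rewrite ler_nat.
  exact: leq_trunc_div.
rewrite -(ltr_pM2r m0') -natrM; apply: lt_le_trans up _; rewrite ler_nat.
exact: ltn_ceil.
Qed.

(** Cut [0, 1[ into |Gamma_k| equal intervals: the vertex at level k is the one numbered by the
    interval that contains x. *)
Definition path_of (x : R) k : T :=
  nth_vertex (capped k) (Num.truncn (x * (g (capped k))%:R)%R).

Lemma is_ray_path_of x : (0 <= x < 1)%R -> is_ray (path_of x).
Proof.
move=> x01; have /andP[x0 x1] := x01; split.
  by rewrite /path_of /= cappedE//; case: N.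
move=> k; have [kN|kN] : lth k N \/ ~ lth k N by exact: EM.
  left; have kN1 : leh k.+1 N by case: N kN.
  have kN0 := leh_leq (leqnSn k) kN1.
  rewrite /path_of !cappedE//.
  have := parent_nth_vertex kN1 (truncn_scale_lt x01 kN1).
  rewrite [in X in _ -> X]level_size_regular// (_ : (_ %/ F k)%N = Num.truncn (x * (g k)%:R)%R).
    by rewrite level_size_regular.
  rewrite level_size_regular// natrM mulrA truncn_divn ?mulr_ge0//.
  exact: branching_gt0.
right; have [n EN] : exists n, N = Some n by case: N kN => [n|] //=; exists n.
have nk : (n <= k)%N by rewrite leqNgt; apply/negP => nk; apply: kN; rewrite EN.
have c1 : capped k = n by rewrite /capped EN; exact/minn_idPr.
have c2 : capped k.+1 = n by rewrite /capped EN; apply/minn_idPr/leqW.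
split; last by rewrite /path_of c1 c2.
have nN : leh n N by rewrite EN /=.
apply/heightT; rewrite /path_of c1 EN; congr Some; apply/esym.
by apply: level_nth_vertex => //; exact: truncn_scale_lt.
Qed.

(** Makes [path_of] a ray for every real; the points that are moved are null for the uniform law on
    [0, 1]. *)
Definition clip (x : R) : R := if (0 <= x < 1)%R then x else 0%R.

Lemma clip_itv x : (0 <= clip x < 1)%R.
Proof. by rewrite /clip; case: ifP => //; rewrite lexx ltr01. Qed.

Lemma measurable_clip : measurable_fun setT clip.
Proof.
apply: measurable_fun_if => //=.
by apply: measurable_and; [exact: measurable_fun_ler|exact: measurable_fun_ltr].
Qed.

Definition uniform_ray (x : measurableTypeR R) : boundary T := exist _ _ (is_ray_path_of (clip_itv x)).

Lemma uniform_ray_cylinder k s : leh k N -> level s = k ->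
  exists2 j, (j < g k)%N & uniform_ray @^-1` (cylinder k s) =
    clip @^-1` `[(j%:R / (g k)%:R)%R, (j.+1%:R / (g k)%:R)%R[%classic.
Proof.
move=> kN sk; have [j jg jP] := vertex_number kN sk; exists j => //.
have g0 : (0 < (g k)%:R :> R)%R by rewrite ltr0n (level_size_gt0 heightT).
apply/funext => x; apply/propext; rewrite /preimage/cylinder/= /path_of cappedE// in_itv/=.
have /andP[c0 _] := clip_itv x.
rewrite ler_pdivrMr// ltr_pdivlMr//.
have E := jP _ (truncn_scale_lt (clip_itv x) kN).
split => [/eqP|h]; first by rewrite E => /eqP <-; apply: truncn_itv; rewrite mulr_ge0.
by apply/eqP; rewrite E (truncn_def h).
Qed.

Lemma measurable_uniform_ray : measurable_fun setT uniform_ray.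
Proof.
apply: (@measurability _ _ _ (boundary T) setT uniform_ray (@cylinders T)) => // _ [_ [k [s ->]] <-].
rewrite setTI [X in measurable X](_ : _ = uniform_ray @^-1` cylinder (capped k) s); last first.
  apply/funext => x; apply/propext; rewrite /preimage/cylinder/= /path_of.
  by rewrite [capped (capped k)]cappedE//; exact: leh_capped.
have cN := leh_capped k.
have [E|ne] := eqVneq (level s) (capped k).
  have [j _ ->] := uniform_ray_cylinder cN E.
  by rewrite -[X in measurable X]setTI; apply: measurable_clip.
rewrite (_ : _ @^-1` _ = set0)//; apply/seteqP; split => // x; rewrite /preimage/cylinder/=.
move=> xs; move/eqP: ne; apply; rewrite -xs (ray_level heightT (uniform_ray x) cN)//.
Qed.

HB.instance Definition _ := isMeasurableFun.Build _ _ _ _ uniform_ray measurable_uniform_ray.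

Definition uniform_boundary : probability (boundary T) R :=
  distribution (uniform_prob (@ltr01 R)) uniform_ray.

Lemma uniform_prob01 (A : set R) : measurable A -> A `<=` `[0%R, 1%R] ->
  uniform_prob (@ltr01 R) A = lebesgue_measure A.
Proof.
move=> mA A01; rewrite /uniform_prob (eq_integral (cst 1)).
  by rewrite integral_cst// mul1e.
by move=> x /[!inE] /A01; rewrite /= in_itv/= /uniform_pdf => ->; rewrite subr0 invr1.
Qed.

Lemma uniform_boundary_cylinder k s : leh k N -> level s = k ->
  uniform_boundary (cylinder k s) = ((g k)%:R^-1)%:E.
Proof.
move=> kN sk; rewrite /uniform_boundary /distribution /pushforward/=.
have [j jg ->] := uniform_ray_cylinder kN sk.
have g0 : (0 < (g k)%:R :> R)%R by rewrite ltr0n (level_size_gt0 heightT).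
set I := `[_, _[%classic; set A := _ @^-1` _.
have mA : measurable A by rewrite -[A]setTI; apply: measurable_clip => //; exact: measurable_itv.
have m01 : measurable (`[0%R, 1%R[%classic : set R) by [].
have I01 : I `<=` `[0%R, 1%R[%classic.
  move=> x; rewrite /I/= !in_itv/= => /andP[xj jx]; apply/andP; split.
    by apply: le_trans xj; rewrite divr_ge0.
  by apply: lt_le_trans jx _; rewrite ler_pdivrMr// mul1r ler_nat.
pose U : probability (measurableTypeR R) R := uniform_prob (@ltr01 R).
have UE (J : set R) : measurable J -> J `<=` `[0%R, 1%R[%classic ->
    U J = lebesgue_measure J.
  move=> mJ J01; apply: uniform_prob01 => // x /J01; rewrite /= !in_itv/= => /andP[-> /ltW].
  by [].
have U01 : U (~` `[0%R, 1%R[%classic) = 0.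
  rewrite probability_setC// (UE _ m01)// lebesgue_measure_itv/= lte_fin ltr01.
  by rewrite oppr0 adde0 subee.
change (U A = ((g k)%:R^-1)%:E).
(* Outside [0, 1[ the preimage may contain extra points because of [clip], but that part is null. *)
rewrite (measureDI U mA m01) [X in X + _](_ : _ = 0) ?add0e; last first.
  apply/eqP; rewrite eq_le measure_ge0 andbT -U01 le_measure ?inE//.
  - exact: measurableD.
  - exact: measurableC.
have AI : A `&` `[0%R, 1%R[%classic = I.
  apply/seteqP; split => x; rewrite /A/preimage/=.
    by case=> + x01; rewrite /clip; rewrite in_itv/= in x01; rewrite x01.
  by move=> Ix; have := I01 _ Ix; rewrite /= in_itv/= => x01; split => //; rewrite /clip x01.
have lt_ends : (j%:R / (g k)%:R < j.+1%:R / (g k)%:R :> R)%R.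
  by rewrite ltr_pM2r ?invr_gt0// ltr_nat.
rewrite AI; apply: (etrans (UE I _ I01)); first exact: measurable_itv.
rewrite /I lebesgue_measure_itv/= lte_fin lt_ends -EFinB -mulrBl -natrB// subSnn.
by rewrite mul1r.
Qed.

Lemma capacity_regular (p : nat -> \bar R) :
  (forall k, 0 <= p k) -> (forall k, leh k.+1 N -> p k.+1 <= p k) ->
  (N = None -> forall m : nat, exists n, (m <= g n)%N) ->
  capacity T N p = (inverse_sum N p g)^-1.
Proof.
move=> p0 pS gy; rewrite /capacity; congr (_^-1); apply/eqP.
rewrite eq_le; apply/andP; split.
  apply: ge_ereal_inf; exists (energy N p uniform_boundary); first by exists uniform_boundary.
  rewrite energy_equidistributed// => k s; exact: uniform_boundary_cylinder.
by apply: le_ereal_inf_tmp => _ [nu _ <-]; exact: inverse_sum_le_energy.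
Qed.

End UniformRay.

(** * A tree with prescribed numbers of children *)

Section RegularTree.
Variables (F : nat -> nat) (N : option nat).
Hypothesis F_gt0 : forall k, lth k N -> (0 < F k)%N.

Definition ltho (k : nat) : bool := if N is Some n then (k < n)%N else true.

Lemma lthoP k : reflect (lth k N) (ltho k).
Proof. by rewrite /ltho; case: N => [n|] /=; [exact: idP|constructor]. Qed.

(* A vertex is the word of the birth ranks on its path to the root, the
   youngest first. *)
Fixpoint valid_word (s : seq nat) : bool :=
  if s is j :: s' then [&& (j < F (size s'))%N, ltho (size s') & valid_word s'] else true.

Definition word : Type := {s : seq nat | valid_word s}.
HB.instance Definition _ := Choice.on word.

Definition empty_word : word := exist _ [::] isT.

Lemma valid_behead s : valid_word s -> valid_word (behead s).
Proof. by case: s => //= j s /and3P[]. Qed.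

Definition word_parent (s : word) : word := exist _ (behead (val s)) (valid_behead (valP s)).

Lemma word_level_parent (s : word) : s <> empty_word ->
  size (val s) = (size (val (word_parent s))).+1.
Proof.
case: s => -[|j s] vs //= ne; case: ne.
by rewrite /empty_word; congr exist; exact: eq_irrelevance.
Qed.

Lemma word_children (s t : word) : (t <> empty_word /\ word_parent t = s) <->
  exists2 j, val t = j :: val s & (j < F (size (val s)))%N && ltho (size (val s)).
Proof.
split=> [[te <-]|[j tj jF]].
  case: t te => -[|j t] vt //= te; last by exists j => //; case/and3P: (vt) => -> ->.
  by case: te; rewrite /empty_word; congr exist; exact: eq_irrelevance.
split; first by move=> te; rewrite te in tj.
by apply/val_inj; rewrite /= tj.
Qed.

(** The default [empty_word] stands for an invalid extension; it does not occur for ranks below [F]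
    at levels below the height. *)
Definition word_kid (s : word) (j : nat) : word := insubd empty_word (j :: val s).

Lemma val_word_kid s j : (j < F (size (val s)))%N -> ltho (size (val s)) ->
  val (word_kid s j) = j :: val s.
Proof. by move=> jF sN; rewrite val_insubd /= jF sN (valP s). Qed.

Lemma word_locally_finite (s : word) :
  finite_set [set t | t <> empty_word /\ word_parent t = s].
Proof.
apply: (@sub_finite_set _ _ (word_kid s @` `I_(F (size (val s))))).
  move=> t /= /word_children[j tj /andP[jF sN]]; exists j => //.
  by apply/val_inj; rewrite /= val_word_kid.
by apply: finite_image; exact: finite_II.
Qed.

Definition regular_tree : rooted_tree :=
  @RootedTree word empty_word word_parent (fun s => size (val s))
    erefl word_level_parent word_locally_finite.

Lemma card_regular_children (s : regular_tree) : lth (level s) N ->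
  #|` fset_set (children s)| = F (level s).
Proof.
move=> /lthoP sN.
rewrite (_ : children s = [set` seq_fset tt [seq word_kid s j | j <- iota 0 (F (level s))]]).
  rewrite set_fsetK size_seq_fset undup_id ?size_map ?size_iota//.
  rewrite map_inj_in_uniq ?iota_uniq// => i j; rewrite !mem_iota => /andP[_ iF] /andP[_ jF].
  by move=> /(congr1 val); rewrite !val_word_kid// => -[].
set L := [seq _ | _ <- _]; have memL (t : word) : [set` seq_fset tt L] t <-> t \in L.
  by rewrite -(seq_fsetE tt L t).
apply/seteqP; split => t.
  move/word_children => [j tj /andP[jF _]]; apply/memL/mapP; exists j.
    by rewrite mem_iota.
  by apply/val_inj; rewrite /= val_word_kid.
move/memL/mapP => [j]; rewrite mem_iota => /andP[_ jF] ->; apply/word_children; exists j.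
  by rewrite val_word_kid.
by rewrite jF.
Qed.

Lemma valid_word_size s : valid_word s -> leh (size s) N.
Proof.
case: s => [|j s] /=; first by case: N.
by move=> /and3P[_ /lthoP + _]; case: N.
Qed.

Lemma regular_tree_height : has_height regular_tree N.
Proof.
move=> s; split=> [lf|EN].
  have := valid_word_size (valP s).
  have : ~ lth (level s) N.
    move=> sN; have := card_regular_children sN; rewrite [children s]lf fset_set0 cardfs0.
    by have := F_gt0 sN; case: F.
  rewrite /level/=; case: N => //= n /negP; rewrite -leqNgt => ns sn.
  by congr Some; apply/eqP; rewrite eqn_leq ns sn.
apply/seteqP; split => // t /word_children[j _ /andP[_ /lthoP]].
by rewrite EN /= ltnn.
Qed.

End RegularTree.

(** * The spherically symmetric tree *)

Section SphericalLevels.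
Variables (R : realType) (T S : rooted_tree) (N : option nat).
Hypothesis heightT : has_height T N.
Hypothesis integral_growth : forall n, lth n N -> growth R T n.+1 \is a Num.int.
Let F k : nat := Num.truncn (growth R T k.+1).

Lemma growth_truncn k : lth k N -> growth R T k.+1 = (F k)%:R.
Proof.
move=> kN; rewrite truncnK// natrEint integral_growth//=.
by rewrite divr_ge0.
Qed.

Lemma level_size_growth k : lth k N -> level_size T k.+1 = (level_size T k * F k)%N.
Proof.
move=> kN; apply/eqP; rewrite -(eqr_nat R) natrM -growth_truncn// /growth /= mulrC divfK//.
by rewrite pnatr_eq0 -lt0n (level_size_gt0 heightT)//; case: N kN => //= n /ltnW.
Qed.

Lemma truncn_growth_gt0 k : lth k N -> (0 < F k)%N.
Proof.
move=> kN; have kN' : leh k.+1 N by case: N kN.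
by have := level_size_gt0 heightT kN'; rewrite level_size_growth// muln_gt0 => /andP[].
Qed.

Lemma spherically_symmetric_regular_tree :
  spherically_symmetric (regular_tree F N) N (growth R T).
Proof.
split; first by apply: regular_tree_height => k; exact: truncn_growth_gt0.
by move=> s sN; rewrite card_regular_children// -growth_truncn.
Qed.

Hypothesis spherical : spherically_symmetric S N (growth R T).

Lemma spherical_card_kids (s : S) : lth (level s) N -> #|` kids s| = F (level s).
Proof.
move=> sN; apply/eqP; rewrite -(eqr_nat R) -growth_truncn//.
by apply/eqP; exact: spherical.2.
Qed.

Lemma level_size_spherical k : leh k N -> level_size S k = level_size T k.
Proof.
elim: k => [|k IH] kN; first by rewrite !level_size0.
have kN' : lth k N by case: N kN.
rewrite (level_size_regular spherical_card_kids kN') level_size_growth//.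
by rewrite IH//; exact: leh_leq kN.
Qed.

Lemma inverse_sum_spherical (p : nat -> \bar R) :
  inverse_sum N p (level_size S) = inverse_sum N p (level_size T).
Proof.
have := level_size_spherical; rewrite /inverse_sum; case: N => [n|] gE /=.
  congr (_ * (_^-1%R)%:E + _); first by rewrite gE//=.
  apply: eq_big_nat => k /andP[_ kn]; rewrite !gE//=; exact: ltnW.
by apply: eq_eseriesr => k _; rewrite !gE.
Qed.

Lemma capacity_spherical (p : nat -> \bar R) :
  (forall k, 0 <= p k) -> (forall k, leh k.+1 N -> p k.+1 <= p k) ->
  (N = None -> forall m : nat, exists n, (m <= level_size T n)%N) ->
  capacity S N p = (inverse_sum N p (level_size T))^-1.
Proof.
move=> p0 pS gy; rewrite -inverse_sum_spherical.
apply: (capacity_regular spherical.1 spherical_card_kids p0 pS) => NN m.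
by have [n mn] := gy NN m; exists n; rewrite level_size_spherical// NN.
Qed.

End SphericalLevels.

Theorem theorem4p3 (R : realType) (d : measure_display)
    (Omega : measurableType d) (P : probability Omega R)
    (N : option nat) (Gamma : rooted_tree)
    (X : Gamma -> {RV P >-> R}) (mu : probability R R)
    (B : set {ptws coordinate N -> R}) :
  has_height Gamma N -> iid X mu -> closed B ->
  let f := growth R Gamma in
  let p := hit_prob X B in
  let upper := 2%:E * (inverse_sum N p (level_size Gamma))^-1 in
  [/\ Pr P (connected_to_boundary X B) <= virtual_survival mu B f,
      virtual_survival mu B f <= upper,
      (forall b : nat -> \bar R,
        (forall n, leh n N ->
          \prod_(i < n) mu [set x : R | x%:E <= b i] = p n) ->
        virtual_survival mu B f
          <= virtual_survival mu (@product_target R N b) f /\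
        virtual_survival mu (@product_target R N b) f <= upper) &
      ((forall n, lth n N -> f n.+1 \is a Num.int) ->
        (exists S : rooted_tree, spherically_symmetric S N f) /\
        (forall S : rooted_tree, spherically_symmetric S N f ->
          (N = None -> forall m : nat, exists n, (m <= level_size Gamma n)%N) ->
          upper = 2%:E * capacity S N p))].
Proof.
move=> heightT iidX closedB f p upper; split.
- exact (boundary_le_virtual_survival iidX heightT closedB).
- exact (virtual_survival_upper iidX heightT closedB).
- by move=> b pb; exact (virtual_survival_product iidX heightT closedB pb).
move=> fint; split; first by eexists; exact: (spherically_symmetric_regular_tree heightT fint).
move=> S symS gy; rewrite /upper (capacity_spherical heightT fint symS)//.
  by move=> k; exact: hit_prob_ge0.
by move=> k kN; exact: (hit_probS heightT iidX closedB kN).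
Qed.
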